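(* The general (multi-valued) solution of the Fuchsian linear differential equation $$\Psi_{xx}=-\frac14\,\frac{x^8+14x^4+1}{(x^5-x)^2}\,\Psi$$ is given by $$\Psi(x)=\sqrt{\frac{x^5-x}{x^4-5}}\;\sqrt{\wp\big(\tau(x)|2,2\tau(x)\big)}\;\big(A\,\tau(x)+B\big),\qquad A,B\in\mathbb{C},$$ where the function $\tau(x)$ is determined by inversion of $$x=\frac{\wp(1|2,2\tau)-\wp(2|2,2\tau)}{\wp(\tau|2,2\tau)-\wp(2|2,2\tau)} .$$
   Context: $\wp(z|\omega,\omega')$ is the Weierstrass elliptic function with half-periods $\omega,\omega'$ (period lattice $2\omega\mathbb{Z}+2\omega'\mathbb{Z}$). The variable $\tau$ lies in the upper half-plane, and $\tau(x)$ is any local analytic branch of the inverse of the displayed function, defined away from $x\in\{0,\pm1,\pm i,\infty\}$. Solutions are understood as analytic germs with consistently chosen branches of the square roots, continued analytically (in particular through points with $x^4=5$). *)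

(* Defs.v *)
(* Stdlib reals with Coquelicot's complex numbers. *)
From Stdlib Require Import Reals ZArith.
From Coquelicot Require Import Coquelicot.

Open Scope C_scope.

(* Both structures are given explicitly: [C] also carries a normed-module
   structure over [R], for which differentiability is only real. *)
Definition is_C_derive (f : C -> C) (z l : C) : Prop :=
  @is_derive C_AbsRing C_NormedModule f z l.

Definition holomorphic_on (U : C -> Prop) (f : C -> C) : Prop :=
  forall z : C, U z -> exists l : C, is_C_derive f z l.

Definition connected_set (U : C -> Prop) : Prop :=
  forall V W : C -> Prop, open V -> open W ->
    (forall z, U z -> V z \/ W z) ->
    (exists z, U z /\ V z) -> (exists z, U z /\ W z) ->
    exists z, U z /\ V z /\ W z.

(* Componentwise, like [C_lim]; meaningful when the sequence converges. *)
Definition C_lim_seq (u : nat -> C) : C :=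
  (real (Lim_seq (fun n => Re (u n))), real (Lim_seq (fun n => Im (u n)))).

Definition wp_term (w w' z : C) (m n : Z) : C :=
  let l := 2 * w * RtoC (IZR m) + 2 * w' * RtoC (IZR n) in
  if (Z.eqb m 0 && Z.eqb n 0)%bool then 0
  else 1 / (z - l) ^ 2 - 1 / l ^ 2.

(* Weierstrass function with half-periods [w] and [w'] (periods [2 * w] and
   [2 * w']).  The lattice sum converges absolutely for [z] off the lattice, so
   it is the limit of its partial sums over the squares |m|, |n| <= N. *)
Definition wp (z w w' : C) : C :=
  1 / z ^ 2 +
  C_lim_seq (fun N : nat =>
    sum_n (fun i : nat => sum_n (fun j : nat =>
      wp_term w w' z (Z.of_nat i - Z.of_nat N) (Z.of_nat j - Z.of_nat N))
      (2 * N)) (2 * N)).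

Definition x_of (t : C) : C :=
  (wp 1 2 (2 * t) - wp 2 2 (2 * t)) / (wp t 2 (2 * t) - wp 2 2 (2 * t)).

(* The finite plane without the singular points 0, 1, -1, i, -i. *)
Definition regular_point (x : C) : Prop :=
  x <> 0 /\ x <> 1 /\ x <> - (1) /\ x <> Ci /\ x <> - Ci.

Definition inverse_branch (U : C -> Prop) (tau : C -> C) : Prop :=
  holomorphic_on U tau /\
  forall x : C, U x -> (0 < Im (tau x))%R /\ x_of (tau x) = x.

Definition sqrt_branch (V : C -> Prop) (f r : C -> C) : Prop :=
  holomorphic_on V r /\ forall x : C, V x -> r x ^ 2 = f x.

(* An analytic [S] on [U] which near every point with x^4 <> 5 is a product of
   branches of the two square roots.  Where x^4 = 5 the first root has a branch
   pole and the second a branch zero; only their product continues there. *)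
Definition prefactor_branch (U : C -> Prop) (tau S : C -> C) : Prop :=
  holomorphic_on U S /\
  forall x0 : C, U x0 -> x0 ^ 4 <> 5 ->
    exists (V : C -> Prop) (r1 r2 : C -> C),
      open V /\ V x0 /\ (forall x, V x -> U x /\ x ^ 4 <> 5) /\
      sqrt_branch V (fun x => (x ^ 5 - x) / (x ^ 4 - 5)) r1 /\
      sqrt_branch V (fun x => wp (tau x) 2 (2 * tau x)) r2 /\
      forall x, V x -> S x = r1 x * r2 x.

Definition ode_solution (U : C -> Prop) (Psi : C -> C) : Prop :=
  exists Psi_x Psi_xx : C -> C,
    forall x : C, U x ->
      is_C_derive Psi x (Psi_x x) /\
      is_C_derive Psi_x x (Psi_xx x) /\
      Psi_xx x =
        - (1 / 4) * ((x ^ 8 + 14 * x ^ 4 + 1) / (x ^ 5 - x) ^ 2) * Psi x.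

(* Main.v *)
(* With q = exp (i pi tau / 2), let al q = 1 + 4 sum q^n / (1 + q^(2n)) and
   be q = al (- q); classically these are the theta constants theta_3^2 and
   theta_4^2.  Summing the lattice sum of wp along rows by the partial fractions of
   1 / sin^2 expresses wp at 1, 2 and tau through Lam q = sum q^n / (1 - q^n)^2, and a
   telescoping double sum gives al^2 = 1 + 8 Lam q - 32 Lam (q^4).  Hence
   x = - be (q^2) / al q and wp tau = (pi^2 / 192) al^2 (x^4 - 5), so that the square
   of the prefactor S is (pi^2 / 192) al^2 (x^5 - x), without a pole at x^4 = 5.

   Under q -> q^2 the pair (al, be) makes one step of the arithmetic-geometric mean.
   Iterating q -> q^2 towards 0 proves identities by invariance: al has no zero,
   q dx/dq = al^2 (x^5 - x) / 4, and q al' / al satisfies a Riccati equation.  The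
   second identity says that tau' is a constant multiple of 1 / S^2, the third turns
   into S'' = Q S; so S and S tau solve the equation, and the Wronskian with S shows
   that there are no other solutions.  Running the mean in the other direction, from
   a given x to a neighbourhood of q = 0, where the inverse function theorem applies,
   shows that every regular x is attained. *)

Require Import Defs.
From Stdlib Require Import Reals ZArith Lra Lia Classical ClassicalEpsilon.
From Coquelicot Require Import Coquelicot.

Open Scope R_scope.
Open Scope C_scope.

(** * Limits and series in C *)

(** No analytic property of [wp] is established, neither its holomorphy in z nor its differential
    equation. Only three of its values enter, and each is turned into a Lambert series in q. The
    number q is exp (2 pi i z / 4) at z = tau, where 4 is the real period; the classical nome is
    q^2. All analyticity in q comes from one power series, that of [al], which converges on the unit
    disc and is differentiated termwise. Squaring of q stands in for modular invariance: a relation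
    compatible with q -> q^2 is decided by its first-order behaviour at 0, and the
    arithmetic-geometric mean supplies the compatibility. Hence theta products, contour integrals
    and Liouville's theorem are avoided. The two roots of the prefactor cannot be handled separately
    where x^4 = 5. The argument therefore works with the square [Ssq] of their product, which has
    neither zeros nor poles at regular points, and returns to S only by S' = Ssq' / (2 S). *)

Definition clim (u : nat -> C) (l : C) : Prop :=
  forall eps : R, 0 < eps -> exists N : nat, forall n : nat,
    (N <= n)%nat -> Cmod (u n - l) < eps.

Lemma clim_ext_ev (u v : nat -> C) (l : C) :
  (exists N, forall n, (N <= n)%nat -> u n = v n) -> clim u l -> clim v l.
Proof.
  intros [N0 He] Hu eps Hp. destruct (Hu eps Hp) as [N HN].
  exists (Nat.max N N0). intros n Hn. rewrite <- He by lia. apply HN. lia.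
Qed.

Lemma clim_ext (u v : nat -> C) (l : C) :
  (forall n, u n = v n) -> clim u l -> clim v l.
Proof. intros He. apply clim_ext_ev. exists 0%nat. intros n _. apply He. Qed.

Lemma clim_const (c : C) : clim (fun _ => c) c.
Proof.
  intros eps Hp. exists 0%nat. intros n _.
  replace (c - c) with (RtoC 0) by ring. now rewrite Cmod_0.
Qed.

Lemma Cmod_minus_sym (x y : C) : Cmod (x - y) = Cmod (y - x).
Proof. rewrite <- Cmod_opp. f_equal. ring. Qed.

Lemma Cmod_triangle_minus (x y : C) : Cmod (x - y) <= Cmod x + Cmod y.
Proof. rewrite <- (Cmod_opp y). apply Cmod_triangle. Qed.

Lemma Cmod_triangle_rev (x y : C) : Cmod x - Cmod y <= Cmod (x - y).
Proof.
  pose proof (Cmod_triangle (x - y) y) as H.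
  replace (x - y + y) with x in H by ring. lra.
Qed.

Lemma clim_plus (u v : nat -> C) (l m : C) :
  clim u l -> clim v m -> clim (fun n => u n + v n) (l + m).
Proof.
  intros Hu Hv eps Hp.
  destruct (Hu (eps / 2)%R) as [N1 H1]; [lra|].
  destruct (Hv (eps / 2)%R) as [N2 H2]; [lra|].
  exists (Nat.max N1 N2). intros n Hn.
  replace (u n + v n - (l + m)) with ((u n - l) + (v n - m)) by ring.
  eapply Rle_lt_trans; [apply Cmod_triangle|].
  specialize (H1 n ltac:(lia)). specialize (H2 n ltac:(lia)). lra.
Qed.

Lemma clim_scal (c : C) (u : nat -> C) (l : C) :
  clim u l -> clim (fun n => c * u n) (c * l).
Proof.
  intros Hu eps Hp.
  assert (Hc := Cmod_ge_0 c).
  destruct (Hu (eps / (Cmod c + 1))%R) as [N H].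
  { apply Rdiv_lt_0_compat; lra. }
  exists N. intros n Hn. specialize (H n Hn).
  replace (c * u n - c * l) with (c * (u n - l)) by ring.
  rewrite Cmod_mult.
  apply Rle_lt_trans with ((Cmod c + 1) * Cmod (u n - l))%R.
  { apply Rmult_le_compat_r; [apply Cmod_ge_0|lra]. }
  apply Rmult_lt_compat_l with (r := (Cmod c + 1)%R) in H; [|lra].
  replace ((Cmod c + 1) * (eps / (Cmod c + 1)))%R with eps in H by (field; lra).
  exact H.
Qed.

Lemma clim_minus (u v : nat -> C) (l m : C) :
  clim u l -> clim v m -> clim (fun n => u n - v n) (l - m).
Proof.
  intros Hu Hv. apply clim_scal with (c := - (1)) in Hv.
  eapply clim_ext; [|replace (l - m) with (l + - (1) * m) by ring;
                     exact (clim_plus _ _ _ _ Hu Hv)].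
  intros n; simpl; ring.
Qed.

Lemma clim_0_Cmod (u : nat -> C) (e : nat -> R) :
  (exists N, forall n, (N <= n)%nat -> Cmod (u n) <= e n) ->
  is_lim_seq e 0%R -> clim u 0.
Proof.
  intros [N0 H0] He eps Hp.
  apply is_lim_seq_spec in He. destruct (He (mkposreal eps Hp)) as [N HN].
  exists (Nat.max N N0). intros n Hn. specialize (HN n ltac:(lia)).
  specialize (H0 n ltac:(lia)). simpl in HN.
  replace (u n - 0) with (u n) by ring.
  pose proof (Rle_abs (e n - 0)). lra.
Qed.

Lemma clim_mult (u v : nat -> C) (l m : C) :
  clim u l -> clim v m -> clim (fun n => u n * v n) (l * m).
Proof.
  intros Hu Hv.
  assert (H0 : clim (fun n => (u n - l) * (v n - m)) 0).
  { intros eps Hp.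
    destruct (Hu (Rmin eps 1)) as [N1 H1]; [apply Rmin_glb_lt; lra|].
    destruct (Hv 1%R) as [N2 H2]; [lra|].
    exists (Nat.max N1 N2). intros n Hn.
    specialize (H1 n ltac:(lia)). specialize (H2 n ltac:(lia)).
    replace ((u n - l) * (v n - m) - 0) with ((u n - l) * (v n - m)) by ring.
    rewrite Cmod_mult. pose proof (Rmin_l eps 1).
    pose proof (Cmod_ge_0 (u n - l)). pose proof (Cmod_ge_0 (v n - m)). nra. }
  pose proof (clim_plus _ _ _ _ H0
    (clim_plus _ _ _ _ (clim_scal m _ _ Hu)
       (clim_minus _ _ _ _ (clim_scal l _ _ Hv) (clim_const (l * m))))) as H.
  replace (l * m) with (0 + (m * l + (l * m - l * m))) by ring.
  eapply clim_ext; [|exact H]. intros n; simpl; ring.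
Qed.

Lemma clim_unique (u : nat -> C) (l m : C) : clim u l -> clim u m -> l = m.
Proof.
  intros Hl Hm. destruct (Ceq_dec l m) as [E|E]; [exact E|exfalso].
  assert (Hp : 0 < Cmod (l - m)).
  { apply Cmod_gt_0. now apply Cminus_eq_contra. }
  destruct (Hl (Cmod (l - m) / 2)%R) as [N1 H1]; [lra|].
  destruct (Hm (Cmod (l - m) / 2)%R) as [N2 H2]; [lra|].
  specialize (H1 (Nat.max N1 N2) ltac:(lia)).
  specialize (H2 (Nat.max N1 N2) ltac:(lia)).
  set (x := u (Nat.max N1 N2)) in *.
  pose proof (Cmod_triangle (l - x) (x - m)) as H.
  replace (l - x + (x - m)) with (l - m) in H by ring.
  rewrite (Cmod_minus_sym l x) in H. lra.
Qed.

Lemma clim_subseq (u : nat -> C) (l : C) (p : nat -> nat) :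
  (forall m, exists N, forall n, (N <= n)%nat -> (m <= p n)%nat) ->
  clim u l -> clim (fun n => u (p n)) l.
Proof.
  intros Hp Hu eps He. destruct (Hu eps He) as [N HN].
  destruct (Hp N) as [N' HN']. exists N'. intros n Hn. apply HN. auto.
Qed.

Lemma clim_le (u : nat -> C) (l : C) (B : R) :
  (exists N, forall n, (N <= n)%nat -> Cmod (u n) <= B) -> clim u l -> Cmod l <= B.
Proof.
  intros [N0 HB] Hu. apply Rnot_lt_le. intros Hlt.
  destruct (Hu (Cmod l - B)%R) as [N HN]; [lra|].
  specialize (HN (Nat.max N N0) ltac:(lia)).
  specialize (HB (Nat.max N N0) ltac:(lia)).
  set (x := u (Nat.max N N0)) in *.
  pose proof (Cmod_triangle_rev l x). rewrite (Cmod_minus_sym l x) in H. lra.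
Qed.

Lemma im_le_Cmod (z : C) : Rabs (Im z) <= Cmod z.
Proof. eapply Rle_trans; [apply Rmax_r|apply Rmax_Cmod]. Qed.

Lemma Cmod_le_Re_Im (z : C) : Cmod z <= Rabs (Re z) + Rabs (Im z).
Proof.
  replace z with (RtoC (Re z) + Ci * RtoC (Im z)) at 1.
  2:{ destruct z as [a b]. unfold Re, Im, RtoC, Ci, Cplus, Cmult; simpl. f_equal; ring. }
  eapply Rle_trans; [apply Cmod_triangle|].
  rewrite Cmod_mult, Cmod_Ci, !Cmod_R. lra.
Qed.

(** The link to [wp], whose limit is componentwise and total: once an epsilon limit is known, the
    real and imaginary parts of the lattice sum need no separate treatment. *)
Lemma clim_C_lim_seq (u : nat -> C) (l : C) : clim u l -> C_lim_seq u = l.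
Proof.
  intros H. unfold C_lim_seq. rewrite (surjective_pairing l).
  assert (E1 : is_lim_seq (fun n => Re (u n)) (fst l)).
  { apply is_lim_seq_spec. intros eps. destruct (H eps (cond_pos eps)) as [N HN].
    exists N. intros n Hn. eapply Rle_lt_trans; [|exact (HN n Hn)].
    exact (re_le_Cmod (u n - l)). }
  assert (E2 : is_lim_seq (fun n => Im (u n)) (snd l)).
  { apply is_lim_seq_spec. intros eps. destruct (H eps (cond_pos eps)) as [N HN].
    exists N. intros n Hn. eapply Rle_lt_trans; [|exact (HN n Hn)].
    exact (im_le_Cmod (u n - l)). }
  now rewrite (is_lim_seq_unique _ _ E1), (is_lim_seq_unique _ _ E2).
Qed.

Lemma clim_cauchy (u : nat -> C) :
  (forall eps : R, 0 < eps -> exists N, forall n m,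
     (N <= n)%nat -> (n <= m)%nat -> Cmod (u m - u n) < eps) ->
  clim u (C_lim_seq u).
Proof.
  intros H.
  assert (HR : forall g : C -> R, (forall z w, g (z - w) = (g z - g w)%R) ->
     (forall z, Rabs (g z) <= Cmod z) ->
     is_lim_seq (fun n => g (u n)) (real (Lim_seq (fun n => g (u n))))).
  { intros g Hg Hgm. apply Lim_seq_correct'. apply ex_lim_seq_cauchy_corr.
    intros eps. destruct (H eps (cond_pos eps)) as [N HN]. exists N.
    intros n m Hn Hm. destruct (Nat.le_ge_cases n m) as [L|L].
    - rewrite Rabs_minus_sym, <- Hg. eapply Rle_lt_trans; [apply Hgm|]. auto.
    - rewrite <- Hg. eapply Rle_lt_trans; [apply Hgm|]. auto. }
  pose proof (HR Re (fun z w => eq_refl) re_le_Cmod) as H1.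
  pose proof (HR Im (fun z w => eq_refl) im_le_Cmod) as H2.
  intros eps Hp.
  apply is_lim_seq_spec in H1. apply is_lim_seq_spec in H2.
  destruct (H1 (mkposreal (eps / 2) ltac:(lra))) as [N1 K1].
  destruct (H2 (mkposreal (eps / 2) ltac:(lra))) as [N2 K2].
  exists (Nat.max N1 N2). intros n Hn.
  specialize (K1 n ltac:(lia)). specialize (K2 n ltac:(lia)). simpl in K1, K2.
  eapply Rle_lt_trans; [apply Cmod_le_Re_Im|].
  replace (Re (u n - C_lim_seq u)) with (Re (u n) - real (Lim_seq (fun n => Re (u n))))%R by reflexivity.
  replace (Im (u n - C_lim_seq u)) with (Im (u n) - real (Lim_seq (fun n => Im (u n))))%R by reflexivity.
  lra.
Qed.

Fixpoint csum (f : nat -> C) (n : nat) : C :=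
  match n with O => 0 | S n => csum f n + f n end.

Fixpoint rsum (f : nat -> R) (n : nat) : R :=
  match n with O => 0%R | S n => (rsum f n + f n)%R end.

Lemma csum_ext (f g : nat -> C) (n : nat) :
  (forall k, (k < n)%nat -> f k = g k) -> csum f n = csum g n.
Proof.
  induction n as [|n IH]; intros H; simpl; [reflexivity|].
  rewrite IH by (intros; apply H; lia). rewrite (H n) by lia. reflexivity.
Qed.

Lemma csum_plus (f g : nat -> C) (n : nat) :
  csum (fun k => f k + g k) n = csum f n + csum g n.
Proof. induction n as [|n IH]; simpl; [|rewrite IH]; ring. Qed.

Lemma csum_scal (c : C) (f : nat -> C) (n : nat) :
  csum (fun k => c * f k) n = c * csum f n.
Proof. induction n as [|n IH]; simpl; [|rewrite IH]; ring. Qed.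

Lemma csum_minus (f g : nat -> C) (n : nat) :
  csum (fun k => f k - g k) n = csum f n - csum g n.
Proof. induction n as [|n IH]; simpl; [|rewrite IH]; ring. Qed.

Lemma csum_0 (f : nat -> C) (n : nat) :
  (forall k, (k < n)%nat -> f k = 0) -> csum f n = 0.
Proof.
  induction n as [|n IH]; intros H; simpl; [reflexivity|].
  rewrite IH by (intros; apply H; lia). rewrite (H n) by lia. ring.
Qed.

Lemma csum_swap (f : nat -> nat -> C) (n m : nat) :
  csum (fun i => csum (fun j => f i j) m) n =
  csum (fun j => csum (fun i => f i j) n) m.
Proof.
  induction n as [|n IH]; simpl.
  - symmetry. apply csum_0. reflexivity.
  - rewrite IH. symmetry. apply csum_plus.
Qed.

Lemma csum_add (f : nat -> C) (n m : nat) :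
  csum f (n + m) = csum f n + csum (fun k => f (n + k)%nat) m.
Proof.
  induction m as [|m IH]; simpl.
  - rewrite Nat.add_0_r. ring.
  - rewrite Nat.add_succ_r. simpl. rewrite IH. ring.
Qed.

Lemma csum_S_l (f : nat -> C) (n : nat) :
  csum f (S n) = f O + csum (fun k => f (S k)) n.
Proof. change (S n) with (1 + n)%nat. rewrite csum_add. simpl. ring. Qed.

Lemma csum_Cmod (f : nat -> C) (M : nat -> R) (n : nat) :
  (forall k, (k < n)%nat -> Cmod (f k) <= M k) -> Cmod (csum f n) <= rsum M n.
Proof.
  induction n as [|n IH]; intros H; simpl.
  - rewrite Cmod_0. lra.
  - eapply Rle_trans; [apply Cmod_triangle|].
    apply Rplus_le_compat; [apply IH; intros; apply H; lia|apply H; lia].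
Qed.

Lemma clim_csum (F : nat -> nat -> C) (f : nat -> C) (n : nat) :
  (forall k, clim (fun N => F N k) (f k)) ->
  clim (fun N => csum (F N) n) (csum f n).
Proof.
  intros H. induction n as [|n IH]; simpl; [apply clim_const|].
  exact (clim_plus _ _ _ _ IH (H n)).
Qed.

Definition rsummable (M : nat -> R) : Prop :=
  (forall k, 0 <= M k) /\ exists B, forall n, rsum M n <= B.

Lemma rsum_le (f g : nat -> R) (n : nat) :
  (forall k, (k < n)%nat -> f k <= g k) -> rsum f n <= rsum g n.
Proof.
  induction n as [|n IH]; intros H; simpl; [lra|].
  apply Rplus_le_compat; [apply IH; intros; apply H; lia|apply H; lia].
Qed.

Lemma rsum_scal (c : R) (f : nat -> R) (n : nat) :
  rsum (fun k => c * f k)%R n = (c * rsum f n)%R.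
Proof. induction n as [|n IH]; simpl; [|rewrite IH]; ring. Qed.

Lemma rsum_mono (M : nat -> R) (n m : nat) :
  (forall k, 0 <= M k) -> (n <= m)%nat -> rsum M n <= rsum M m.
Proof. intros H L. induction L; simpl; [lra|]. specialize (H m). lra. Qed.

Lemma rsummable_scal (c : R) (M : nat -> R) :
  0 <= c -> rsummable M -> rsummable (fun k => c * M k)%R.
Proof.
  intros Hc [H0 [B HB]]. split.
  - intros k. apply Rmult_le_pos; auto.
  - exists (c * B)%R. intros n. rewrite rsum_scal. apply Rmult_le_compat_l; auto.
Qed.

Lemma rsummable_le (f M : nat -> R) :
  (forall k, 0 <= f k <= M k) -> rsummable M -> rsummable f.
Proof.
  intros Hf [H0 [B HB]]. split; [apply Hf|].
  exists B. intros n. eapply Rle_trans; [|apply (HB n)]. apply rsum_le. intros; apply Hf.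
Qed.

Lemma rsummable_tail (M : nat -> R) (eps : R) :
  rsummable M -> 0 < eps ->
  exists K, forall N, (K <= N)%nat -> rsum M N - rsum M K < eps.
Proof.
  intros [H0 [B HB]] Hp.
  destruct (completeness (fun x => exists n, x = rsum M n)) as [s [Hs1 Hs2]].
  { exists B. intros x [n ->]. apply HB. }
  { exists (rsum M 0). now exists O. }
  (* [s] is the supremum of the increasing partial sums; if none exceeded s - eps, then s - eps
     would be a smaller upper bound. *)
  destruct (classic (exists K, s - eps < rsum M K)) as [[K HK]|Hn].
  - exists K. intros N HN. assert (rsum M N <= s) by (apply Hs1; now exists N). lra.
  - exfalso. assert (s <= s - eps); [|lra].
    apply Hs2. intros x [n ->]. apply Rnot_lt_le. intros L. apply Hn. now exists n.
Qed.

Lemma csum_diff_Cmod (f : nat -> C) (M : nat -> R) (n m : nat) :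
  (n <= m)%nat -> (forall k, (k < m)%nat -> Cmod (f k) <= M k) ->
  Cmod (csum f m - csum f n) <= rsum M m - rsum M n.
Proof.
  intros L. induction L as [|m L IH]; intros H.
  - replace (csum f n - csum f n) with (RtoC 0) by ring. rewrite Cmod_0. lra.
  - simpl. replace (csum f m + f m - csum f n) with ((csum f m - csum f n) + f m) by ring.
    eapply Rle_trans; [apply Cmod_triangle|].
    assert (Cmod (csum f m - csum f n) <= rsum M m - rsum M n) by (apply IH; intros; apply H; lia).
    specialize (H m ltac:(lia)). lra.
Qed.

Definition Ser (f : nat -> C) : C := C_lim_seq (csum f).

Lemma Ser_correct (f : nat -> C) (M : nat -> R) :
  (forall k, Cmod (f k) <= M k) -> rsummable M -> clim (csum f) (Ser f).
Proof.
  intros Hf HM. apply clim_cauchy. intros eps Hp.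
  destruct (rsummable_tail M eps HM Hp) as [K HK].
  exists K. intros n m Hn Hm.
  eapply Rle_lt_trans; [apply csum_diff_Cmod with (M := M); auto|].
  pose proof (HK m ltac:(lia)).
  pose proof (rsum_mono M K n (proj1 HM) Hn). lra.
Qed.

Lemma Ser_unique (f : nat -> C) (l : C) : clim (csum f) l -> Ser f = l.
Proof. apply clim_C_lim_seq. Qed.

Lemma Ser_ext (f g : nat -> C) : (forall k, f k = g k) -> Ser f = Ser g.
Proof.
  intros H. unfold Ser, C_lim_seq. f_equal; f_equal; apply Lim_seq_ext; intros n;
  now rewrite (csum_ext f g n (fun k _ => H k)).
Qed.

Lemma Ser_Cmod (f : nat -> C) (M : nat -> R) (B : R) :
  (forall k, Cmod (f k) <= M k) -> rsummable M -> (forall n, rsum M n <= B) ->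
  Cmod (Ser f) <= B.
Proof.
  intros Hf HM HB. apply clim_le with (u := csum f); [|now apply Ser_correct with M].
  exists 0%nat. intros n _. eapply Rle_trans; [|apply (HB n)]. apply csum_Cmod. auto.
Qed.

(** Dominated convergence: beyond a cut both sums are small by the tail of [M], and below it only
    finitely many limits are taken. The length [K N] varies because the sums treated later end at N,
    2 N or 2^N. *)
Theorem tannery (F : nat -> nat -> C) (f : nat -> C) (M : nat -> R) (K : nat -> nat) :
  rsummable M ->
  (exists N0, forall N k, (N0 <= N)%nat -> (k < K N)%nat -> Cmod (F N k) <= M k) ->
  (forall k, clim (fun N => F N k) (f k)) ->
  (forall m, exists N0, forall N, (N0 <= N)%nat -> (m <= K N)%nat) ->
  clim (fun N => csum (F N) (K N)) (Ser f).
Proof.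
  intros HM [N0 HF] Hlim HK.
  assert (Hf : forall k, Cmod (f k) <= M k).
  { intros k. apply clim_le with (u := fun N => F N k); [|apply Hlim].
    destruct (HK (S k)) as [N1 H1]. exists (Nat.max N0 N1). intros n Hn.
    apply HF; [lia|]. specialize (H1 n ltac:(lia)). lia. }
  intros eps Hp.
  destruct (rsummable_tail M (eps / 4) HM ltac:(lra)) as [m Hm].
  destruct (clim_csum F f m Hlim (eps / 4)%R ltac:(lra)) as [N1 H1].
  destruct (HK m) as [N2 H2].
  exists (Nat.max N0 (Nat.max N1 N2)). intros N HN.
  specialize (H1 N ltac:(lia)). specialize (H2 N ltac:(lia)).
  assert (A1 : Cmod (csum (F N) (K N) - csum (F N) m) < eps / 4).
  { eapply Rle_lt_trans; [apply csum_diff_Cmod with (M := M)|]; auto.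
    intros k Hk. apply HF; [lia|exact Hk]. }
  assert (A2 : Cmod (Ser f - csum f m) <= eps / 4).
  { apply clim_le with (u := fun n => csum f n - csum f m).
    - exists m. intros n Hn. left.
      eapply Rle_lt_trans; [apply csum_diff_Cmod with (M := M)|]; auto.
    - apply clim_minus; [apply Ser_correct with M; auto|apply clim_const]. }
  replace (csum (F N) (K N) - Ser f) with
    ((csum (F N) (K N) - csum (F N) m) + (csum (F N) m - csum f m) - (Ser f - csum f m)) by ring.
  eapply Rle_lt_trans; [apply Cmod_triangle_minus|].
  eapply Rle_lt_trans; [apply Rplus_le_compat_r, Cmod_triangle|]. lra.
Qed.

(** Tannery's theorem in the row index i: the row cut at N tends to the full row, and all cuts are
    dominated by [B * u i]. *)
Lemma clim_double_square (a : nat -> nat -> C) (u v : nat -> R) :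
  rsummable u -> rsummable v -> (forall i j, Cmod (a i j) <= u i * v j) ->
  clim (fun N => csum (fun i => csum (a i) N) N) (Ser (fun i => Ser (a i))).
Proof.
  intros Hu Hv Ha. destruct Hv as [Hv0 [B HB]].
  assert (B0 : 0 <= B) by exact (HB O).
  apply tannery with (M := fun i => (B * u i)%R).
  - apply rsummable_scal; auto.
  - exists 0%nat. intros N k _ _.
    eapply Rle_trans; [apply csum_Cmod with (M := fun j => (u k * v j)%R); auto|].
    rewrite rsum_scal, Rmult_comm. apply Rmult_le_compat_r; auto. apply Hu.
  - intros k. apply Ser_correct with (M := fun j => (u k * v j)%R); auto.
    apply rsummable_scal; [apply Hu|]. split; eauto.
  - intros m. exists m. auto.
Qed.

(** Both iterated sums are limits of the same square partial sums, in which the finite sums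
    commute. *)
Theorem Ser_swap (a : nat -> nat -> C) (u v : nat -> R) :
  rsummable u -> rsummable v -> (forall i j, Cmod (a i j) <= u i * v j) ->
  Ser (fun i => Ser (fun j => a i j)) = Ser (fun j => Ser (fun i => a i j)).
Proof.
  intros Hu Hv Ha. eapply clim_unique; [apply (clim_double_square a u v); auto|].
  eapply clim_ext; [|apply (clim_double_square (fun j i => a i j) v u); auto].
  - intros n. apply csum_swap.
  - intros i j. rewrite Rmult_comm. apply Ha.
Qed.

Lemma Ser_scal (c : C) (f : nat -> C) (l : C) :
  clim (csum f) l -> clim (csum (fun k => c * f k)) (c * l).
Proof.
  intros Hf. eapply clim_ext; [|exact (clim_scal c _ _ Hf)].
  intros n. symmetry. apply csum_scal.
Qed.

Lemma rsummable_geom (r : R) : 0 <= r < 1 -> rsummable (fun k => r ^ k)%R.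
Proof.
  intros Hr. split; [intros; apply pow_le; lra|].
  exists (/ (1 - r))%R. intros n.
  assert (H : (rsum (fun k => r ^ k) n * (1 - r) = 1 - r ^ n)%R).
  { induction n as [|n IH]; simpl; [ring|]. rewrite Rmult_plus_distr_r, IH. ring. }
  apply Rmult_le_reg_r with (1 - r)%R; [lra|]. rewrite H, Rinv_l by lra.
  pose proof (pow_le r n (proj1 Hr)). lra.
Qed.

(* Comparison with the telescoping sum of 2 (1 / sqrt (k+1) - 1 / sqrt (k+2)). *)
Lemma rsummable_pow32 : rsummable (fun k => / (INR (S k) * sqrt (INR (S k))))%R.
Proof.
  assert (P : forall k, 0 < INR (S k)) by (intros; apply lt_0_INR; lia).
  assert (Q : forall k, 0 < sqrt (INR (S k))) by (intros; apply sqrt_lt_R0; auto).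
  split.
  - intros k. left. apply Rinv_0_lt_compat. apply Rmult_lt_0_compat; auto.
  - exists 3%R. intros n.
    destruct n as [|n]; [simpl; lra|].
    enough (rsum (fun k => / (INR (S k) * sqrt (INR (S k))))%R (S n) <= 3 - 2 / sqrt (INR (S n))).
    { assert (0 < 2 / sqrt (INR (S n))) by (apply Rdiv_lt_0_compat; [lra|auto]). lra. }
    induction n as [|n IH].
    + simpl. rewrite sqrt_1. lra.
    + change (rsum (fun k => / (INR (S k) * sqrt (INR (S k))))%R (S (S n)))
        with (rsum (fun k => / (INR (S k) * sqrt (INR (S k))))%R (S n)
              + / (INR (S (S n)) * sqrt (INR (S (S n)))))%R.
      set (s := sqrt (INR (S n))) in *. set (t := sqrt (INR (S (S n)))) in *.
      assert (Hs : 0 < s) by apply Q. assert (Ht : 0 < t) by apply Q.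
      assert (Es : (s * s = INR (S n))%R) by (apply sqrt_sqrt; left; auto).
      assert (Et : (t * t = INR (S (S n)))%R) by (apply sqrt_sqrt; left; auto).
      assert (E1 : (t * t = s * s + 1)%R) by (rewrite Et, Es, (S_INR (S n)); ring).
      rewrite <- Et.
      assert (Hst : s < t) by nra.
      enough (/ (t * t * t) <= 2 / s - 2 / t) by lra.
      replace (2 / s - 2 / t)%R with (2 * (t - s) / (s * t))%R by (field; lra).
      replace (t - s)%R with (/ (t + s))%R.
      2:{ apply Rmult_eq_reg_r with (t + s)%R; [|lra]. rewrite Rinv_l by lra. nra. }
      replace (2 * / (t + s) / (s * t))%R with (/ (s * t * ((t + s) / 2)))%R by (field; lra).
      apply Rinv_le_contravar; [|apply Rle_trans with (t * t * ((t + s)/2))%R].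
      * apply Rmult_lt_0_compat; nra.
      * apply Rmult_le_compat_r; nra.
      * apply Rmult_le_compat_l; nra.
Qed.

(** * Complex differentiation *)

(** Trades the filters of [is_derive] for discs in the modulus, the form in which the estimates
    below are made. *)
Lemma is_C_derive_eps (f : C -> C) (z l : C) :
  is_C_derive f z l <->
  forall eps : R, 0 < eps -> exists d : R, 0 < d /\ forall w : C,
    Cmod (w - z) < d -> Cmod (f w - f z - l * (w - z)) <= eps * Cmod (w - z).
Proof.
  split.
  - intros [_ H] eps Hp.
    specialize (H z (fun P Q => Q) (mkposreal eps Hp)).
    destruct H as [d Hd]. exists (pos d). split; [apply cond_pos|].
    intros w Hw. specialize (Hd w Hw). rewrite (Cmult_comm l). exact Hd.
  - intros H. split; [apply is_linear_scal_l|].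
    intros x Hx. assert (E : z = x) by exact (@is_filter_lim_locally_unique C_AbsRing (AbsRing_NormedModule C_AbsRing) z x Hx). subst x.
    intros eps. destruct (H eps (cond_pos eps)) as [d [Hd Hw]].
    exists (mkposreal d Hd). intros w Hb. specialize (Hw w Hb).
    rewrite (Cmult_comm l) in Hw. exact Hw.
Qed.

Lemma open_disc (U : C -> Prop) (x : C) :
  open U -> U x -> exists d : R, 0 < d /\ forall w, Cmod (w - x) < d -> U w.
Proof.
  intros HU Hx. destruct (HU x Hx) as [d Hd].
  exists (pos d). split; [apply cond_pos|].
  intros w Hw. apply Hd. apply C_NormedModule_mixin_compat1. exact Hw.
Qed.

Lemma open_intro (U : C -> Prop) :
  (forall x, U x -> exists d : R, 0 < d /\ forall w, Cmod (w - x) < d -> U w) -> open U.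
Proof.
  intros H x Hx. destruct (H x Hx) as [d [Hd Hw]].
  (* The balls behind [open] are squares; the square of half-side d / sqrt 2 lies in the disc of
     radius d. *)
  assert (S2 : 0 < sqrt 2) by (apply sqrt_lt_R0; lra).
  exists (mkposreal (d / sqrt 2) (Rdiv_lt_0_compat _ _ Hd S2)).
  intros y Hy. apply Hw. apply C_NormedModule_mixin_compat2 in Hy. simpl in Hy.
  replace (sqrt 2 * (d / sqrt 2))%R with d in Hy by (field; lra). exact Hy.
Qed.

Lemma open_disc_at (x : C) (r : R) : open (fun w => Cmod (w - x) < r).
Proof.
  apply open_intro. intros y Hy. exists (r - Cmod (y - x))%R. split; [lra|].
  intros w Hw. pose proof (Cmod_triangle (w - y) (y - x)) as H.
  replace (w - y + (y - x)) with (w - x) in H by ring. lra.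
Qed.

Lemma Cmod_self (z : C) : Cmod (z - z) = 0%R.
Proof. replace (z - z) with (RtoC 0) by ring. apply Cmod_0. Qed.

Lemma C_derive_ext_loc (f g : C -> C) (z l : C) :
  (exists d : R, 0 < d /\ forall w, Cmod (w - z) < d -> f w = g w) ->
  is_C_derive f z l -> is_C_derive g z l.
Proof.
  intros [d [Hd He]] H. apply (is_derive_ext_loc f g z l); [|exact H].
  exists (mkposreal d Hd). exact He.
Qed.

Lemma C_derive_ext_open (U : C -> Prop) (f g : C -> C) (z l : C) :
  open U -> U z -> (forall w, U w -> f w = g w) ->
  is_C_derive f z l -> is_C_derive g z l.
Proof.
  intros HU Hz He. apply C_derive_ext_loc.
  destruct (open_disc U z HU Hz) as [d [Hd Hw]]. exists d. split; auto.
Qed.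

Lemma C_derive_ext (f g : C -> C) (z l : C) :
  (forall w, f w = g w) -> is_C_derive f z l -> is_C_derive g z l.
Proof. intros He. apply C_derive_ext_loc. exists 1%R. split; [lra|auto]. Qed.

Lemma C_derive_const (c z : C) : is_C_derive (fun _ => c) z 0.
Proof. exact (@is_derive_const C_AbsRing C_NormedModule c z). Qed.

Lemma C_derive_id (z : C) : is_C_derive (fun x => x) z 1.
Proof.
  apply is_C_derive_eps. intros eps Hp. exists 1%R. split; [lra|]. intros w _.
  replace (w - z - 1 * (w - z)) with (RtoC 0) by ring. rewrite Cmod_0.
  apply Rmult_le_pos; [lra|apply Cmod_ge_0].
Qed.

Lemma C_derive_plus (f g : C -> C) (z l m : C) :
  is_C_derive f z l -> is_C_derive g z m -> is_C_derive (fun x => f x + g x) z (l + m).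
Proof. exact (@is_derive_plus C_AbsRing C_NormedModule f g z l m). Qed.

Lemma C_derive_minus (f g : C -> C) (z l m : C) :
  is_C_derive f z l -> is_C_derive g z m -> is_C_derive (fun x => f x - g x) z (l - m).
Proof. exact (@is_derive_minus C_AbsRing C_NormedModule f g z l m). Qed.

Lemma C_derive_cont (f : C -> C) (z l : C) :
  is_C_derive f z l ->
  forall eps : R, 0 < eps -> exists d : R, 0 < d /\ forall w,
    Cmod (w - z) < d -> Cmod (f w - f z) < eps.
Proof.
  intros H eps Hp. pose proof (Cmod_ge_0 l) as Hl.
  apply is_C_derive_eps with (eps := 1%R) in H; [|lra].
  destruct H as [d [Hd H]].
  exists (Rmin d (eps / (Cmod l + 2))). split.
  { apply Rmin_glb_lt; [lra|]. apply Rdiv_lt_0_compat; lra. }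
  intros w Hw. specialize (H w (Rlt_le_trans _ _ _ Hw (Rmin_l _ _))).
  assert (Hw2 := Rlt_le_trans _ _ _ Hw (Rmin_r _ _)).
  replace (f w - f z) with ((f w - f z - l * (w - z)) + l * (w - z)) by ring.
  eapply Rle_lt_trans; [apply Cmod_triangle|]. rewrite Cmod_mult.
  apply Rmult_lt_compat_l with (r := (Cmod l + 2)%R) in Hw2; [|lra].
  replace ((Cmod l + 2) * (eps / (Cmod l + 2)))%R with eps in Hw2 by (field; lra).
  pose proof (Cmod_ge_0 (w - z)). nra.
Qed.

Lemma C_derive_comp (f g : C -> C) (z l m : C) :
  is_C_derive f (g z) l -> is_C_derive g z m -> is_C_derive (fun x => f (g x)) z (l * m).
Proof.
  intros Hf Hg. apply is_C_derive_eps. intros eps Hp.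
  pose proof (Cmod_ge_0 l) as L0. pose proof (Cmod_ge_0 m) as M0.
  set (e1 := (eps / (2 * (Cmod m + 1)))%R).
  set (e2 := Rmin 1 (eps / (2 * (Cmod l + 1)))).
  assert (P1 : 0 < e1) by (apply Rdiv_lt_0_compat; lra).
  assert (P2 : 0 < e2).
  { apply Rmin_glb_lt; [lra|]. apply Rdiv_lt_0_compat; lra. }
  destruct (proj1 (is_C_derive_eps f (g z) l) Hf e1 P1) as [d1 [D1 H1]].
  destruct (proj1 (is_C_derive_eps g z m) Hg e2 P2) as [d2 [D2 H2]].
  destruct (C_derive_cont g z m Hg d1 D1) as [d3 [D3 H3]].
  exists (Rmin d2 d3). split; [now apply Rmin_glb_lt|]. intros w Hw.
  specialize (H2 w (Rlt_le_trans _ _ _ Hw (Rmin_l _ _))).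
  specialize (H3 w (Rlt_le_trans _ _ _ Hw (Rmin_r _ _))).
  specialize (H1 (g w) H3).
  replace (f (g w) - f (g z) - l * m * (w - z)) with
    ((f (g w) - f (g z) - l * (g w - g z)) + l * (g w - g z - m * (w - z))) by ring.
  eapply Rle_trans; [apply Cmod_triangle|]. rewrite Cmod_mult.
  set (h := Cmod (w - z)) in *. assert (Hh : 0 <= h) by apply Cmod_ge_0.
  assert (G : Cmod (g w - g z) <= (Cmod m + 1) * h).
  { replace (g w - g z) with ((g w - g z - m * (w - z)) + m * (w - z)) by ring.
    eapply Rle_trans; [apply Cmod_triangle|]. rewrite Cmod_mult. fold h.
    assert (e2 <= 1) by apply Rmin_l. nra. }
  assert (A : e1 * Cmod (g w - g z) <= eps / 2 * h).
  { apply Rle_trans with (e1 * ((Cmod m + 1) * h))%R; [apply Rmult_le_compat_l; lra|].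
    unfold e1. right. field. lra. }
  assert (B : Cmod l * Cmod (g w - g z - m * (w - z)) <= eps / 2 * h).
  { apply Rle_trans with ((Cmod l + 1) * (eps / (2 * (Cmod l + 1)) * h))%R.
    - apply Rmult_le_compat; [lra|apply Cmod_ge_0|lra|].
      eapply Rle_trans; [exact H2|]. apply Rmult_le_compat_r; [lra|apply Rmin_r].
    - right. field. lra. }
  lra.
Qed.

Lemma C_derive_mult (f g : C -> C) (z l m : C) :
  is_C_derive f z l -> is_C_derive g z m ->
  is_C_derive (fun x => f x * g x) z (l * g z + f z * m).
Proof.
  intros Hf Hg. apply is_C_derive_eps. intros eps Hp.
  set (B := (Cmod (f z) + Cmod (g z) + Cmod l + 1)%R).
  pose proof (Cmod_ge_0 l) as L0. pose proof (Cmod_ge_0 (f z)) as F0. pose proof (Cmod_ge_0 (g z)) as G0.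
  assert (HB : 0 < B) by (unfold B; lra).
  assert (Pe : 0 < eps / (3 * B)) by (apply Rdiv_lt_0_compat; lra).
  set (e := Rmin 1 (eps / (3 * B))).
  assert (P : 0 < e) by (apply Rmin_glb_lt; lra).
  destruct (proj1 (is_C_derive_eps f z l) Hf e P) as [d1 [D1 H1]].
  destruct (proj1 (is_C_derive_eps g z m) Hg e P) as [d2 [D2 H2]].
  destruct (C_derive_cont g z m Hg (eps / (3 * B))%R Pe) as [d3 [D3 H3]].
  exists (Rmin d1 (Rmin d2 d3)). split; [repeat apply Rmin_glb_lt; auto|]. intros w Hw.
  assert (W1 : Cmod (w - z) < d1) by (eapply Rlt_le_trans; [exact Hw|apply Rmin_l]).
  assert (W2 : Cmod (w - z) < d2).
  { eapply Rlt_le_trans; [exact Hw|]. eapply Rle_trans; [apply Rmin_r|apply Rmin_l]. }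
  assert (W3 : Cmod (w - z) < d3).
  { eapply Rlt_le_trans; [exact Hw|]. eapply Rle_trans; [apply Rmin_r|apply Rmin_r]. }
  specialize (H1 w W1). specialize (H2 w W2). specialize (H3 w W3).
  replace (f w * g w - f z * g z - (l * g z + f z * m) * (w - z)) with
    ((f w - f z - l * (w - z)) * g z + f z * (g w - g z - m * (w - z))
     + (f w - f z) * (g w - g z)) by ring.
  eapply Rle_trans; [apply Cmod_triangle|].
  eapply Rle_trans; [apply Rplus_le_compat_r, Cmod_triangle|]. rewrite !Cmod_mult.
  set (h := Cmod (w - z)) in *. assert (Hh : 0 <= h) by apply Cmod_ge_0.
  assert (He1 : e <= 1) by apply Rmin_l. assert (He2 : e <= eps / (3 * B)) by apply Rmin_r.
  assert (F : Cmod (f w - f z) <= (Cmod l + 1) * h).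
  { replace (f w - f z) with ((f w - f z - l * (w - z)) + l * (w - z)) by ring.
    eapply Rle_trans; [apply Cmod_triangle|]. rewrite Cmod_mult. fold h. nra. }
  assert (T : forall x y : R, 0 <= x -> x <= B -> 0 <= y -> y <= eps / (3 * B) * h ->
     x * y <= eps / 3 * h).
  { intros x y X0 X1 Y0 Y1. apply Rle_trans with (B * (eps / (3 * B) * h))%R.
    - apply Rmult_le_compat; auto.
    - right. field. lra. }
  assert (T1 := T (Cmod (g z)) (Cmod (f w - f z - l * (w - z))) ltac:(lra) ltac:(unfold B; lra)
     (Cmod_ge_0 _) ltac:(eapply Rle_trans; [exact H1|apply Rmult_le_compat_r; lra])).
  assert (T2 := T (Cmod (f z)) (Cmod (g w - g z - m * (w - z))) ltac:(lra) ltac:(unfold B; lra)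
     (Cmod_ge_0 _) ltac:(eapply Rle_trans; [exact H2|apply Rmult_le_compat_r; lra])).
  assert (T3 : Cmod (f w - f z) * Cmod (g w - g z) <= eps / 3 * h).
  { apply Rle_trans with ((B * h) * (eps / (3 * B)))%R.
    - apply Rmult_le_compat; try apply Cmod_ge_0; [|lra].
      eapply Rle_trans; [exact F|]. apply Rmult_le_compat_r; [lra|unfold B; lra].
    - right. field. lra. }
  lra.
Qed.

Lemma C_derive_scal (c : C) (f : C -> C) (z l : C) :
  is_C_derive f z l -> is_C_derive (fun x => c * f x) z (c * l).
Proof.
  intros H. replace (c * l) with (0 * f z + c * l) by ring.
  exact (C_derive_mult (fun _ => c) f z 0 l (C_derive_const c z) H).
Qed.

Lemma C_derive_pow (n : nat) (z : C) :
  is_C_derive (fun x => x ^ n) z (RtoC (INR n) * z ^ pred n).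
Proof.
  induction n as [|n IH].
  - simpl. replace (0 * 1) with (RtoC 0) by ring. apply C_derive_const.
  - replace (RtoC (INR (S n)) * z ^ pred (S n)) with (1 * z ^ n + z * (RtoC (INR n) * z ^ pred n)).
    + apply (C_derive_mult (fun x => x) (fun x => x ^ n) z 1 _ (C_derive_id z) IH).
    + rewrite S_INR, RtoC_plus. destruct n as [|n]; simpl; ring.
Qed.

Lemma C_derive_inv (z : C) : z <> 0 -> is_C_derive (fun x => / x) z (- / (z * z)).
Proof.
  intros Hz. apply is_C_derive_eps. intros eps Hp.
  assert (P : 0 < Cmod z) by now apply Cmod_gt_0.
  set (k := Cmod z) in *.
  exists (Rmin (k / 2) (eps * (k * k * k) / 2)). split.
  { apply Rmin_glb_lt; [lra|]. assert (0 < k * k * k) by (repeat apply Rmult_lt_0_compat; lra). nra. }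
  intros w Hw.
  assert (W1 := Rlt_le_trans _ _ _ Hw (Rmin_l _ _)).
  assert (W2 := Rlt_le_trans _ _ _ Hw (Rmin_r _ _)).
  assert (Kw : k / 2 < Cmod w).
  { pose proof (Cmod_triangle_rev z w). rewrite Cmod_minus_sym in H. fold k in H. lra. }
  assert (Hw0 : w <> 0) by (apply Cmod_gt_0; lra).
  replace (/ w - / z - - / (z * z) * (w - z)) with ((w - z) * (w - z) / (w * (z * z))) by (field; auto).
  rewrite Cmod_div by (repeat apply Cmult_neq_0; auto). rewrite !Cmod_mult. fold k.
  set (h := Cmod (w - z)) in *. assert (Hh : 0 <= h) by apply Cmod_ge_0.
  set (v := Cmod w) in *.
  assert (Q : 0 < v * (k * k)) by (repeat apply Rmult_lt_0_compat; lra).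
  apply Rmult_le_reg_r with (v * (k * k))%R; [exact Q|].
  replace (h * h / (v * (k * k)) * (v * (k * k)))%R with (h * h)%R by (field; lra).
  assert (0 < k * k) by nra.
  assert (eps * (k * k * k) / 2 <= eps * (v * (k * k))).
  { replace (eps * (k * k * k) / 2)%R with (eps * (k / 2 * (k * k)))%R by field.
    apply Rmult_le_compat_l; [lra|]. apply Rmult_le_compat_r; lra. }
  nra.
Qed.

Lemma C_derive_div (f g : C -> C) (z l m : C) :
  is_C_derive f z l -> is_C_derive g z m -> g z <> 0 ->
  is_C_derive (fun x => f x / g x) z ((l * g z - f z * m) / (g z * g z)).
Proof.
  intros Hf Hg Hz.
  pose proof (C_derive_comp Cinv g z _ _ (C_derive_inv (g z) Hz) Hg) as Hi.
  pose proof (C_derive_mult f (fun x => / g x) z _ _ Hf Hi) as H.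
  replace ((l * g z - f z * m) / (g z * g z)) with
    (l * / g z + f z * (- / (g z * g z) * m)) by (field; auto).
  exact H.
Qed.

Lemma C_derive_unique (f : C -> C) (z l m : C) :
  is_C_derive f z l -> is_C_derive f z m -> l = m.
Proof.
  intros H1 H2. rewrite <- (is_C_derive_unique f z l H1). exact (is_C_derive_unique f z m H2).
Qed.

Lemma C_derive_eq (f : C -> C) (z l m : C) : is_C_derive f z l -> l = m -> is_C_derive f z m.
Proof. now intros H <-. Qed.

(** [phi] stands for [Re] and [Im]: a real linear functional turns the complex derivative into a
    real one along the segment, where the real mean value theorem is available. *)
Lemma derive_along_segment (phi : C -> R) (f : C -> C) (z h l : C) (t : R) :
  (forall a b, phi (a - b) = (phi a - phi b)%R) ->
  (forall (r : R) a, phi (RtoC r * a) = (r * phi a)%R) ->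
  (forall a, Rabs (phi a) <= Cmod a) ->
  is_C_derive f (z + RtoC t * h) l ->
  is_derive (fun s : R => phi (f (z + RtoC s * h))) t (phi (l * h)).
Proof.
  intros Ha Hs Hb Hf. apply is_derive_Reals. intros eps Hp.
  pose proof (Cmod_ge_0 h) as Hh.
  set (e := (eps / (2 * (Cmod h + 1)))%R).
  assert (Pe : 0 < e) by (apply Rdiv_lt_0_compat; lra).
  destruct (proj1 (is_C_derive_eps _ _ _) Hf e Pe) as [d [Hd Hw]].
  assert (Pd : 0 < d / (Cmod h + 1)) by (apply Rdiv_lt_0_compat; lra).
  exists (mkposreal _ Pd). intros s Hs0 Hsd. simpl in Hsd.
  specialize (Hw (z + RtoC (t + s) * h)).
  replace (z + RtoC (t + s) * h - (z + RtoC t * h)) with (RtoC s * h) in Hw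
    by (rewrite RtoC_plus; ring).
  rewrite Cmod_mult, Cmod_R in Hw.
  assert (Ps : 0 < Rabs s) by now apply Rabs_pos_lt.
  assert (L : Rabs s * Cmod h < d).
  { apply Rle_lt_trans with (Rabs s * (Cmod h + 1))%R; [apply Rmult_le_compat_l; lra|].
    apply Rmult_lt_compat_r with (r := (Cmod h + 1)%R) in Hsd; [|lra].
    replace (d / (Cmod h + 1) * (Cmod h + 1))%R with d in Hsd by (field; lra). exact Hsd. }
  specialize (Hw L).
  set (D := f (z + RtoC (t + s) * h) - f (z + RtoC t * h) - l * (RtoC s * h)) in Hw.
  assert (E : (((phi (f (z + RtoC (t + s) * h)%C) - phi (f (z + RtoC t * h)%C)) / s - phi (l * h)%C) = phi D / s)%R).
  { unfold D. rewrite !Ha. replace (l * (RtoC s * h)) with (RtoC s * (l * h)) by ring.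
    rewrite Hs. field. exact Hs0. }
  rewrite E. unfold Rdiv. rewrite Rabs_mult, Rabs_inv.
  apply Rle_lt_trans with (e * (Rabs s * Cmod h) * / Rabs s)%R.
  { apply Rmult_le_compat_r; [left; now apply Rinv_0_lt_compat|]. eapply Rle_trans; [apply Hb|exact Hw]. }
  replace (e * (Rabs s * Cmod h) * / Rabs s)%R with (e * Cmod h)%R by (field; lra).
  apply Rle_lt_trans with (e * (Cmod h + 1))%R; [apply Rmult_le_compat_l; lra|].
  replace (e * (Cmod h + 1))%R with (eps / 2)%R by (unfold e; field; lra). lra.
Qed.

Lemma Cmod_convex (z w z0 : C) (r t : R) :
  0 <= t <= 1 -> Cmod (z - z0) < r -> Cmod (w - z0) < r ->
  Cmod (z + RtoC t * (w - z) - z0) < r.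
Proof.
  intros Ht Hz Hw.
  replace (z + RtoC t * (w - z) - z0) with (RtoC (1 - t) * (z - z0) + RtoC t * (w - z0))
    by (rewrite RtoC_minus; ring).
  eapply Rle_lt_trans; [apply Cmod_triangle|]. rewrite !Cmod_mult, !Cmod_R, !Rabs_pos_eq by lra.
  (* At t = 1 the weight of [z] vanishes and strictness comes from [w]; for smaller t it comes from
     [z]. *)
  destruct (Req_dec t 1) as [->|Hn]; [lra|].
  assert ((1 - t) * Cmod (z - z0) < (1 - t) * r) by (apply Rmult_lt_compat_l; lra).
  assert (t * Cmod (w - z0) <= t * r) by (apply Rmult_le_compat_l; lra). lra.
Qed.

(* The factor 2 comes from applying the real mean value theorem to Re and Im separately. *)
Lemma mean_value_bound (f f1 : C -> C) (z0 : C) (r M : R) :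
  (forall z, Cmod (z - z0) < r -> is_C_derive f z (f1 z) /\ Cmod (f1 z) <= M) ->
  forall z w, Cmod (z - z0) < r -> Cmod (w - z0) < r ->
  Cmod (f w - f z) <= 2 * M * Cmod (w - z).
Proof.
  intros H z w Hz Hw.
  assert (K : forall phi : C -> R, (forall a b, phi (a - b) = (phi a - phi b)%R) ->
    (forall (r : R) a, phi (RtoC r * a) = (r * phi a)%R) ->
    (forall a, Rabs (phi a) <= Cmod a) -> Rabs (phi (f w - f z)) <= M * Cmod (w - z)).
  { intros phi Ha Hs Hb.
    assert (Hd : forall t, 0 <= t <= 1 ->
      is_derive (fun s : R => phi (f (z + RtoC s * (w - z)))) t
        (phi (f1 (z + RtoC t * (w - z)) * (w - z)))).
    { intros t Ht. apply derive_along_segment; auto. apply H. now apply Cmod_convex. }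
    destruct (MVT_gen (fun s : R => phi (f (z + RtoC s * (w - z)))) 0 1
      (fun t => phi (f1 (z + RtoC t * (w - z)) * (w - z)))) as [c [Hc E]].
    - intros x. rewrite Rmin_left, Rmax_right by lra. intros Hx. apply Hd. lra.
    - intros x. rewrite Rmin_left, Rmax_right by lra. intros Hx.
      apply continuity_pt_filterlim. apply (ex_derive_continuous (V := R_NormedModule)).
      eexists. apply Hd. lra.
    - rewrite Rmin_left, Rmax_right in Hc by lra.
      replace (z + RtoC 1 * (w - z)) with w in E by ring.
      replace (z + RtoC 0 * (w - z)) with z in E by ring.
      rewrite Ha, E, Rminus_0_r, Rmult_1_r.
      eapply Rle_trans; [apply Hb|]. rewrite Cmod_mult.
      apply Rmult_le_compat_r; [apply Cmod_ge_0|]. apply H. now apply Cmod_convex. }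
  eapply Rle_trans; [apply Cmod_le_Re_Im|].
  pose proof (K Re (fun a b => eq_refl) (fun r a => re_scal_l r a) re_le_Cmod).
  pose proof (K Im (fun a b => eq_refl) (fun r a => im_scal_l r a) im_le_Cmod). lra.
Qed.

Lemma derive_0_const_disc (f : C -> C) (z0 : C) (r : R) :
  (forall z, Cmod (z - z0) < r -> is_C_derive f z 0) ->
  forall z, Cmod (z - z0) < r -> f z = f z0.
Proof.
  intros H z Hz.
  assert (B : Cmod (f z - f z0) <= 2 * 0 * Cmod (z - z0)).
  { apply (mean_value_bound f (fun _ => 0) z0 r 0); auto.
    - intros x Hx. split; [auto|]. rewrite Cmod_0. lra.
    - rewrite Cmod_self. eapply Rle_lt_trans; [apply Cmod_ge_0|exact Hz]. }
  apply Ceq_minus. apply Cmod_eq_0. pose proof (Cmod_ge_0 (f z - f z0)). lra.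
Qed.

(** As f is constant on discs, the points of U with the value f z0 and those with another value form
    two disjoint open sets covering U. *)
Lemma derive_0_const_connected (U : C -> Prop) (f : C -> C) :
  open U -> connected_set U -> (forall z, U z -> is_C_derive f z 0) ->
  exists c, forall z, U z -> f z = c.
Proof.
  intros HU HC Hf.
  destruct (classic (exists z0, U z0)) as [[z0 Hz0]|Hn].
  2:{ exists 0. intros z Hz. exfalso. apply Hn. now exists z. }
  exists (f z0). intros z Hz. apply NNPP. intros Hne.
  assert (Hloc : forall x, U x -> exists d : R, 0 < d /\ forall w, Cmod (w - x) < d -> U w /\ f w = f x).
  { intros x Hx. destruct (open_disc U x HU Hx) as [d [Hd Hw]]. exists d. split; [exact Hd|].
    intros w Hw'. split; [auto|]. apply derive_0_const_disc with (r := d); auto. }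
  destruct (HC (fun x => U x /\ f x = f z0) (fun x => U x /\ f x <> f z0)) as [x [_ [[_ A] [_ B]]]]; auto.
  - apply open_intro. intros x [Hx E]. destruct (Hloc x Hx) as [d [Hd Hw]]. exists d. split; [exact Hd|].
    intros w Hw'. destruct (Hw w Hw') as [A B]. split; [exact A|congruence].
  - apply open_intro. intros x [Hx E]. destruct (Hloc x Hx) as [d [Hd Hw]]. exists d. split; [exact Hd|].
    intros w Hw'. destruct (Hw w Hw') as [A B]. split; [exact A|congruence].
  - intros x Hx. destruct (classic (f x = f z0)); auto.
  - exists z0. auto.
  - exists z. auto.
Qed.

(** * The inverse function theorem *)

Section Contraction.

Variables (phi : C -> C) (z0 b : C) (d : R).
Hypothesis d_pos : 0 < d.
Hypothesis phi_contr : forall z w, Cmod (z - z0) < d -> Cmod (w - z0) < d ->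
  Cmod (phi w - phi z) <= / 4 * Cmod (w - z).
Hypothesis start : Cmod (phi z0 + b - z0) < d / 4.

Fixpoint iterate (n : nat) : C :=
  match n with O => z0 | S n => phi (iterate n) + b end.

(** The contraction contributes at most a quarter of d / 2 and [start] at most d / 4, together 3 d /
    8 < d / 2. *)
Lemma iterate_ball (n : nat) : Cmod (iterate n - z0) < d / 2.
Proof.
  induction n as [|n IH]; simpl; [rewrite Cmod_self; lra|].
  replace (phi (iterate n) + b - z0) with ((phi (iterate n) - phi z0) + (phi z0 + b - z0)) by ring.
  eapply Rle_lt_trans; [apply Cmod_triangle|].
  assert (H := phi_contr z0 (iterate n) ltac:(rewrite Cmod_self; lra) ltac:(lra)). lra.
Qed.

Lemma iterate_step (n : nat) : Cmod (iterate (S n) - iterate n) <= d * (/ 4) ^ n.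
Proof.
  induction n as [|n IH].
  - simpl. lra.
  - replace (iterate (S (S n)) - iterate (S n)) with (phi (iterate (S n)) - phi (iterate n))
      by (simpl; ring).
    eapply Rle_trans; [apply phi_contr|].
    + pose proof (iterate_ball n). lra.
    + pose proof (iterate_ball (S n)). lra.
    + change ((/ 4) ^ S n)%R with (/ 4 * (/ 4) ^ n)%R. lra.
Qed.

(** The iterates are the partial sums of their steps, which a geometric series dominates. The limit
    satisfies only the weak bound d / 2, still strictly inside the disc where [phi] contracts. *)
Lemma contraction_fixed_point : exists z, Cmod (z - z0) < d /\ z = phi z + b.
Proof.
  set (D := fun n => iterate (S n) - iterate n).
  assert (HD : clim (csum D) (Ser D)).
  { apply Ser_correct with (M := fun n => (d * (/ 4) ^ n)%R); [apply iterate_step|].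
    apply rsummable_scal; [lra|]. apply rsummable_geom. lra. }
  assert (HI : clim iterate (z0 + Ser D)).
  { eapply clim_ext; [|exact (clim_plus _ _ _ _ (clim_const z0) HD)].
    intros n. simpl. induction n as [|n IH]; simpl; [ring|].
    rewrite Cplus_assoc, IH. unfold D. simpl. ring. }
  set (z := z0 + Ser D) in *.
  assert (Hz : Cmod (z - z0) <= d / 2).
  { apply clim_le with (u := fun n => iterate n - z0).
    - exists 0%nat. intros n _. left. apply iterate_ball.
    - apply clim_minus; [exact HI|apply clim_const]. }
  exists z. split; [lra|].
  apply clim_unique with (u := fun n => iterate (S n)).
  - apply (clim_subseq iterate z S); [|exact HI]. intros m. exists m. intros; lia.
  - simpl. apply clim_plus; [|apply clim_const].
    intros eps Hp. destruct (HI eps Hp) as [N HN]. exists N. intros n Hn.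
    eapply Rle_lt_trans; [apply phi_contr|].
    + lra.
    + pose proof (iterate_ball n). lra.
    + specialize (HN n Hn). pose proof (Cmod_ge_0 (iterate n - z)). lra.
Qed.

End Contraction.

(** Solving f z = x means finding a fixed point of Newton's map with frozen derivative, z - f z / l
    + x / l with l = f1 z0. *)
Theorem inverse_function (f f1 : C -> C) (z0 : C) (r : R) :
  0 < r -> (forall z, Cmod (z - z0) < r -> is_C_derive f z (f1 z)) -> f1 z0 <> 0 ->
  (forall eps : R, 0 < eps -> exists d : R, 0 < d /\
     forall z, Cmod (z - z0) < d -> Cmod (f1 z - f1 z0) < eps) ->
  exists (eta : R) (g : C -> C), 0 < eta /\ forall x, Cmod (x - f z0) < eta ->
    Cmod (g x - z0) < r /\ f (g x) = x /\ is_C_derive g x (/ f1 (g x)).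
Proof.
  intros Hr Hf Hl Hc. set (l := f1 z0) in *.
  assert (Pl : 0 < Cmod l) by now apply Cmod_gt_0.
  (* This makes the derivative of [phi] at most 1/8, which the factor 2 of [mean_value_bound] turns
     into the contraction constant 1/4. *)
  destruct (Hc (Cmod l / 8)%R ltac:(lra)) as [d0 [Hd0 Hd]].
  set (d := Rmin d0 r). assert (Pd : 0 < d) by now apply Rmin_glb_lt.
  set (phi := fun z => z - / l * f z).
  assert (Hphi : forall z w, Cmod (z - z0) < d -> Cmod (w - z0) < d ->
     Cmod (phi w - phi z) <= / 4 * Cmod (w - z)).
  { replace (/ 4)%R with (2 * / 8)%R by field.
    apply mean_value_bound with (f1 := fun z => 1 - / l * f1 z).
    intros z Hz. assert (Z1 := Rlt_le_trans _ _ _ Hz (Rmin_l _ _)).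
    assert (Z2 := Rlt_le_trans _ _ _ Hz (Rmin_r _ _)). split.
    - apply C_derive_minus; [apply C_derive_id|apply C_derive_scal; auto].
    - replace (1 - / l * f1 z) with (- (f1 z - l) / l) by (field; auto).
      rewrite Cmod_div, Cmod_opp by auto. specialize (Hd z Z1).
      apply Rmult_le_reg_r with (Cmod l); [exact Pl|].
      replace (Cmod (f1 z - l) / Cmod l * Cmod l)%R with (Cmod (f1 z - l)) by (field; lra). lra. }
  assert (Hnz : forall z, Cmod (z - z0) < d -> f1 z <> 0).
  { intros z Hz E. specialize (Hd z (Rlt_le_trans _ _ _ Hz (Rmin_l _ _))).
    rewrite E in Hd. replace (0 - l) with (- l) in Hd by ring. rewrite Cmod_opp in Hd. lra. }
  (* [f] stretches distances by at least |l| / 2. Hence solutions are unique in the disc, and the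
     [g] picked by choice below is automatically Lipschitz, which is all the continuity that its
     derivative needs. *)
  assert (Hlip : forall z w, Cmod (z - z0) < d -> Cmod (w - z0) < d ->
     Cmod (w - z) <= 2 / Cmod l * Cmod (f w - f z)).
  { intros z w Hz Hw. specialize (Hphi z w Hz Hw).
    assert (E : w - z = (phi w - phi z) + / l * (f w - f z)) by (unfold phi; ring).
    assert (T := Cmod_triangle (phi w - phi z) (/ l * (f w - f z))).
    rewrite <- E, Cmod_mult, Cmod_inv in T by auto.
    pose proof (Cmod_ge_0 (w - z)). pose proof (Cmod_ge_0 (f w - f z)).
    assert (0 <= / Cmod l * Cmod (f w - f z)).
    { apply Rmult_le_pos; [left; now apply Rinv_0_lt_compat|lra]. }
    unfold Rdiv. lra. }
  set (eta := (Cmod l * d / 4)%R).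
  assert (Peta : 0 < eta) by (unfold eta; assert (0 < Cmod l * d) by (apply Rmult_lt_0_compat; lra); lra).
  assert (Hex : forall x, Cmod (x - f z0) < eta -> exists z, Cmod (z - z0) < d /\ f z = x).
  { intros x Hx.
    destruct (contraction_fixed_point phi z0 (/ l * x) d Pd Hphi) as [z [Hz E]].
    - replace (phi z0 + / l * x - z0) with (/ l * (x - f z0)) by (unfold phi; ring).
      rewrite Cmod_mult, Cmod_inv by auto.
      apply Rmult_lt_reg_l with (Cmod l); [exact Pl|].
      rewrite <- Rmult_assoc, Rinv_r, Rmult_1_l by lra. unfold eta in Hx. lra.
    - exists z. split; [exact Hz|].
      assert (A : / l * (x - f z) = 0).
      { unfold phi in E. replace (/ l * (x - f z)) with ((z - / l * f z + / l * x) - z) by ring.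
        rewrite <- E. ring. }
      replace x with (l * (/ l * (x - f z)) + f z) by (field; auto). rewrite A. ring. }
  set (g := fun x => epsilon (inhabits (RtoC 0)) (fun z => Cmod (z - z0) < d /\ f z = x)).
  assert (Hg : forall x, Cmod (x - f z0) < eta -> Cmod (g x - z0) < d /\ f (g x) = x).
  { intros x Hx. apply (epsilon_spec (inhabits (RtoC 0)) (fun z => Cmod (z - z0) < d /\ f z = x)). auto. }
  exists eta, g. split; [exact Peta|]. intros x Hx.
  destruct (Hg x Hx) as [G1 G2].
  assert (G3 := Rlt_le_trans _ _ _ G1 (Rmin_r _ _)).
  split; [exact G3|]. split; [exact G2|].
  set (m := f1 (g x)). assert (Hm : m <> 0) by now apply Hnz.
  assert (Pm : 0 < Cmod m) by now apply Cmod_gt_0.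
  apply is_C_derive_eps. intros eps Hp.
  (* Inversion costs a factor 2 / |l| from [Hlip] and a factor 1 / |m| from the division by f1 (g
     x). *)
  set (e := (eps * Cmod m * Cmod l / 2)%R).
  assert (Pe : 0 < e) by (unfold e; assert (0 < eps * Cmod m * Cmod l) by (repeat apply Rmult_lt_0_compat; lra); lra).
  destruct (proj1 (is_C_derive_eps _ _ _) (Hf (g x) G3) e Pe) as [d1 [D1 H1]].
  exists (Rmin (eta - Cmod (x - f z0)) (d1 * Cmod l / 2)). split.
  { apply Rmin_glb_lt; [lra|]. assert (0 < d1 * Cmod l) by (apply Rmult_lt_0_compat; lra). lra. }
  intros x' Hx'.
  assert (X1 := Rlt_le_trans _ _ _ Hx' (Rmin_l _ _)).
  assert (X2 := Rlt_le_trans _ _ _ Hx' (Rmin_r _ _)).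
  assert (Hx'' : Cmod (x' - f z0) < eta).
  { pose proof (Cmod_triangle (x' - x) (x - f z0)) as T.
    replace (x' - x + (x - f z0)) with (x' - f z0) in T by ring. lra. }
  destruct (Hg x' Hx'') as [G1' G2'].
  specialize (Hlip (g x) (g x') G1 G1'). rewrite G2, G2' in Hlip.
  set (h := Cmod (x' - x)) in *. assert (Hh : 0 <= h) by apply Cmod_ge_0.
  assert (Hl2 : 2 / Cmod l * h < d1).
  { apply Rmult_lt_reg_r with (Cmod l / 2)%R; [lra|].
    replace (2 / Cmod l * h * (Cmod l / 2))%R with h by (field; lra). lra. }
  specialize (H1 (g x') (Rle_lt_trans _ _ _ Hlip Hl2)). fold m in H1. rewrite G2, G2' in H1.
  replace (g x' - g x - / m * (x' - x)) with (- (x' - x - m * (g x' - g x)) / m) by (field; auto).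
  rewrite Cmod_div, Cmod_opp by auto.
  apply Rmult_le_reg_r with (Cmod m); [exact Pm|].
  unfold Rdiv at 1. rewrite Rmult_assoc, Rinv_l, Rmult_1_r by lra.
  eapply Rle_trans; [exact H1|].
  apply Rle_trans with (e * (2 / Cmod l * h))%R; [apply Rmult_le_compat_l; lra|].
  unfold e. right. field. lra.
Qed.

(** * Power series on the unit disc *)

Definition CPS (c : nat -> C) (q : C) : C := Ser (fun n => c n * q ^ n).

(** Radius of convergence at least 1, put as Cauchy estimates, a form that survives termwise
    differentiation. *)
Definition unit_radius (c : nat -> C) : Prop :=
  forall r : R, 0 <= r < 1 -> exists B : R, forall n, Cmod (c n) * r ^ n <= B.

Definition coeff_derive (c : nat -> C) (n : nat) : C := RtoC (INR (S n)) * c (S n).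

Lemma unit_radius_summable (c : nat -> C) (r : R) :
  unit_radius c -> 0 <= r < 1 -> rsummable (fun n => Cmod (c n) * r ^ n)%R.
Proof.
  (* The midpoint s of r and 1 leaves room: a bound at s gives a geometric factor (r / s)^n at r. *)
  intros Hc Hr. set (s := ((1 + r) / 2)%R). assert (Hs : 0 < s < 1) by (unfold s; lra).
  destruct (Hc s ltac:(lra)) as [B HB].
  assert (HB0 : 0 <= B).
  { eapply Rle_trans; [|apply (HB 0%nat)]. apply Rmult_le_pos; [apply Cmod_ge_0|simpl; lra]. }
  assert (Hq : 0 <= r / s < 1).
  { split; [apply Rmult_le_pos; [lra|left; apply Rinv_0_lt_compat; lra]|].
    apply Rmult_lt_reg_r with s; [lra|]. unfold Rdiv. rewrite Rmult_assoc, Rinv_l by lra. unfold s. lra. }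
  apply rsummable_le with (M := fun n => (B * (r / s) ^ n)%R).
  - intros n. split.
    + apply Rmult_le_pos; [apply Cmod_ge_0|apply pow_le; lra].
    + replace (r ^ n)%R with (s ^ n * (r / s) ^ n)%R.
      * rewrite <- Rmult_assoc. apply Rmult_le_compat_r; [apply pow_le; lra|apply HB].
      * rewrite <- Rpow_mult_distr. f_equal. field. lra.
  - apply rsummable_scal; [exact HB0|]. now apply rsummable_geom.
Qed.

Lemma CPS_term_bound (c : nat -> C) (q : C) (r : R) (n : nat) :
  Cmod q <= r -> Cmod (c n * q ^ n) <= Cmod (c n) * r ^ n.
Proof.
  intros H. rewrite Cmod_mult, Cmod_pow. apply Rmult_le_compat_l; [apply Cmod_ge_0|].
  apply pow_incr. split; [apply Cmod_ge_0|exact H].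
Qed.

Lemma CPS_correct (c : nat -> C) (q : C) :
  unit_radius c -> Cmod q < 1 -> clim (csum (fun n => c n * q ^ n)) (CPS c q).
Proof.
  intros Hc Hq. apply Ser_correct with (M := fun n => (Cmod (c n) * Cmod q ^ n)%R).
  - intros n. apply CPS_term_bound. lra.
  - apply unit_radius_summable; auto. split; [apply Cmod_ge_0|exact Hq].
Qed.

(** Each of the n + 1 terms of 1 + x + ... + x^n is at least x^n, and the geometric sum is
    bounded. *)
Lemma linear_pow_bounded (x : R) : 0 <= x < 1 -> exists B, forall n, INR (S n) * x ^ n <= B.
Proof.
  intros Hx. destruct (rsummable_geom x Hx) as [_ [B HB]]. exists B. intros n.
  eapply Rle_trans; [|apply (HB (S n))].
  assert (H : forall m, (m <= S n)%nat -> INR m * x ^ n <= rsum (fun k => x ^ k)%R m).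
  { induction m as [|m IH]; intros Hm; [simpl; lra|]. rewrite S_INR. simpl.
    specialize (IH ltac:(lia)).
    assert (x ^ n <= x ^ m).
    { replace n with (m + (n - m))%nat by lia. rewrite pow_add.
      rewrite <- (Rmult_1_r (x ^ m)) at 2. apply Rmult_le_compat_l; [apply pow_le; lra|].
      rewrite <- (pow1 (n - m)). apply pow_incr. lra. }
    lra. }
  apply H. lia.
Qed.

Lemma unit_radius_derive (c : nat -> C) : unit_radius c -> unit_radius (coeff_derive c).
Proof.
  intros Hc r Hr. set (s := ((1 + r) / 2)%R). assert (Hs : 0 < s < 1) by (unfold s; lra).
  destruct (Hc s ltac:(lra)) as [B HB].
  assert (Hq : 0 <= r / s < 1).
  { split; [apply Rmult_le_pos; [lra|left; apply Rinv_0_lt_compat; lra]|].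
    apply Rmult_lt_reg_r with s; [lra|]. unfold Rdiv. rewrite Rmult_assoc, Rinv_l by lra. unfold s. lra. }
  destruct (linear_pow_bounded _ Hq) as [B' HB'].
  exists (B / s * B')%R. intros n. unfold coeff_derive.
  rewrite Cmod_mult, Cmod_R, Rabs_pos_eq by apply pos_INR.
  replace (INR (S n) * Cmod (c (S n)) * r ^ n)%R with
    (Cmod (c (S n)) * s ^ S n / s * (INR (S n) * (r / s) ^ n))%R.
  - apply Rmult_le_compat.
    + apply Rmult_le_pos; [apply Rmult_le_pos; [apply Cmod_ge_0|apply pow_le; lra]|left; apply Rinv_0_lt_compat; lra].
    + apply Rmult_le_pos; [apply pos_INR|apply pow_le; lra].
    + apply Rmult_le_compat_r; [left; apply Rinv_0_lt_compat; lra|apply HB].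
    + apply HB'.
  - replace (r ^ n)%R with (s ^ n * (r / s) ^ n)%R.
    + simpl. field. lra.
    + rewrite <- Rpow_mult_distr. f_equal. field. lra.
Qed.

(** The bound has the coefficients of the second derivative, so the remainders of a whole power
    series add up to |w - z|^2 times a convergent series. The induction multiplies the previous
    remainder by w. *)
Lemma pow_remainder (z w : C) (r : R) (n : nat) :
  Cmod z <= r -> Cmod w <= r ->
  Cmod (w ^ S (S n) - z ^ S (S n) - RtoC (INR (S (S n))) * z ^ S n * (w - z)) <=
  INR (S (S n)) * INR (S n) * r ^ n * (Cmod (w - z) * Cmod (w - z)).
Proof.
  intros Hz Hw. assert (Hr : 0 <= r) by (eapply Rle_trans; [apply Cmod_ge_0|exact Hz]).
  set (h := Cmod (w - z)). assert (Hh : 0 <= h) by apply Cmod_ge_0.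
  assert (K : forall n, Cmod (z ^ n) <= r ^ n).
  { intros m. rewrite Cmod_pow. apply pow_incr. split; [apply Cmod_ge_0|exact Hz]. }
  induction n as [|n IH].
  - replace (INR 2) with 2%R by (simpl; ring).
    replace (w ^ 2 - z ^ 2 - 2 * z ^ 1 * (w - z)) with ((w - z) * (w - z)) by (simpl; ring).
    rewrite Cmod_mult. fold h. simpl. nra.
  - set (m := S (S n)) in *.
    replace (w ^ S m - z ^ S m - RtoC (INR (S m)) * z ^ m * (w - z)) with
      (w * (w ^ m - z ^ m - RtoC (INR m) * z ^ S n * (w - z)) + RtoC (INR m) * z ^ S n * ((w - z) * (w - z))).
    2:{ rewrite (S_INR m), RtoC_plus. unfold m. simpl Cpow. ring. }
    eapply Rle_trans; [apply Cmod_triangle|]. rewrite !Cmod_mult. fold h.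
    rewrite Cmod_R, Rabs_pos_eq by apply pos_INR.
    assert (A : Cmod w * Cmod (w ^ m - z ^ m - RtoC (INR m) * z ^ S n * (w - z)) <=
       r * (INR m * INR (S n) * r ^ n * (h * h))).
    { apply Rmult_le_compat; auto; apply Cmod_ge_0. }
    assert (B : INR m * Cmod (z ^ S n) * (h * h) <= INR m * r ^ S n * (h * h)).
    { apply Rmult_le_compat_r; [nra|]. apply Rmult_le_compat_l; [apply pos_INR|apply K]. }
    fold h in A. apply Rle_trans with (r ^ S n * (h * h) * (INR m * (INR (S n) + 1)))%R.
    { simpl pow in *. lra. }
    replace (INR (S n) + 1)%R with (INR m) by (unfold m; rewrite (S_INR (S n)); reflexivity).
    assert (P0 := pow_le r (S n) Hr).
    assert (INR m * INR m <= INR (S m) * INR m).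
    { apply Rmult_le_compat_r; [apply pos_INR|]. rewrite (S_INR m). lra. }
    replace (INR (S m) * INR m * r ^ S n * (h * h))%R with (r ^ S n * (h * h) * (INR (S m) * INR m))%R by ring.
    apply Rmult_le_compat_l; [|exact H]. apply Rmult_le_pos; nra.
Qed.

Theorem CPS_derive (c : nat -> C) (z : C) :
  unit_radius c -> Cmod z < 1 -> is_C_derive (CPS c) z (CPS (coeff_derive c) z).
Proof.
  intros Hc Hz.
  assert (Hc1 := unit_radius_derive c Hc). assert (Hc2 := unit_radius_derive _ Hc1).
  set (r := ((1 + Cmod z) / 2)%R). assert (Hz0 := Cmod_ge_0 z).
  assert (Hr : 0 <= r < 1) by (unfold r; lra).
  destruct (unit_radius_summable _ r Hc2 Hr) as [_ [B HB]].
  assert (HB0 : 0 <= B) by exact (HB 0%nat).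
  apply is_C_derive_eps. intros eps Hp.
  exists (Rmin ((1 - Cmod z) / 2) (eps / (B + 1))). split.
  { apply Rmin_glb_lt; [lra|]. apply Rdiv_lt_0_compat; lra. }
  intros w Hw. set (h := Cmod (w - z)) in *. assert (Hh : 0 <= h) by apply Cmod_ge_0.
  assert (W1 := Rlt_le_trans _ _ _ Hw (Rmin_l _ _)).
  assert (W2 := Rlt_le_trans _ _ _ Hw (Rmin_r _ _)).
  assert (Hwr : Cmod w <= r).
  { pose proof (Cmod_triangle_rev w z). fold h in H. unfold r. lra. }
  assert (Hzr : Cmod z <= r) by (unfold r; lra).
  apply Rle_trans with (B * (h * h))%R.
  2:{ apply Rmult_lt_compat_l with (r := (B + 1)%R) in W2; [|lra].
      replace ((B + 1) * (eps / (B + 1)))%R with eps in W2 by (field; lra). nra. }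
  (* The remainder of the partial sums. With lengths N + 2, N + 2 and N + 1 the terms of degree 0
     and 1 cancel exactly, and N quadratic remainders are left. *)
  set (T := fun N => csum (fun n => c n * w ^ n) (S (S N)) - csum (fun n => c n * z ^ n) (S (S N))
       - csum (fun n => coeff_derive c n * z ^ n) (S N) * (w - z)).
  apply clim_le with (u := T).
  - exists 0%nat. intros N _.
    replace (T N) with (csum (fun n => c (S (S n)) * (w ^ S (S n) - z ^ S (S n)
         - RtoC (INR (S (S n))) * z ^ S n * (w - z))) N).
    + eapply Rle_trans.
      * apply csum_Cmod with (M := fun n => (h * h * (Cmod (coeff_derive (coeff_derive c) n) * r ^ n))%R).
        intros k _. rewrite Cmod_mult. unfold coeff_derive. rewrite !Cmod_mult, !Cmod_R, !Rabs_pos_eq by apply pos_INR.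
        eapply Rle_trans; [apply Rmult_le_compat_l; [apply Cmod_ge_0|apply pow_remainder; eauto]|].
        fold h. right. ring.
      * rewrite rsum_scal, Rmult_comm. apply Rmult_le_compat_r; [nra|apply HB].
    + unfold T. induction N as [|N IH].
      * simpl. unfold coeff_derive. simpl. ring.
      * change (csum (fun n => c (S (S n)) * (w ^ S (S n) - z ^ S (S n) - RtoC (INR (S (S n))) * z ^ S n * (w - z))) (S N))
          with (csum (fun n => c (S (S n)) * (w ^ S (S n) - z ^ S (S n) - RtoC (INR (S (S n))) * z ^ S n * (w - z))) N
                + c (S (S N)) * (w ^ S (S N) - z ^ S (S N) - RtoC (INR (S (S N))) * z ^ S N * (w - z))).
        rewrite IH.
        change (csum (fun n => c n * w ^ n) (S (S (S N)))) with (csum (fun n => c n * w ^ n) (S (S N)) + c (S (S N)) * w ^ S (S N)).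
        change (csum (fun n => c n * z ^ n) (S (S (S N)))) with (csum (fun n => c n * z ^ n) (S (S N)) + c (S (S N)) * z ^ S (S N)).
        change (csum (fun n => coeff_derive c n * z ^ n) (S (S N))) with
          (csum (fun n => coeff_derive c n * z ^ n) (S N) + coeff_derive c (S N) * z ^ S N).
        unfold coeff_derive at 3. ring.
  - assert (Q : forall k m, exists N, forall n, (N <= n)%nat -> (m <= k + n)%nat)
      by (intros k m; exists m; intros; lia).
    unfold T. apply clim_minus; [apply clim_minus|].
    + apply (clim_subseq _ _ (fun N => S (S N)) (Q 2%nat)). apply CPS_correct; auto. lra.
    + apply (clim_subseq _ _ (fun N => S (S N)) (Q 2%nat)). apply CPS_correct; auto.
    + apply clim_mult; [|apply clim_const].
      apply (clim_subseq _ _ (fun N => S N) (Q 1%nat)). apply CPS_correct; auto.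
Qed.

Lemma CPS_0 (c : nat -> C) : CPS c 0 = c 0%nat.
Proof.
  apply Ser_unique. apply clim_ext_ev with (u := fun _ => c 0%nat); [|apply clim_const].
  exists 1%nat. intros [|n] Hn; [lia|]. rewrite csum_S_l, csum_0; [simpl; ring|].
  intros k _. simpl. ring.
Qed.

(** * Lambert series as power series *)

Lemma geometric_clim (w : C) : Cmod w < 1 -> clim (csum (fun n => w ^ n)) (/ (1 - w)).
Proof.
  intros Hw.
  assert (Hn : 1 - w <> 0).
  { intros E. assert (E' : w = 1) by (replace w with (1 - (1 - w)) by ring; rewrite E; ring).
    rewrite E', Cmod_1 in Hw. lra. }
  assert (H0 : clim (fun n => w ^ n) 0).
  { apply clim_0_Cmod with (e := fun n => (Cmod w ^ n)%R).
    - exists 0%nat. intros n _. rewrite Cmod_pow. lra.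
    - apply is_lim_seq_geom. rewrite Rabs_pos_eq by apply Cmod_ge_0. exact Hw. }
  pose proof (clim_scal (/ (1 - w)) _ _ (clim_minus _ _ _ _ (clim_const 1) H0)) as H.
  replace (/ (1 - w)) with (/ (1 - w) * (1 - 0)) by (field; auto).
  eapply clim_ext; [|exact H]. intros n. simpl.
  induction n as [|n IH]; simpl.
  - field; auto.
  - rewrite <- IH. field. auto.
Qed.

Lemma Cmod_pow_lt_1 (q : C) (n : nat) : Cmod q < 1 -> Cmod (q ^ S n) < 1.
Proof.
  intros H. rewrite Cmod_pow. pose proof (Cmod_ge_0 q).
  induction n as [|n IH]; [simpl; lra|]. change (Cmod q ^ S (S n))%R with (Cmod q * Cmod q ^ S n)%R.
  assert (0 <= Cmod q ^ S n) by (apply pow_le; lra). nra.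
Qed.

(** The divisor sum of g (n / d) over d = [S k] dividing n, which is the Dirichlet convolution of g
    with 1. For g = [chi], four times this is the number of representations of n > 0 as a sum of two
    squares. *)
Definition lambert_coeff (g : nat -> C) (n : nat) : C :=
  csum (fun k => if Nat.eqb (n mod S k) 0 then g (n / S k)%nat else 0) n.

Lemma csum_multiples (g : nat -> C) (q : C) (k M : nat) :
  csum (fun n => (if Nat.eqb (n mod S k) 0 then g (n / S k)%nat else 0) * q ^ n) (M * S k) =
  csum (fun m => g m * (q ^ S k) ^ m) M.
Proof.
  induction M as [|M IH]; [reflexivity|].
  replace (S M * S k)%nat with (M * S k + S k)%nat by lia.
  rewrite csum_add, IH, csum_S_l.
  rewrite (csum_0 _ k).
  - rewrite Nat.add_0_r. rewrite Nat.Div0.mod_mul. simpl Nat.eqb. cbv iota.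
    rewrite Nat.div_mul by lia. cbn [csum]. rewrite <- Cpow_mult_r, (Nat.mul_comm M). ring.
  - intros j Hj. replace ((M * S k + S j) mod S k)%nat with (S j).
    + simpl Nat.eqb. cbv iota. ring.
    + rewrite Nat.add_comm, Nat.Div0.mod_add. rewrite Nat.mod_small by lia. reflexivity.
Qed.

Lemma lambert_sum (g : nat -> C) (q : C) :
  g 0%nat = 0 -> (forall n, Cmod (g n) <= 1) -> Cmod q < 1 ->
  Ser (fun k => Ser (fun m => g m * (q ^ S k) ^ m)) = CPS (lambert_coeff g) q.
Proof.
  intros Hg0 Hg Hq.
  set (a := fun k n => (if Nat.eqb (n mod S k) 0 then g (n / S k)%nat else 0) * q ^ n).
  (* A nonzero entry has n = 0 excluded by [g 0 = 0] and satisfies k < n, so |q|^n = s^n s^n is at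
     most s^k s^n. Splitting off the root gives the product majorant that [Ser_swap] requires. *)
  set (s := sqrt (Cmod q)). assert (Hq0 := Cmod_ge_0 q).
  assert (Hs : 0 <= s < 1).
  { split; [apply sqrt_pos|]. unfold s. rewrite <- sqrt_1. apply sqrt_lt_1; lra. }
  assert (Hsq : (s * s = Cmod q)%R) by (apply sqrt_sqrt; exact Hq0).
  assert (Ha : forall k n, Cmod (a k n) <= s ^ k * s ^ n).
  { intros k n. assert (P : 0 <= s ^ k * s ^ n) by (apply Rmult_le_pos; apply pow_le; lra).
    unfold a. destruct (Nat.eqb (n mod S k) 0) eqn:E.
    - destruct (Nat.eq_dec n 0) as [->|Hn].
      + rewrite Nat.Div0.div_0_l, Hg0, Cmult_0_l, Cmod_0. exact P.
      + apply Nat.eqb_eq in E.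
        assert (Hk : (S k <= n)%nat).
        { destruct (Nat.le_gt_cases (S k) n) as [L|L]; [exact L|].
          rewrite Nat.mod_small in E by lia. lia. }
        rewrite Cmod_mult, Cmod_pow, <- Hsq, Rpow_mult_distr.
        apply Rle_trans with (1 * (s ^ n * s ^ n))%R.
        { apply Rmult_le_compat_r; [apply Rmult_le_pos; apply pow_le; lra|apply Hg]. }
        rewrite Rmult_1_l. apply Rmult_le_compat_r; [apply pow_le; lra|].
        replace n with (k + (n - k))%nat by lia. rewrite pow_add.
        rewrite <- (Rmult_1_r (s ^ k)) at 2. apply Rmult_le_compat_l; [apply pow_le; lra|].
        rewrite <- (pow1 (n - k)). apply pow_incr. lra.
    - rewrite Cmult_0_l, Cmod_0. exact P. }
  assert (Hsum := rsummable_geom s Hs).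
  transitivity (Ser (fun k => Ser (a k))).
  - apply Ser_ext. intros k. apply Ser_unique.
    eapply clim_ext; [intros M; apply csum_multiples|].
    apply (clim_subseq (csum (a k)) (Ser (a k)) (fun M => (M * S k)%nat)).
    + intros m. exists m. intros n Hn. nia.
    + apply Ser_correct with (M := fun n => (s ^ k * s ^ n)%R); [apply Ha|].
      apply rsummable_scal; [apply pow_le; lra|exact Hsum].
  - etransitivity; [exact (Ser_swap a _ _ Hsum Hsum Ha)|]. apply Ser_ext. intros n.
    (* A divisor [S k] of n > 0 has k < n, so the partial sums are constant from n on; for n = 0 all
       terms vanish by [Hg0]. *)
    apply Ser_unique. apply clim_ext_ev with (u := fun _ => lambert_coeff g n * q ^ n); [|apply clim_const].
    exists n. intros N HN. replace N with (n + (N - n))%nat by lia.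
    rewrite csum_add, (csum_0 _ (N - n)).
    + unfold lambert_coeff, a. rewrite Cplus_0_r, Cmult_comm, <- csum_scal.
      apply csum_ext. intros; ring.
    + intros k _. unfold a. destruct n as [|n].
      * rewrite Nat.Div0.div_0_l, Hg0. destruct (Nat.eqb _ _); ring.
      * rewrite Nat.mod_small by lia. simpl. ring.
Qed.

Lemma unit_radius_lambert (g : nat -> C) :
  (forall n, Cmod (g n) <= 1) -> unit_radius (lambert_coeff g).
Proof.
  intros Hg r Hr. destruct (linear_pow_bounded r Hr) as [B HB]. exists B. intros n.
  eapply Rle_trans; [|apply (HB n)]. apply Rmult_le_compat_r; [apply pow_le; lra|].
  eapply Rle_trans; [apply csum_Cmod with (M := fun _ => 1%R)|].
  - intros k _. destruct (Nat.eqb _ _); [apply Hg|rewrite Cmod_0; lra].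
  - rewrite S_INR. assert (rsum (fun _ => 1%R) n = INR n); [|lra].
    induction n as [|n IH]; [reflexivity|]. rewrite S_INR. simpl. lra.
Qed.

(** * The Lambert series al and Lam *)

Lemma Ci_sqr : Ci * Ci = - (1).
Proof. unfold Ci, Cmult, Copp, RtoC; simpl. f_equal; ring. Qed.

(** The nontrivial character modulo 4, with values 0, 1, 0, -1. Written with powers of [Ci], it has
    a difference of two geometric series as generating function. *)
Definition chi (m : nat) : C := (Ci ^ m - (- Ci) ^ m) / (2 * Ci).

Lemma chi_0 : chi 0 = 0.
Proof. unfold chi. simpl. field. apply Ci_nz. Qed.

Lemma C2_nz : RtoC 2 <> 0.
Proof. intros E. apply RtoC_inj in E. lra. Qed.

Lemma chi_bound (m : nat) : Cmod (chi m) <= 1.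
Proof.
  unfold chi. rewrite Cmod_div by (apply Cmult_neq_0; [apply C2_nz|apply Ci_nz]).
  rewrite Cmod_mult, Cmod_R, Cmod_Ci, Rabs_pos_eq by lra.
  pose proof (Cmod_triangle_minus (Ci ^ m) ((- Ci) ^ m)) as H.
  rewrite !Cmod_pow, Cmod_opp, Cmod_Ci, pow1 in H. lra.
Qed.

Definition al (q : C) : C := 1 + 4 * CPS (lambert_coeff chi) q.
Definition be (q : C) : C := al (- q).

Definition sech (w : C) : C := w / (1 + w * w).
(** The Koebe function, the sum of n w^n. At w = exp (2 i a) it equals - 1 / (4 sin(a)^2), which is
    how it enters the rows of [wp]. *)
Definition koebe (w : C) : C := w / ((1 - w) * (1 - w)).
Definition Lam (q : C) : C := Ser (fun k => koebe (q ^ S k)).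

Lemma Cmod_1_plus (w : C) : 1 - Cmod w <= Cmod (1 + w).
Proof.
  pose proof (Cmod_triangle_rev 1 (- w)) as H. rewrite Cmod_1, Cmod_opp in H.
  replace (1 - - w) with (1 + w) in H by ring. exact H.
Qed.

Lemma Cmod_1_minus (w : C) : 1 - Cmod w <= Cmod (1 - w).
Proof. pose proof (Cmod_triangle_rev 1 w) as H. rewrite Cmod_1 in H. exact H. Qed.

Lemma one_plus_nz (w : C) : Cmod w < 1 -> 1 + w <> 0.
Proof. intros H. apply Cmod_gt_0. pose proof (Cmod_1_plus w). lra. Qed.

Lemma one_minus_nz (w : C) : Cmod w < 1 -> 1 - w <> 0.
Proof. intros H. apply Cmod_gt_0. pose proof (Cmod_1_minus w). lra. Qed.

Lemma Cmod_sqr_lt (w : C) : Cmod w < 1 -> Cmod (w * w) < 1.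
Proof. intros H. rewrite Cmod_mult. pose proof (Cmod_ge_0 w). nra. Qed.

Lemma Cmod_pow_le (q : C) (n : nat) : Cmod q < 1 -> Cmod (q ^ S n) <= Cmod q.
Proof.
  intros H. rewrite Cmod_pow. simpl. rewrite <- (Rmult_1_r (Cmod q)) at 3.
  apply Rmult_le_compat_l; [apply Cmod_ge_0|]. rewrite <- (pow1 n).
  apply pow_incr. split; [apply Cmod_ge_0|lra].
Qed.

Lemma sech_bound (w : C) (r : R) :
  Cmod w <= r -> r < 1 -> Cmod (sech w) <= Cmod w / (1 - r).
Proof.
  intros H Hr. unfold sech. pose proof (Cmod_ge_0 w).
  rewrite Cmod_div by (apply one_plus_nz, Cmod_sqr_lt; lra).
  apply Rmult_le_compat_l; [lra|]. apply Rinv_le_contravar; [lra|].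
  eapply Rle_trans; [|apply Cmod_1_plus]. rewrite Cmod_mult. nra.
Qed.

Lemma koebe_bound (w : C) (r : R) :
  Cmod w <= r -> r < 1 -> Cmod (koebe w) <= Cmod w / ((1 - r) * (1 - r)).
Proof.
  intros H Hr. unfold koebe. pose proof (Cmod_ge_0 w).
  assert (Hn : 1 - w <> 0) by (apply one_minus_nz; lra).
  rewrite Cmod_div by (apply Cmult_neq_0; auto).
  apply Rmult_le_compat_l; [lra|]. apply Rinv_le_contravar; [nra|].
  rewrite Cmod_mult. pose proof (Cmod_1_minus w). nra.
Qed.

Lemma lambert_type_clim (f : C -> C) (K : R) (q : C) :
  Cmod q < 1 -> 0 <= K -> (forall w, Cmod w <= Cmod q -> Cmod (f w) <= Cmod w * K) ->
  clim (csum (fun k => f (q ^ S k))) (Ser (fun k => f (q ^ S k))).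
Proof.
  intros Hq HK Hf. pose proof (Cmod_ge_0 q) as H0.
  apply Ser_correct with (M := fun k => (K * Cmod q ^ k)%R).
  - intros k. eapply Rle_trans; [apply Hf, Cmod_pow_le, Hq|].
    rewrite Rmult_comm. apply Rmult_le_compat_l; [exact HK|].
    rewrite Cmod_pow. simpl. pose proof (pow_le (Cmod q) k H0). nra.
  - apply rsummable_scal; [exact HK|]. apply rsummable_geom. lra.
Qed.

Lemma Lam_clim (q : C) : Cmod q < 1 -> clim (csum (fun k => koebe (q ^ S k))) (Lam q).
Proof.
  intros Hq. apply lambert_type_clim with (K := (/ ((1 - Cmod q) * (1 - Cmod q)))%R); auto.
  - left. apply Rinv_0_lt_compat. nra.
  - intros w Hw. now apply koebe_bound.
Qed.

Lemma chi_series (w : C) : Cmod w < 1 -> Ser (fun m => chi m * w ^ m) = sech w.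
Proof.
  intros Hw. apply Ser_unique.
  assert (H1 : Cmod (Ci * w) < 1) by (rewrite Cmod_mult, Cmod_Ci; lra).
  assert (H2 : Cmod (- Ci * w) < 1) by (rewrite Cmod_mult, Cmod_opp, Cmod_Ci; lra).
  pose proof (clim_scal (/ (2 * Ci)) _ _
    (clim_minus _ _ _ _ (geometric_clim _ H1) (geometric_clim _ H2))) as H.
  assert (N1 := one_minus_nz _ H1). assert (N2 := one_minus_nz _ H2).
  assert (N3 := one_plus_nz _ (Cmod_sqr_lt _ Hw)).
  replace (sech w) with (/ (2 * Ci) * (/ (1 - Ci * w) - / (1 - - Ci * w))).
  - eapply clim_ext; [|exact H]. intros n. cbv beta. rewrite <- csum_minus, <- csum_scal.
    apply csum_ext. intros k _. rewrite !Cpow_mult_l. unfold chi. field. apply Ci_nz.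
  - unfold sech.
    replace (1 + w * w) with ((1 - Ci * w) * (1 - - Ci * w)).
    + field. repeat split; auto using Ci_nz.
    + replace ((1 - Ci * w) * (1 - - Ci * w)) with (1 - (Ci * Ci) * (w * w)) by ring.
      rewrite Ci_sqr. ring.
Qed.

(** The second face of [al]: the power series can be differentiated, while this sum of rational
    functions can be manipulated term by term. *)
Lemma al_clim (q : C) :
  Cmod q < 1 -> clim (csum (fun k => sech (q ^ S k))) ((al q - 1) / 4).
Proof.
  intros Hq.
  replace ((al q - 1) / 4) with (Ser (fun k => sech (q ^ S k))).
  - apply lambert_type_clim with (K := (/ (1 - Cmod q))%R); auto.
    + left. apply Rinv_0_lt_compat. lra.
    + intros w Hw. now apply sech_bound.
  - unfold al. rewrite <- (lambert_sum chi q chi_0 chi_bound Hq).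
    transitivity (Ser (fun k => Ser (fun m => chi m * (q ^ S k) ^ m))); [|field].
    apply Ser_ext. intros k. symmetry. apply chi_series. now apply Cmod_pow_lt_1.
Qed.

Lemma Cpow_opp_even (q : C) (n : nat) : (- q) ^ (2 * n) = q ^ (2 * n).
Proof. rewrite !Cpow_mult_r. f_equal. ring. Qed.

(** Twice the even part of the series of n w^n. *)
Lemma koebe_parity (w : C) : Cmod w < 1 -> koebe w + koebe (- w) = 4 * koebe (w * w).
Proof.
  intros H. assert (N1 := one_minus_nz _ H). assert (N2 := one_plus_nz _ H).
  unfold koebe. replace (1 - w * w) with ((1 - w) * (1 + w)) by ring.
  replace (1 - - w) with (1 + w) by ring. field. auto.
Qed.

Lemma sech_sqr (w : C) :
  Cmod w < 1 -> sech w * sech w = koebe (w ^ 2) - 4 * koebe (w ^ 4).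
Proof.
  intros H. assert (H2 := Cmod_sqr_lt _ H).
  assert (N1 := one_minus_nz _ H2). assert (N2 := one_plus_nz _ H2).
  unfold sech, koebe.
  replace (1 - w ^ 4) with ((1 - w * w) * (1 + w * w)) by ring.
  replace (1 - w ^ 2) with (1 - w * w) by ring. field. auto.
Qed.

Lemma clim_double (u : nat -> C) (l : C) : clim u l -> clim (fun n => u (2 * n)%nat) l.
Proof. apply clim_subseq. intros m. exists m. intros; lia. Qed.

(** [sech] is odd, so in the sum for q and - q the odd powers cancel while the even ones double and
    form the series at q^2. *)
Lemma al_sqr_arg (q : C) : Cmod q < 1 -> al (q ^ 2) = (al q + be q) / 2.
Proof.
  intros Hq. assert (Hm : Cmod (- q) < 1) by now rewrite Cmod_opp.
  assert (H2 := Cmod_pow_lt_1 q 1 Hq).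
  assert (E : (al q - 1) / 4 + (be q - 1) / 4 = 2 * ((al (q ^ 2) - 1) / 4)).
  { apply clim_unique with (u := fun N => csum (fun k => sech (q ^ S k)) (2 * N)
                                      + csum (fun k => sech ((- q) ^ S k)) (2 * N)).
    - apply clim_plus; apply (clim_double (csum _)); apply al_clim; auto.
    - eapply clim_ext; [|exact (clim_scal 2 _ _ (al_clim _ H2))].
      intros N. cbv beta. induction N as [|N IH]; [simpl; ring|].
      replace (2 * S N)%nat with (S (S (2 * N))) by lia. cbn [csum].
      rewrite Cmult_plus_distr_l, IH.
      replace (S (S (2 * N)))%nat with (2 * S N)%nat by lia.
      rewrite Cpow_opp_even, (Cpow_mult_r q 2 (S N)).
      rewrite !(Cpow_S _ (2 * N)), Cpow_opp_even.
      assert (S1 : Cmod (q * q ^ (2 * N)) < 1) by exact (Cmod_pow_lt_1 q (2 * N) Hq).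
      replace (- q * q ^ (2 * N)) with (- (q * q ^ (2 * N))) by ring.
      set (w := q * q ^ (2 * N)) in *. assert (N2 := one_plus_nz _ (Cmod_sqr_lt _ S1)).
      assert (A : sech (- w) = - sech w).
      { unfold sech. replace (- w * - w) with (w * w) by ring. field. auto. }
      rewrite A. ring. }
  replace (al (q ^ 2)) with (1 + 2 * (2 * ((al (q ^ 2) - 1) / 4))) by field.
  rewrite <- E. field.
Qed.

(** In Lam q + Lam (- q) the even powers give 2 Lam (q^2). By [koebe_parity] the odd ones give four
    times the sum over odd powers of q^2, that is 4 (Lam (q^2) - Lam (q^4)). *)
Lemma Lam_opp (q : C) : Cmod q < 1 -> Lam (- q) = - Lam q + 6 * Lam (q ^ 2) - 4 * Lam (q ^ 4).
Proof.
  intros Hq. assert (Hm : Cmod (- q) < 1) by now rewrite Cmod_opp.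
  assert (H2 := Cmod_pow_lt_1 q 1 Hq). assert (H4 := Cmod_pow_lt_1 q 3 Hq).
  assert (E : Lam q + Lam (- q) = 2 * Lam (q ^ 2) + 4 * (Lam (q ^ 2) - Lam (q ^ 4))).
  { apply clim_unique with (u := fun N => csum (fun k => koebe (q ^ S k)) (2 * N)
                                      + csum (fun k => koebe ((- q) ^ S k)) (2 * N)).
    - apply clim_plus; apply (clim_double (csum _)); apply Lam_clim; auto.
    - eapply clim_ext; [|exact (clim_plus _ _ _ _ (clim_scal 2 _ _ (Lam_clim _ H2))
         (clim_scal 4 _ _ (clim_minus _ _ _ _ (clim_double _ _ (Lam_clim _ H2)) (Lam_clim _ H4))))].
      intros N. cbv beta. induction N as [|N IH]; [simpl; ring|].
      replace (2 * S N)%nat with (S (S (2 * N))) by lia. cbn [csum].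
      replace (S (S (2 * N)))%nat with (2 * S N)%nat by lia.
      rewrite Cpow_opp_even, (Cpow_mult_r q 2 (S N)).
      assert (A : koebe (q ^ S (2 * N)) + koebe ((- q) ^ S (2 * N)) = 4 * koebe ((q ^ 2) ^ S (2 * N))).
      { replace ((- q) ^ S (2 * N)) with (- (q ^ S (2 * N))).
        - rewrite koebe_parity by now apply Cmod_pow_lt_1. do 2 f_equal.
          rewrite <- Cpow_mult_l. f_equal. ring.
        - rewrite !Cpow_S, Cpow_opp_even. ring. }
      assert (B : koebe ((q ^ 2) ^ (2 * S N)) = koebe ((q ^ 4) ^ S N)).
      { f_equal. rewrite (Cpow_mult_r _ 2 (S N)), <- (Cpow_mult_r q 2 2). reflexivity. }
      rewrite B.
      match goal with |- ?l = ?r =>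
        match type of IH with ?l0 = ?r0 =>
          replace r with (r0 + (koebe (q ^ S (2 * N)) + koebe ((- q) ^ S (2 * N)))
                            + 2 * koebe ((q ^ 2) ^ S N)) by ring end end.
      rewrite <- IH, A. ring. }
  replace (Lam (- q)) with (Lam q + Lam (- q) - Lam q) by ring. rewrite E. ring.
Qed.

(** The geometric series differentiated termwise; uniqueness of derivatives identifies the
    result. *)
Lemma coeff_derive_geom (w : C) :
  Cmod w < 1 -> clim (csum (fun n => RtoC (INR (S n)) * w ^ n)) (/ ((1 - w) * (1 - w))).
Proof.
  intros Hw. set (one := fun _ : nat => RtoC 1).
  assert (H1 : unit_radius one).
  { intros r Hr. exists 1%R. intros n. unfold one. rewrite Cmod_1, Rmult_1_l.
    rewrite <- (pow1 n). apply pow_incr. lra. }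
  assert (N : 1 - w <> 0) by now apply one_minus_nz.
  assert (E : CPS (coeff_derive one) w = / ((1 - w) * (1 - w))).
  { apply C_derive_unique with (f := CPS one) (z := w); [now apply CPS_derive|].
    apply C_derive_ext_loc with (f := fun x => / (1 - x)).
    - exists (1 - Cmod w)%R. split; [lra|]. intros x Hx.
      assert (Cmod x < 1).
      { pose proof (Cmod_triangle_rev x w). lra. }
      symmetry. apply Ser_unique. eapply clim_ext; [|now apply geometric_clim].
      intros n. apply csum_ext. intros k _. unfold one. ring.
    - eapply C_derive_eq.
      + apply (C_derive_comp Cinv (fun x => 1 - x) w (- / ((1 - w) * (1 - w))) (0 - 1)).
        * now apply C_derive_inv.
        * apply C_derive_minus; [apply C_derive_const|apply C_derive_id].
      + field. auto. }
  rewrite <- E. eapply clim_ext; [|apply CPS_correct; [apply unit_radius_derive, H1|exact Hw]].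
  intros n. apply csum_ext. intros k _. unfold coeff_derive, one. ring.
Qed.

Lemma rsummable_linear_geom (r : R) : 0 <= r < 1 -> rsummable (fun k => INR (S k) * r ^ k)%R.
Proof.
  intros Hr.
  assert (H1 : unit_radius (fun n => RtoC (INR (S n)))).
  { intros s Hs. destruct (linear_pow_bounded s Hs) as [B HB]. exists B. intros n.
    rewrite Cmod_R, Rabs_pos_eq by apply pos_INR. apply HB. }
  pose proof (unit_radius_summable _ r H1 Hr) as H.
  apply rsummable_le with (2 := H). intros k.
  rewrite Cmod_R, Rabs_pos_eq by apply pos_INR.
  split; [|lra]. apply Rmult_le_pos; [apply pos_INR|apply pow_le; lra].
Qed.

(* Expanding koebe (q^k) and exchanging the order of summation. *)
Lemma Lam_lambert (q : C) :
  Cmod q < 1 ->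
  clim (csum (fun d => RtoC (INR (S d)) * (q ^ S d / (1 - q ^ S d)))) (Lam q).
Proof.
  intros Hq. pose proof (Cmod_ge_0 q) as H0.
  set (a := fun k d => RtoC (INR (S d)) * (q ^ (S k * S d))).
  set (r := Cmod q) in *.
  assert (U := rsummable_geom r (conj H0 Hq)).
  assert (V := rsummable_linear_geom r (conj H0 Hq)).
  assert (Ha : forall k d, Cmod (a k d) <= r ^ k * (INR (S d) * r ^ d)).
  { intros k d. unfold a. rewrite Cmod_mult, Cmod_R, Rabs_pos_eq, Cmod_pow by apply pos_INR. fold r.
    replace (r ^ k * (INR (S d) * r ^ d))%R with (INR (S d) * (r ^ (k + d)))%R by (rewrite pow_add; ring).
    apply Rmult_le_compat_l; [apply pos_INR|].
    replace (S k * S d)%nat with ((k + d) + (1 + k * d))%nat by lia. rewrite pow_add.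
    rewrite <- (Rmult_1_r (r ^ (k + d))) at 2. apply Rmult_le_compat_l; [apply pow_le; lra|].
    rewrite <- (pow1 (1 + k * d)). apply pow_incr. lra. }
  assert (E1 : Lam q = Ser (fun k => Ser (fun d => a k d))).
  { apply Ser_ext. intros k. symmetry. apply Ser_unique.
    pose proof (clim_scal (q ^ S k) _ _ (coeff_derive_geom _ (Cmod_pow_lt_1 q k Hq))) as H.
    eapply clim_ext; [|exact H]. intros n. cbv beta. rewrite <- csum_scal. apply csum_ext.
    intros d _. unfold a. rewrite (Cpow_mult_r q (S k)), (Cpow_S (q ^ S k)). ring. }
  assert (E2 : forall d, clim (csum (fun k => a k d)) (RtoC (INR (S d)) * (q ^ S d / (1 - q ^ S d)))).
  { intros d.
    pose proof (clim_scal (RtoC (INR (S d)) * q ^ S d) _ _ (geometric_clim _ (Cmod_pow_lt_1 q d Hq))) as H.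
    replace (RtoC (INR (S d)) * (q ^ S d / (1 - q ^ S d))) with
      (RtoC (INR (S d)) * q ^ S d * / (1 - q ^ S d)) by (unfold Cdiv; ring).
    eapply clim_ext; [|exact H]. intros n. cbv beta. rewrite <- csum_scal. apply csum_ext.
    intros k _. unfold a. rewrite Nat.mul_comm, (Cpow_mult_r q (S d)), (Cpow_S (q ^ S d)). ring. }
  rewrite E1, (Ser_swap a _ _ U V Ha).
  assert (E3 : forall d, Ser (fun k => a k d) = RtoC (INR (S d)) * (q ^ S d / (1 - q ^ S d))).
  { intros d. apply Ser_unique, E2. }
  apply clim_ext with (u := csum (fun d => Ser (fun k => a k d))).
  { intros n. apply csum_ext. intros d _. apply E3. }
  destruct U as [U0 [B HB]].
  apply Ser_correct with (M := fun d => (B * (INR (S d) * r ^ d))%R).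
  - intros d. apply Ser_Cmod with (M := fun k => ((INR (S d) * r ^ d) * r ^ k)%R).
    + intros k. rewrite Rmult_comm. apply Ha.
    + apply rsummable_scal; [apply V|]. split; eauto.
    + intros n. rewrite rsum_scal, Rmult_comm. apply Rmult_le_compat_r; [apply V|apply HB].
  - apply rsummable_scal; [exact (HB 0%nat)|exact V].
Qed.

(** * Jacobi's identity al^2 = 1 + 8 Lam(q) - 32 Lam(q^4) *)

Section Jacobi.

Variable q : C.
Hypothesis Hq : Cmod q < 1.

(* With q = exp (i a), these are 1 / cos (n a), - i tan (n a) (twice) and i / sin (d a);
   [sec_mult] is 1 / (cos x cos y) = (tan x - tan y) / sin (x - y). *)
Definition sec_at (n : Z) : C := 2 * sech (q ^ Z.abs_nat n).
Definition tan_nat (n : nat) : C := (1 - q ^ n * q ^ n) / (1 + q ^ n * q ^ n).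
Definition tan_at (n : Z) : C := if (0 <=? n)%Z then tan_nat (Z.abs_nat n) else - tan_nat (Z.abs_nat n).
Definition cosec (d : nat) : C := 2 * (q ^ d / (1 - q ^ d * q ^ d)).

Lemma den_nz (n : nat) : 1 + q ^ n * q ^ n <> 0.
Proof.
  destruct n as [|n].
  - simpl. replace (1 + 1 * 1) with (RtoC 2) by (rewrite Cmult_1_l, <- RtoC_plus; f_equal; ring).
    apply C2_nz.
  - apply one_plus_nz, Cmod_sqr_lt. now apply Cmod_pow_lt_1.
Qed.

Lemma den_nz' (n : nat) : (0 < n)%nat -> 1 - q ^ n * q ^ n <> 0.
Proof.
  destruct n as [|n]; [lia|]. intros _. apply one_minus_nz, Cmod_sqr_lt. now apply Cmod_pow_lt_1.
Qed.

Lemma tan_nat_0 : tan_nat 0 = 0.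
Proof. unfold tan_nat. simpl. unfold Cdiv. ring. Qed.

Lemma tan_opp (n : Z) : tan_at (- n) = - tan_at n.
Proof.
  unfold tan_at. replace (Z.abs_nat (- n)) with (Z.abs_nat n) by lia.
  destruct (Z.leb_spec 0 n), (Z.leb_spec 0 (- n)); try lia; try ring.
  replace (Z.abs_nat n) with 0%nat by lia. rewrite tan_nat_0. ring.
Qed.

Lemma sec_mult (n d : nat) :
  (1 <= d <= 2 * n)%nat ->
  sec_at (Z.of_nat n) * sec_at (Z.of_nat n - Z.of_nat d) = cosec d * (tan_at (Z.of_nat n) - tan_at (Z.of_nat n - Z.of_nat d)).
Proof.
  intros Hd. unfold sec_at, tan_at.
  rewrite (proj2 (Z.leb_le 0 (Z.of_nat n))) by lia.
  replace (Z.abs_nat (Z.of_nat n)) with n by lia.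
  destruct (Z.leb_spec 0 (Z.of_nat n - Z.of_nat d)) as [Hs|Hs].
  - replace (Z.abs_nat (Z.of_nat n - Z.of_nat d)) with (n - d)%nat by lia.
    set (m := (n - d)%nat). pose proof (den_nz n) as N1. pose proof (den_nz m) as N2.
    pose proof (den_nz' d ltac:(lia)) as N3.
    unfold tan_nat, cosec, sech. replace n with (m + d)%nat in * by lia. rewrite Cpow_add_r in *.
    field. auto.
  - replace (Z.abs_nat (Z.of_nat n - Z.of_nat d)) with (d - n)%nat by lia.
    set (m := (d - n)%nat). pose proof (den_nz n) as N1. pose proof (den_nz m) as N2.
    pose proof (den_nz' d ltac:(lia)) as N3.
    unfold tan_nat, cosec, sech. replace d with (n + m)%nat in * by lia. rewrite Cpow_add_r in *.
    field. auto.
Qed.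

Definition tan_window (N d : nat) : C := csum (fun i => tan_at (Z.of_nat N - Z.of_nat i)) d.
(** For a fixed difference d, the products of secants at n and n - d inside the window -N..N
    telescope to cosec d times the d highest tangents minus the d lowest, which by oddness is 2
    [tan_window]. Both signs of d then give the factor 4 of [sec_sum_square]. *)
Definition off_diag (N : nat) : C := csum (fun k => cosec (S k) * tan_window N (S k)) (2 * N).
Definition sec_sum (N : nat) : C := csum (fun i => sec_at (Z.of_nat N - Z.of_nat i)) (S (2 * N)).

Lemma tan_window_symmetric (N : nat) : tan_window N (S (2 * N)) = 0.
Proof.
  induction N as [|N IH].
  - unfold tan_window. simpl. unfold tan_at. simpl. rewrite tan_nat_0. ring.
  - unfold tan_window in *. replace (S (2 * S N)) with (S (S (S (2 * N)))) by lia.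
    rewrite csum_S_l. cbn [csum].
    rewrite (csum_ext _ (fun i => tan_at (Z.of_nat N - Z.of_nat i))) by (intros; f_equal; lia).
    replace (Z.of_nat (S N) - Z.of_nat (S (2 * N)))%Z with (Z.of_nat N - Z.of_nat (2 * N))%Z by lia.
    cbn [csum] in IH. rewrite IH.
    replace (Z.of_nat (S N) - Z.of_nat (S (S (2 * N))))%Z with (- (Z.of_nat (S N) - Z.of_nat 0))%Z by lia.
    rewrite tan_opp. ring.
Qed.

Lemma tan_window_step (N d : nat) :
  tan_window (S N) d - tan_window N d = tan_at (Z.of_nat (S N)) - tan_at (Z.of_nat (S N) - Z.of_nat d).
Proof.
  induction d as [|d IH].
  - unfold tan_window. simpl csum. rewrite Z.sub_0_r. ring.
  - unfold tan_window in *. cbn [csum]. 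
    replace (Z.of_nat (S N) - Z.of_nat (S d))%Z with (Z.of_nat N - Z.of_nat d)%Z by lia.
    match goal with |- (?a + ?b) - (?c + ?d) = ?r => replace (a + b - (c + d)) with ((a - c) + b - d) by ring end.
    rewrite IH. ring.
Qed.

Lemma sec_sum_step (N : nat) : sec_sum (S N) = sec_sum N + 2 * sec_at (Z.of_nat (S N)).
Proof.
  unfold sec_sum. replace (S (2 * S N)) with (S (S (S (2 * N)))) by lia.
  rewrite csum_S_l. cbn [csum].
  rewrite (csum_ext _ (fun i => sec_at (Z.of_nat N - Z.of_nat i))) by (intros; f_equal; lia).
  replace (Z.of_nat (S N) - Z.of_nat (S (2 * N)))%Z with (Z.of_nat N - Z.of_nat (2 * N))%Z by lia.
  replace (sec_at (Z.of_nat (S N) - Z.of_nat (S (S (2 * N))))) with (sec_at (Z.of_nat (S N)))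
    by (unfold sec_at; f_equal; f_equal; f_equal; lia).
  replace (Z.of_nat (S N) - Z.of_nat (S (2 * N)))%Z with (Z.of_nat N - Z.of_nat (2 * N))%Z by lia.
  rewrite Z.sub_0_r. ring.
Qed.

Lemma sec_sum_eq (N : nat) : sec_sum N = 1 + 4 * csum (fun k => sech (q ^ S k)) N.
Proof.
  induction N as [|N IH].
  - unfold sec_sum, sec_at, sech. simpl. field.
  - rewrite sec_sum_step, IH. unfold sec_at. cbn [csum].
    replace (Z.abs_nat (Z.of_nat (S N))) with (S N) by lia. ring.
Qed.

Lemma sec_sum_square (N : nat) :
  sec_sum N * sec_sum N = 1 + 8 * csum (fun k => sech (q ^ S k) * sech (q ^ S k)) N + 4 * off_diag N.
Proof.
  induction N as [|N IH].
  - rewrite sec_sum_eq. unfold off_diag. simpl. ring.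
  - rewrite sec_sum_step. cbn [csum].
    set (t := sec_at (Z.of_nat (S N))).
    assert (E1 : t * sec_sum N = csum (fun k => cosec (S k) * (tan_at (Z.of_nat (S N)) - tan_at (Z.of_nat (S N) - Z.of_nat (S k)))) (S (2 * N))).
    { unfold sec_sum. rewrite <- csum_scal. apply csum_ext. intros k Hk. unfold t.
      rewrite <- sec_mult by lia. do 2 f_equal. lia. }
    (* The difference d = 2 N + 1 fits the pattern because its window at N is symmetric and sums to
       0. The pair N + 1, -(N + 1), of difference 2 N + 2, is new and adds the last term. *)
    assert (E2 : off_diag (S N) = off_diag N + t * sec_sum N + cosec (S (S (2 * N))) * tan_at (Z.of_nat (S N))).
    { unfold off_diag. replace (2 * S N)%nat with (S (S (2 * N))) by lia. rewrite E1. cbn [csum].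
      assert (E3 : tan_window (S N) (S (2 * N)) = tan_at (Z.of_nat (S N)) - tan_at (Z.of_nat (S N) - Z.of_nat (S (2 * N)))).
      { rewrite <- tan_window_step, tan_window_symmetric. ring. }
      assert (E4 : tan_window (S N) (S (S (2 * N))) = tan_at (Z.of_nat (S N))).
      { pose proof (tan_window_step N (S (S (2 * N)))) as H.
        assert (E5 : tan_window N (S (S (2 * N))) = - tan_at (Z.of_nat (S N))).
        { change (tan_window N (S (S (2 * N)))) with (tan_window N (S (2 * N)) + tan_at (Z.of_nat N - Z.of_nat (S (2 * N)))).
          rewrite tan_window_symmetric, <- tan_opp. replace (- Z.of_nat (S N))%Z with (Z.of_nat N - Z.of_nat (S (2 * N)))%Z by lia. ring. }
        rewrite E5 in H.
        replace (Z.of_nat (S N) - Z.of_nat (S (S (2 * N))))%Z with (- Z.of_nat (S N))%Z in H by lia.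
        rewrite tan_opp in H.
        replace (tan_window (S N) (S (S (2 * N)))) with ((tan_window (S N) (S (S (2 * N))) - - tan_at (Z.of_nat (S N))) - tan_at (Z.of_nat (S N))) by ring.
        rewrite H. ring. }
      rewrite E3, E4.
      rewrite (csum_ext (fun k => cosec (S k) * tan_window (S N) (S k))
        (fun k => cosec (S k) * tan_window N (S k) + cosec (S k) * (tan_at (Z.of_nat (S N)) - tan_at (Z.of_nat (S N) - Z.of_nat (S k))))).
      - rewrite csum_plus. ring.
      - intros k _. rewrite <- tan_window_step. ring. }
    rewrite E2.
    (* This is tan a / sin (2 a) = 1 / (2 cos(a)^2). *)
    assert (E6 : cosec (S (S (2 * N))) * tan_at (Z.of_nat (S N)) = 2 * (sech (q ^ S N) * sech (q ^ S N))).
    { unfold tan_at. rewrite (proj2 (Z.leb_le 0 (Z.of_nat (S N)))) by lia.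
      replace (Z.abs_nat (Z.of_nat (S N))) with (S N) by lia.
      replace (S (S (2 * N))) with (S N + S N)%nat by lia.
      unfold cosec, tan_nat, sech. pose proof (den_nz (S N)) as N1. pose proof (den_nz' (S N + S N) ltac:(lia)) as N2.
      rewrite Cpow_add_r in *. field. auto. }
    rewrite E6.
    replace ((sec_sum N + 2 * t) * (sec_sum N + 2 * t)) with (sec_sum N * sec_sum N + 4 * (t * sec_sum N) + 4 * (t * t)) by ring.
    rewrite IH.
    assert (E7 : t = 2 * sech (q ^ S N)).
    { unfold t, sec_at. replace (Z.abs_nat (Z.of_nat (S N))) with (S N) by lia. reflexivity. }
    rewrite E7. ring.
Qed.

Lemma tan_nat_bound (n : nat) : Cmod (tan_nat n) <= 2 / (1 - Cmod q).
Proof.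
  pose proof (Cmod_ge_0 q) as H0. assert (P : 0 < / (1 - Cmod q)) by (apply Rinv_0_lt_compat; lra).
  destruct n as [|n].
  - rewrite tan_nat_0, Cmod_0. unfold Rdiv. lra.
  - unfold tan_nat. rewrite Cmod_div by apply den_nz.
    pose proof (Cmod_pow_le q n Hq) as H. set (w := q ^ S n) in *. pose proof (Cmod_ge_0 w) as Hw.
    apply Rmult_le_compat.
    + apply Cmod_ge_0.
    + left. apply Rinv_0_lt_compat, Cmod_gt_0, den_nz.
    + eapply Rle_trans; [apply Cmod_triangle_minus|]. rewrite Cmod_1, Cmod_mult. nra.
    + apply Rinv_le_contravar; [lra|]. eapply Rle_trans; [|apply Cmod_1_plus].
      rewrite Cmod_mult. nra.
Qed.

Lemma tan_nat_clim : clim tan_nat 1.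
Proof.
  pose proof (Cmod_ge_0 q) as H0.
  assert (H : clim (fun n => tan_nat n - 1) 0).
  { apply clim_0_Cmod with (e := fun n => (2 / (1 - Cmod q) * Cmod q ^ n)%R).
    - exists 1%nat. intros [|n] Hn; [lia|].
      unfold tan_nat. pose proof (den_nz (S n)) as N. pose proof (Cmod_pow_le q n Hq) as H.
      pose proof (Cmod_pow q (S n)) as Hp. set (w := q ^ S n) in *. pose proof (Cmod_ge_0 w) as Hw.
      replace ((1 - w * w) / (1 + w * w) - 1) with (- (2 * (w * w)) / (1 + w * w)) by (field; auto).
      rewrite Cmod_div, Cmod_opp, !Cmod_mult, Cmod_R, Rabs_pos_eq, <- Hp by (auto; lra).
      replace (2 / (1 - Cmod q) * Cmod w)%R with (2 * Cmod w * / (1 - Cmod q))%R by (unfold Rdiv; ring).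
      apply Rmult_le_compat.
      + nra.
      + left. apply Rinv_0_lt_compat, Cmod_gt_0. exact N.
      + nra.
      + apply Rinv_le_contravar; [lra|]. eapply Rle_trans; [|apply Cmod_1_plus].
        rewrite Cmod_mult. nra.
    - replace (Finite 0) with (Rbar_mult (2 / (1 - Cmod q))%R 0%R) by (simpl; f_equal; ring).
      apply is_lim_seq_scal_l. apply is_lim_seq_geom. rewrite Rabs_pos_eq; lra. }
  pose proof (clim_plus _ _ _ _ H (clim_const 1)) as H1.
  replace (0 + 1) with (RtoC 1) in H1 by ring.
  eapply clim_ext; [|exact H1]. intros n. simpl. ring.
Qed.

Lemma tan_window_clim (d : nat) : clim (fun N => tan_window N d) (RtoC (INR d)).
Proof.
  induction d as [|d IH].
  - exact (clim_const 0).
  - rewrite S_INR, RtoC_plus. unfold tan_window. cbn [csum].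
    apply clim_plus; [exact IH|].
    apply clim_ext_ev with (u := fun N => tan_nat (N - d)%nat).
    + exists d. intros N HN. unfold tan_at. rewrite (proj2 (Z.leb_le _ _)) by lia. f_equal. lia.
    + apply (clim_subseq tan_nat 1 (fun N => (N - d)%nat)); [|apply tan_nat_clim].
      intros m. exists (m + d)%nat. intros; lia.
Qed.

Lemma tan_window_bound (N d : nat) : Cmod (tan_window N d) <= INR d * (2 / (1 - Cmod q)).
Proof.
  unfold tan_window. eapply Rle_trans; [apply csum_Cmod with (M := fun _ => (2 / (1 - Cmod q) * 1)%R)|].
  - intros k _. rewrite Rmult_1_r. unfold tan_at.
    destruct (Z.leb _ _); [|rewrite Cmod_opp]; apply tan_nat_bound.
  - rewrite rsum_scal, Rmult_comm. apply Rmult_le_compat_r.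
    + left. apply Rdiv_lt_0_compat; lra.
    + induction d as [|d IH]; [simpl; lra|]. rewrite S_INR. simpl. lra.
Qed.

Lemma cosec_bound (k : nat) : Cmod (cosec (S k)) <= 2 / (1 - Cmod q) * Cmod q ^ k.
Proof.
  pose proof (Cmod_ge_0 q) as H0.
  unfold cosec. pose proof (den_nz' (S k) ltac:(lia)) as N.
  rewrite Cmod_mult, Cmod_div, Cmod_R, Rabs_pos_eq by (auto; lra).
  pose proof (Cmod_pow_le q k Hq) as H.
  assert (Hk : Cmod (q ^ S k) <= Cmod q ^ k).
  { rewrite Cmod_pow. simpl. pose proof (pow_le _ k H0). nra. }
  set (w := q ^ S k) in *. pose proof (Cmod_ge_0 w) as Hw.
  replace (2 / (1 - Cmod q) * Cmod q ^ k)%R with (2 * (Cmod q ^ k * / (1 - Cmod q)))%R by (unfold Rdiv; ring).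
  apply Rmult_le_compat_l; [lra|]. apply Rmult_le_compat; auto.
  - left. apply Rinv_0_lt_compat, Cmod_gt_0. exact N.
  - apply Rinv_le_contravar; [lra|]. eapply Rle_trans; [|apply Cmod_1_minus].
    rewrite Cmod_mult. nra.
Qed.

(** Each tangent tends to 1, so the window of length d tends to d. The sum of d q^d / (1 - q^(2 d))
    is a difference of two series of [Lam_lambert], since w / (1 - w^2) = w / (1 - w) - w^2 / (1 -
    w^2). *)
Lemma off_diag_clim : clim off_diag (2 * (Lam q - Lam (q ^ 2))).
Proof.
  pose proof (Cmod_ge_0 q) as H0. assert (P : 0 < / (1 - Cmod q)) by (apply Rinv_0_lt_compat; lra).
  assert (H2 := Cmod_pow_lt_1 q 1 Hq).
  replace (2 * (Lam q - Lam (q ^ 2))) with (Ser (fun k => cosec (S k) * RtoC (INR (S k)))).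
  - apply tannery with (M := fun k => ((2 / (1 - Cmod q)) * (2 / (1 - Cmod q)) * (INR (S k) * Cmod q ^ k))%R).
    + apply rsummable_scal; [unfold Rdiv; nra|]. apply rsummable_linear_geom. lra.
    + exists 0%nat. intros N k _ _. rewrite Cmod_mult.
      eapply Rle_trans; [apply Rmult_le_compat; [apply Cmod_ge_0|apply Cmod_ge_0|apply cosec_bound|apply tan_window_bound]|].
      right. ring.
    + intros k. apply clim_scal. apply tan_window_clim.
    + intros m. exists m. intros; lia.
  - apply Ser_unique.
    eapply clim_ext; [|exact (clim_scal 2 _ _ (clim_minus _ _ _ _ (Lam_lambert _ Hq) (Lam_lambert _ H2)))].
    intros n. cbv beta. rewrite <- csum_minus, <- csum_scal. apply csum_ext. intros k _.
    unfold cosec. replace ((q ^ 2) ^ S k) with (q ^ S k * q ^ S k)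
      by (rewrite <- Cpow_mult_l; f_equal; ring).
    pose proof (Cmod_pow_lt_1 q k Hq) as Hw. set (w := q ^ S k) in *.
    pose proof (one_minus_nz _ Hw). pose proof (one_minus_nz _ (Cmod_sqr_lt _ Hw)). field. auto.
Qed.

(** By [sech_sqr] the diagonal yields 8 Lam (q^2) - 32 Lam (q^4), and the rest yields 8 Lam q - 8
    Lam (q^2); the middle terms cancel. *)
Theorem al_square : al q * al q = 1 + 8 * Lam q - 32 * Lam (q ^ 4).
Proof.
  assert (H2 := Cmod_pow_lt_1 q 1 Hq). assert (H4 := Cmod_pow_lt_1 q 3 Hq).
  assert (HZ : clim sec_sum (al q)).
  { replace (al q) with (1 + 4 * ((al q - 1) / 4)) by field.
    eapply clim_ext; [|exact (clim_plus _ _ _ _ (clim_const 1) (clim_scal 4 _ _ (al_clim q Hq)))].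
    intros n. symmetry. apply sec_sum_eq. }
  apply clim_unique with (u := fun N => sec_sum N * sec_sum N); [now apply clim_mult|].
  assert (HS : clim (csum (fun k => sech (q ^ S k) * sech (q ^ S k))) (Lam (q ^ 2) - 4 * Lam (q ^ 4))).
  { eapply clim_ext; [|exact (clim_minus _ _ _ _ (Lam_clim _ H2) (clim_scal 4 _ _ (Lam_clim _ H4)))].
    intros n. cbv beta. rewrite <- csum_scal, <- csum_minus. apply csum_ext. intros k _.
    rewrite sech_sqr by now apply Cmod_pow_lt_1.
    rewrite <- !Cpow_mult_r, !(Nat.mul_comm (S k)). reflexivity. }
  pose proof (clim_plus _ _ _ _ (clim_plus _ _ _ _ (clim_const 1) (clim_scal 8 _ _ HS)) (clim_scal 4 _ _ off_diag_clim)) as H.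
  replace (1 + 8 * Lam q - 32 * Lam (q ^ 4)) with
    (1 + 8 * (Lam (q ^ 2) - 4 * Lam (q ^ 4)) + 4 * (2 * (Lam q - Lam (q ^ 2)))) by ring.
  eapply clim_ext; [|exact H]. intros N. cbv beta. symmetry. apply sec_sum_square.
Qed.

End Jacobi.

Lemma be_square (q : C) : Cmod q < 1 -> be q * be q = 1 - 8 * Lam q + 48 * Lam (q ^ 2) - 64 * Lam (q ^ 4).
Proof.
  intros Hq. unfold be. rewrite al_square by now rewrite Cmod_opp.
  rewrite Lam_opp by exact Hq. replace ((- q) ^ 4) with (q ^ 4) by ring. ring.
Qed.

(* The second half of the arithmetic-geometric mean step; the first is [al_sqr_arg]. *)
Theorem be_sqr_arg (q : C) : Cmod q < 1 -> be (q ^ 2) * be (q ^ 2) = al q * be q.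
Proof.
  intros Hq. assert (H2 := Cmod_pow_lt_1 q 1 Hq).
  pose proof (al_sqr_arg q Hq) as E. pose proof (al_square q Hq) as A.
  pose proof (be_square q Hq) as B. pose proof (al_square _ H2) as A2.
  rewrite (be_square _ H2).
  rewrite <- !Cpow_mult_r in *. simpl Nat.mul in *.
  rewrite E in A2.
  (* The product is rewritten by the squares of al, be and (al + be) / 2 = al (q^2), all of which
     are linear in [Lam]. *)
  replace (al q * be q) with
    (2 * ((al q + be q) / 2 * ((al q + be q) / 2)) - (al q * al q + be q * be q) / 2) by field.
  rewrite A2, A, B. field.
Qed.

(** * Differential equations for al *)

Definition al1 (q : C) : C := 4 * CPS (coeff_derive (lambert_coeff chi)) q.
Definition al2 (q : C) : C := 4 * CPS (coeff_derive (coeff_derive (lambert_coeff chi))) q.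

Lemma lambert_chi_radius : unit_radius (lambert_coeff chi).
Proof. exact (unit_radius_lambert chi chi_bound). Qed.

Lemma al_derive (q : C) : Cmod q < 1 -> is_C_derive al q (al1 q).
Proof.
  intros Hq. eapply C_derive_eq.
  - apply C_derive_plus; [apply C_derive_const|].
    apply C_derive_scal. apply CPS_derive; [apply lambert_chi_radius|exact Hq].
  - unfold al1. ring.
Qed.

Lemma al1_derive (q : C) : Cmod q < 1 -> is_C_derive al1 q (al2 q).
Proof.
  intros Hq. apply C_derive_scal. apply CPS_derive; [|exact Hq].
  apply unit_radius_derive, lambert_chi_radius.
Qed.

Lemma al2_derive (q : C) : Cmod q < 1 -> exists l, is_C_derive al2 q l.
Proof.
  intros Hq. eexists. apply C_derive_scal. apply CPS_derive; [|exact Hq].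
  do 2 apply unit_radius_derive. apply lambert_chi_radius.
Qed.

Lemma al_0 : al 0 = 1.
Proof. unfold al. rewrite CPS_0. unfold lambert_coeff. simpl. ring. Qed.

Lemma chi_1 : chi 1 = 1.
Proof. unfold chi. simpl. field. apply Ci_nz. Qed.

Lemma al1_0 : al1 0 = 4.
Proof.
  unfold al1. rewrite CPS_0. unfold coeff_derive, lambert_coeff. simpl. rewrite chi_1. ring.
Qed.

(* Otherwise unification unfolds these down to real limits and does not terminate. *)
Opaque al al1 al2.

Lemma Cmod_0_lt_1 : Cmod 0 < 1.
Proof. rewrite Cmod_0. lra. Qed.

Lemma squaring_invariant_near_0 (P : C -> Prop) :
  (forall q, Cmod q < 1 -> P q -> P (q ^ 2)) ->
  forall q, Cmod q < 1 -> P q ->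
  forall d, 0 < d -> exists q', Cmod q' < d /\ Cmod q' < 1 /\ P q'.
Proof.
  intros HP q Hq Pq d Hd. pose proof (Cmod_ge_0 q) as H0.
  (* The exponent 2^n of the n-th square is weakened to n + 1, which is enough for convergence to 0
     and simpler to carry. *)
  assert (H : forall n, exists q', Cmod q' <= Cmod q ^ S n /\ P q').
  { induction n as [|n [q' [H1 H2]]].
    - exists q. split; [simpl; lra|exact Pq].
    - exists (q' ^ 2). pose proof (Cmod_ge_0 q').
      assert (E0 : Cmod q ^ S n <= Cmod q).
      { simpl. rewrite <- (Rmult_1_r (Cmod q)) at 3. apply Rmult_le_compat_l; [lra|].
        rewrite <- (pow1 n). apply pow_incr. lra. }
      split; [|apply HP; [lra|exact H2]].
      rewrite Cmod_pow. change (Cmod q ^ S (S n))%R with (Cmod q * Cmod q ^ S n)%R. simpl pow at 1.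
      rewrite Rmult_1_r. apply Rmult_le_compat; lra. }
  assert (Hl : is_lim_seq (fun n => (Cmod q ^ n)%R) 0%R).
  { apply is_lim_seq_geom. rewrite Rabs_pos_eq; lra. }
  apply is_lim_seq_spec in Hl. destruct (Hl (mkposreal (Rmin d 1) ltac:(apply Rmin_glb_lt; lra))) as [N HN].
  specialize (HN (S N) ltac:(lia)). simpl pos in HN. rewrite Rminus_0_r in HN.
  destruct (H N) as [q' [H1 H2]]. exists q'.
  pose proof (Rle_abs (Cmod q ^ S N)). pose proof (Rmin_l d 1). pose proof (Rmin_r d 1).
  repeat split; auto; lra.
Qed.

Lemma Cmult_integral (x y : C) : x * y = 0 -> x = 0 \/ y = 0.
Proof.
  intros H. destruct (Ceq_dec x 0) as [|Hx]; auto. destruct (Ceq_dec y 0) as [|Hy]; auto.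
  exfalso. exact (Cmult_neq_0 x y Hx Hy H).
Qed.

(** A zero of [be] at q is one at q^2 as well, by be (q^2)^2 = al q * be q. Zeros would then
    accumulate at 0, where [be] is close to 1. *)
Lemma be_nz (q : C) : Cmod q < 1 -> be q <> 0.
Proof.
  intros Hq E.
  destruct (C_derive_cont al 0 _ (al_derive 0 Cmod_0_lt_1) 1 ltac:(lra)) as [d [Hd Hc]].
  destruct (squaring_invariant_near_0 (fun q => be q = 0)) with (q := q) (d := d) as [x [H1 [H2 H3]]]; auto.
  - intros x Hx Ex. pose proof (be_sqr_arg x Hx) as F. rewrite Ex, Cmult_0_r in F.
    destruct (Cmult_integral _ _ F); assumption.
  - specialize (Hc (- x)). unfold be in H3. rewrite H3, al_0 in Hc.
    replace (- x - 0) with (- x) in Hc by ring. rewrite Cmod_opp in Hc. specialize (Hc H1).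
    replace (0 - 1) with (- (1)) in Hc by ring. rewrite Cmod_opp, Cmod_1 in Hc. lra.
Qed.

Lemma al_nz (q : C) : Cmod q < 1 -> al q <> 0.
Proof.
  intros Hq. replace q with (- - q) by ring. apply (be_nz (- q)). now rewrite Cmod_opp.
Qed.

Lemma al_plus_be_nz (q : C) : Cmod q < 1 -> al q + be q <> 0.
Proof.
  intros Hq E. pose proof (al_sqr_arg q Hq) as F. rewrite E in F.
  apply (al_nz (q ^ 2) (Cmod_pow_lt_1 q 1 Hq)). rewrite F. unfold Cdiv. ring.
Qed.

Lemma opp_derive (z : C) : is_C_derive (fun x => - x) z (- (1)).
Proof.
  eapply C_derive_eq; [apply (C_derive_ext (fun x => - (1) * x)); [intros; ring|]|].
  - apply C_derive_scal, C_derive_id.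
  - ring.
Qed.

Lemma be_derive (q : C) : Cmod q < 1 -> is_C_derive be q (- al1 (- q)).
Proof.
  intros Hq. eapply C_derive_eq.
  - apply (C_derive_comp al (fun x => - x) q (al1 (- q)) (- (1))).
    + apply al_derive. now rewrite Cmod_opp.
    + apply opp_derive.
  - ring.
Qed.

Lemma sqr_derive (z : C) : is_C_derive (fun x => x ^ 2) z (2 * z).
Proof.
  eapply C_derive_eq; [apply C_derive_pow|]. simpl.
  replace (1 + 1)%R with 2%R by ring. ring.
Qed.

Lemma disc_ext (f h : C -> C) (q l : C) :
  Cmod q < 1 -> (forall x, Cmod x < 1 -> f x = h x) -> is_C_derive f q l -> is_C_derive h q l.
Proof.
  intros Hq He. apply C_derive_ext_loc. exists (1 - Cmod q)%R. split; [lra|].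
  intros w Hw. apply He. pose proof (Cmod_triangle_rev w q). lra.
Qed.

(* The logarithmic derivatives q al' / al and q be' / be. *)
Definition dal (q : C) : C := q * al1 q / al q.
Definition dbe (q : C) : C := dal (- q).

Lemma al1_dal (q : C) : Cmod q < 1 -> q * al1 q = dal q * al q.
Proof. intros Hq. unfold dal. field. now apply al_nz. Qed.

Lemma al1_dbe (q : C) : Cmod q < 1 -> - q * al1 (- q) = dbe q * be q.
Proof. intros Hq. unfold dbe, be. apply al1_dal. now rewrite Cmod_opp. Qed.

(** The derivative of [al_sqr_arg], expressed by logarithmic derivatives. *)
Lemma dal_sqr_arg (q : C) : Cmod q < 1 -> 2 * dal (q ^ 2) * (al q + be q) = dal q * al q + dbe q * be q.
Proof.
  intros Hq. assert (H2 := Cmod_pow_lt_1 q 1 Hq).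
  assert (E : al1 (q ^ 2) * (2 * q) = / 2 * (al1 q + - al1 (- q))).
  { apply C_derive_unique with (f := fun x => al (x ^ 2)) (z := q).
    - apply (C_derive_comp al (fun x => x ^ 2)); [now apply al_derive|apply sqr_derive].
    - apply disc_ext with (f := fun x => / 2 * (al x + be x)); [exact Hq| |].
      + intros x Hx. rewrite al_sqr_arg by exact Hx. field.
      + apply C_derive_scal, C_derive_plus; [now apply al_derive|now apply be_derive]. }
  rewrite <- (al1_dal q Hq), <- (al1_dbe q Hq).
  replace (q * al1 q + - q * al1 (- q)) with (2 * q * (/ 2 * (al1 q + - al1 (- q)))) by field.
  rewrite <- E. replace (2 * q * (al1 (q ^ 2) * (2 * q))) with (4 * (q ^ 2 * al1 (q ^ 2))) by ring.
  rewrite al1_dal, al_sqr_arg by auto. field.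
Qed.

Lemma dbe_sqr_arg (q : C) : Cmod q < 1 -> 4 * dbe (q ^ 2) = dal q + dbe q.
Proof.
  intros Hq. assert (H2 := Cmod_pow_lt_1 q 1 Hq).
  assert (E : - al1 (- q ^ 2) * (2 * q) * be (q ^ 2) + be (q ^ 2) * (- al1 (- q ^ 2) * (2 * q)) =
              al1 q * be q + al q * - al1 (- q)).
  { assert (D : is_C_derive (fun x => be (x ^ 2)) q (- al1 (- q ^ 2) * (2 * q))).
    { apply (C_derive_comp be (fun x => x ^ 2)); [now apply be_derive|apply sqr_derive]. }
    apply C_derive_unique with (f := fun x => be (x ^ 2) * be (x ^ 2)) (z := q).
    - exact (C_derive_mult _ _ q _ _ D D).
    - apply disc_ext with (f := fun x => al x * be x); [exact Hq| |].
      + intros x Hx. symmetry. now apply be_sqr_arg.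
      + apply C_derive_mult; [now apply al_derive|now apply be_derive]. }
  assert (NA := al_nz q Hq). assert (NB := be_nz q Hq).
  assert (F : 4 * dbe (q ^ 2) * (al q * be q) = (dal q + dbe q) * (al q * be q)).
  { rewrite <- (be_sqr_arg q Hq).
    replace (4 * dbe (q ^ 2) * (be (q ^ 2) * be (q ^ 2))) with
      (4 * be (q ^ 2) * (dbe (q ^ 2) * be (q ^ 2))) by ring.
    rewrite <- (al1_dbe _ H2), be_sqr_arg by exact Hq.
    replace (4 * be (q ^ 2) * (- q ^ 2 * al1 (- q ^ 2))) with
      (q * (- al1 (- q ^ 2) * (2 * q) * be (q ^ 2) + be (q ^ 2) * (- al1 (- q ^ 2) * (2 * q)))) by ring.
    rewrite E.
    replace (q * (al1 q * be q + al q * - al1 (- q))) with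
      (q * al1 q * be q + al q * (- q * al1 (- q))) by ring.
    rewrite al1_dal, al1_dbe by exact Hq. ring. }
  replace (4 * dbe (q ^ 2)) with (4 * dbe (q ^ 2) * (al q * be q) / (al q * be q)) by (field; auto).
  rewrite F. field. auto.
Qed.

Definition dal1 (q : C) : C :=
  ((1 * al1 q + q * al2 q) * al q - q * al1 q * al1 q) / (al q * al q).

Lemma dal_derive (q : C) : Cmod q < 1 -> is_C_derive dal q (dal1 q).
Proof.
  intros Hq. apply (C_derive_div (fun x => x * al1 x) al q); [|now apply al_derive|now apply al_nz].
  apply (C_derive_mult (fun x => x) al1 q); [apply C_derive_id|now apply al1_derive].
Qed.

Lemma dbe_derive (q : C) : Cmod q < 1 -> is_C_derive dbe q (- dal1 (- q)).
Proof.
  intros Hq. eapply C_derive_eq.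
  - apply (C_derive_comp dal (fun x => - x) q (dal1 (- q)) (- (1))).
    + apply dal_derive. now rewrite Cmod_opp.
    + apply opp_derive.
  - ring.
Qed.

Lemma dal1_0 : dal1 0 = 4.
Proof. unfold dal1. rewrite al_0, al1_0. field. Qed.

Lemma dal_0 : dal 0 = 0.
Proof. unfold dal, Cdiv. ring. Qed.

Lemma small_of_derive (f : C -> C) (l : C) :
  is_C_derive f 0 l -> f 0 = 0 -> forall eps, 0 < eps ->
  exists d, 0 < d /\ forall q, Cmod q < d -> Cmod (f q - l * q) <= eps * Cmod q.
Proof.
  intros H H0 eps Hp. destruct (proj1 (is_C_derive_eps _ _ _) H eps Hp) as [d [Hd Hw]].
  exists d. split; [exact Hd|]. intros q Hq. specialize (Hw q).
  rewrite H0 in Hw. replace (q - 0) with q in Hw by ring.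
  replace (f q - 0 - l * q) with (f q - l * q) in Hw by ring. auto.
Qed.

(** Equal arguments of the arithmetic-geometric mean stay equal, so a coincidence would recur
    arbitrarily near 0. There al - be behaves like 8 q. *)
Lemma al_minus_be_nz (q : C) : Cmod q < 1 -> q <> 0 -> al q <> be q.
Proof.
  intros Hq Hq0 E.
  destruct (small_of_derive (fun x => al x - be x) 8) with (eps := 4%R) as [d [Hd Hs]].
  - eapply C_derive_eq.
    + apply C_derive_minus; [apply al_derive|apply be_derive]; apply Cmod_0_lt_1.
    + replace (- 0) with (RtoC 0) by ring. rewrite al1_0. ring.
  - unfold be. replace (- 0) with (RtoC 0) by ring. ring.
  - lra.
  - destruct (squaring_invariant_near_0 (fun q => q <> 0 /\ al q = be q)) with (q := q) (d := d)
      as [x [H1 [H2 [H3 H4]]]]; auto.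
    + intros x Hx [Nx Ex]. split; [now apply Cpow_nz|].
      pose proof (al_sqr_arg x Hx) as A. pose proof (be_sqr_arg x Hx) as B.
      rewrite <- Ex in A, B. replace ((al x + al x) / 2) with (al x) in A by field.
      assert (F : (al (x ^ 2) - be (x ^ 2)) * (al (x ^ 2) + be (x ^ 2)) = 0).
      { replace ((al (x ^ 2) - be (x ^ 2)) * (al (x ^ 2) + be (x ^ 2))) with
          (al (x ^ 2) * al (x ^ 2) - be (x ^ 2) * be (x ^ 2)) by ring. rewrite B, A. ring. }
      destruct (Cmult_integral _ _ F) as [G|G].
      * now apply Ceq_minus.
      * exfalso. exact (al_plus_be_nz _ (Cmod_pow_lt_1 x 1 Hx) G).
    + specialize (Hs x H1). cbv beta in Hs. rewrite H4 in Hs.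
      replace (be x - be x - 8 * x) with (- (8 * x)) in Hs by ring.
      rewrite Cmod_opp, Cmod_mult, Cmod_R, Rabs_pos_eq in Hs by lra.
      apply Cmod_gt_0 in H3. lra.
Qed.

(* Both sides change by the same factor (al - be) / (4 (al + be)) under q -> q^2,
   so their quotient is invariant, hence equal to its limit at q = 0. *)
Theorem dal_minus_dbe (q : C) : Cmod q < 1 -> dal q - dbe q = (al q * al q - be q * be q) / 2.
Proof.
  intros Hq. destruct (Ceq_dec q 0) as [->|Hq0].
  { unfold dbe, be. replace (- 0) with (RtoC 0) by ring. rewrite dal_0. field. }
  set (G := fun x => al x * al x - be x * be x).
  assert (HG : forall x, Cmod x < 1 -> x <> 0 -> G x <> 0).
  { intros x Hx Nx. unfold G.
    replace (al x * al x - be x * be x) with ((al x - be x) * (al x + be x)) by ring.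
    apply Cmult_neq_0; [|now apply al_plus_be_nz].
    apply Cminus_eq_contra. now apply al_minus_be_nz. }
  set (H := fun x => (dal x - dbe x) / G x).
  assert (HH : forall x, Cmod x < 1 -> x <> 0 -> H (x ^ 2) = H x).
  { intros x Hx Nx. assert (H2 := Cmod_pow_lt_1 x 1 Hx). assert (Nx2 := Cpow_nz x 2 Nx).
    pose proof (al_plus_be_nz x Hx) as N1.
    assert (N2 : al x - be x <> 0) by (apply Cminus_eq_contra; now apply al_minus_be_nz).
    assert (E1 : dal (x ^ 2) - dbe (x ^ 2) = (dal x - dbe x) * (al x - be x) / (4 * (al x + be x))).
    { replace (dal (x ^ 2)) with (2 * dal (x ^ 2) * (al x + be x) / (2 * (al x + be x))) by (field; auto).
      replace (dbe (x ^ 2)) with (4 * dbe (x ^ 2) / 4) by field.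
      rewrite dal_sqr_arg, dbe_sqr_arg by exact Hx. field. auto. }
    assert (E2 : G (x ^ 2) = (al x - be x) * (al x - be x) / 4).
    { unfold G. rewrite be_sqr_arg, al_sqr_arg by exact Hx. field. }
    unfold H. rewrite E1, E2. unfold G.
    replace (al x * al x - be x * be x) with ((al x - be x) * (al x + be x)) by ring.
    field. auto. }
  assert (DG : is_C_derive G 0 16).
  { eapply C_derive_eq.
    - pose proof (al_derive 0 Cmod_0_lt_1) as DA. pose proof (be_derive 0 Cmod_0_lt_1) as DB.
      exact (C_derive_minus _ _ _ _ _ (C_derive_mult _ _ _ _ _ DA DA) (C_derive_mult _ _ _ _ _ DB DB)).
    - unfold be. replace (- 0) with (RtoC 0) by ring. rewrite al_0, al1_0. ring. }
  assert (G0 : G 0 = 0).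
  { unfold G, be. replace (- 0) with (RtoC 0) by ring. ring. }
  (* Near 0 the difference dal - dbe behaves like 8 q and [G] like 16 q, hence the value 1/2 of the
     invariant quotient. *)
  assert (DF : is_C_derive (fun x => 2 * (dal x - dbe x) - G x) 0 0).
  { eapply C_derive_eq.
    - apply C_derive_minus; [|exact DG]. apply C_derive_scal, C_derive_minus;
        [apply dal_derive|apply dbe_derive]; apply Cmod_0_lt_1.
    - replace (- 0) with (RtoC 0) by ring. rewrite dal1_0. ring. }
  assert (F0 : 2 * (dal 0 - dbe 0) - G 0 = 0).
  { rewrite G0. unfold dbe. replace (- 0) with (RtoC 0) by ring. ring. }
  assert (Hlim : H q = / 2).
  { destruct (Ceq_dec (H q) (/ 2)) as [|Hne]; [assumption|exfalso].
    assert (Pe : 0 < Cmod (H q - / 2)) by (apply Cmod_gt_0; now apply Cminus_eq_contra).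
    set (e := Cmod (H q - / 2)) in *.
    destruct (small_of_derive G 16 DG G0 8%R ltac:(lra)) as [d1 [D1 K1]].
    destruct (small_of_derive _ 0 DF F0 e Pe) as [d2 [D2 K2]].
    destruct (squaring_invariant_near_0 (fun x => x <> 0 /\ H x = H q)) with (q := q) (d := Rmin d1 d2)
      as [x [H1 [H2 [H3 H4]]]]; auto.
    - intros x Hx [Nx Ex]. split; [now apply Cpow_nz|]. rewrite HH; auto.
    - now apply Rmin_glb_lt.
    - specialize (K1 x (Rlt_le_trans _ _ _ H1 (Rmin_l _ _))).
      specialize (K2 x (Rlt_le_trans _ _ _ H1 (Rmin_r _ _))).
      assert (Px : 0 < Cmod x) by now apply Cmod_gt_0.
      assert (LG : 8 * Cmod x <= Cmod (G x)).
      { pose proof (Cmod_triangle_rev (16 * x) (16 * x - G x)) as Tr.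
        replace (16 * x - (16 * x - G x)) with (G x) in Tr by ring.
        rewrite (Cmod_minus_sym (16 * x)), Cmod_mult, Cmod_R, Rabs_pos_eq in Tr by lra. lra. }
      assert (Q : H x - / 2 = (2 * (dal x - dbe x) - G x) / (2 * G x)).
      { unfold H. field. now apply HG. }
      assert (NG : 2 * G x <> 0) by (apply Cmult_neq_0; [apply C2_nz|now apply HG]).
      assert (Qm : (Cmod (H x - / 2) * Cmod (2 * G x))%R = Cmod (2 * (dal x - dbe x) - G x)).
      { rewrite <- Cmod_mult, Q. f_equal. field. now apply HG. }
      rewrite H4 in Qm. fold e in Qm. rewrite Cmod_mult, Cmod_R, Rabs_pos_eq in Qm by lra.
      replace (2 * (dal x - dbe x) - G x - 0 * x) with (2 * (dal x - dbe x) - G x) in K2 by ring.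
      rewrite <- Qm in K2.
      assert (e * (2 * (8 * Cmod x)) <= e * (2 * Cmod (G x))) by (apply Rmult_le_compat_l; lra).
      nra. }
  replace (dal q - dbe q) with (H q * G q) by (unfold H; field; now apply HG).
  rewrite Hlim. unfold G. field.
Qed.

Lemma dal_sqr_arg' (q : C) : Cmod q < 1 -> 2 * dal (q ^ 2) = dal q - be q * (al q - be q) / 2.
Proof.
  intros Hq. pose proof (al_plus_be_nz q Hq) as N.
  replace (2 * dal (q ^ 2)) with (2 * dal (q ^ 2) * (al q + be q) / (al q + be q)) by (field; auto).
  rewrite dal_sqr_arg by exact Hq.
  replace (dbe q) with (dal q - (dal q - dbe q)) by ring. rewrite dal_minus_dbe by exact Hq. field. auto.
Qed.

Lemma dal1_sqr_arg (q : C) : Cmod q < 1 ->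
  4 * (q ^ 2 * dal1 (q ^ 2)) =
  q * dal1 q - (dbe q * be q * (al q - be q) + be q * (dal q * al q - dbe q * be q)) / 2.
Proof.
  intros Hq. assert (H2 := Cmod_pow_lt_1 q 1 Hq).
  assert (E : 2 * (dal1 (q ^ 2) * (2 * q)) =
     dal1 q - / 2 * (- al1 (- q) * (al q - be q) + be q * (al1 q - - al1 (- q)))).
  { apply C_derive_unique with (f := fun x => 2 * dal (x ^ 2)) (z := q).
    - apply C_derive_scal. apply (C_derive_comp dal (fun x => x ^ 2)); [now apply dal_derive|apply sqr_derive].
    - apply disc_ext with (f := fun x => dal x - / 2 * (be x * (al x - be x))); [exact Hq| |].
      + intros x Hx. rewrite dal_sqr_arg' by exact Hx. field.
      + exact (C_derive_minus _ _ _ _ _ (dal_derive q Hq) (C_derive_scal (/ 2) _ _ _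
          (C_derive_mult _ _ _ _ _ (be_derive q Hq)
            (C_derive_minus _ _ _ _ _ (al_derive q Hq) (be_derive q Hq))))). }
  rewrite <- (al1_dal q Hq), <- (al1_dbe q Hq).
  replace (4 * (q ^ 2 * dal1 (q ^ 2))) with (q * (2 * (dal1 (q ^ 2) * (2 * q)))) by ring.
  rewrite E. field.
Qed.

(** Its vanishing is the Riccati equation for the logarithmic derivative of [al]. *)
Definition defect (q : C) : C :=
  q * dal1 q - dal q * dal q - be q * be q * (al q * al q - be q * be q) / 4.

(** Once [dbe] is eliminated by [dal_minus_dbe], both sides are polynomials in al, be, dal and q *
    dal1 at q, and they agree formally. *)
Lemma defect_sqr_arg (q : C) : Cmod q < 1 -> 4 * defect (q ^ 2) = defect q.
Proof.
  intros Hq. unfold defect.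
  replace (4 * (q ^ 2 * dal1 (q ^ 2) - dal (q ^ 2) * dal (q ^ 2)
     - be (q ^ 2) * be (q ^ 2) * (al (q ^ 2) * al (q ^ 2) - be (q ^ 2) * be (q ^ 2)) / 4)) with
   (4 * (q ^ 2 * dal1 (q ^ 2)) - (2 * dal (q ^ 2)) * (2 * dal (q ^ 2))
     - be (q ^ 2) * be (q ^ 2) * (al (q ^ 2) * al (q ^ 2) - be (q ^ 2) * be (q ^ 2))) by field.
  rewrite dal1_sqr_arg, dal_sqr_arg', be_sqr_arg, al_sqr_arg by exact Hq.
  replace (dbe q) with (dal q - (dal q - dbe q)) by ring. rewrite dal_minus_dbe by exact Hq. field.
Qed.

Lemma defect_derive_0 : exists l, is_C_derive defect 0 l.
Proof.
  destruct (al2_derive 0 Cmod_0_lt_1) as [l2 H2].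
  pose proof (al_derive 0 Cmod_0_lt_1) as Ha. pose proof (al1_derive 0 Cmod_0_lt_1) as Ha1.
  pose proof (be_derive 0 Cmod_0_lt_1) as Hb. pose proof (dal_derive 0 Cmod_0_lt_1) as Haa.
  assert (N := al_nz 0 Cmod_0_lt_1).
  assert (A1 : exists l, is_C_derive dal1 0 l).
  { eexists. exact (C_derive_div _ _ _ _ _
      (C_derive_minus _ _ _ _ _
        (C_derive_mult _ _ _ _ _
          (C_derive_plus _ _ _ _ _ (C_derive_scal 1 _ _ _ Ha1) (C_derive_mult _ _ _ _ _ (C_derive_id 0) H2)) Ha)
        (C_derive_mult _ _ _ _ _ (C_derive_mult _ _ _ _ _ (C_derive_id 0) Ha1) Ha1))
      (C_derive_mult _ _ _ _ _ Ha Ha) (Cmult_neq_0 _ _ N N)). }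
  destruct A1 as [l1 A1].
  assert (N4 : RtoC 4 <> 0) by (intros F; apply RtoC_inj in F; lra).
  eexists. exact (C_derive_minus _ _ _ _ _
    (C_derive_minus _ _ _ _ _ (C_derive_mult _ _ _ _ _ (C_derive_id 0) A1) (C_derive_mult _ _ _ _ _ Haa Haa))
    (C_derive_div _ _ _ _ _
      (C_derive_mult _ _ _ _ _ (C_derive_mult _ _ _ _ _ Hb Hb)
        (C_derive_minus _ _ _ _ _ (C_derive_mult _ _ _ _ _ Ha Ha) (C_derive_mult _ _ _ _ _ Hb Hb)))
      (C_derive_const 4 0) N4)).
Qed.

(* By [defect_sqr_arg] the quotient defect q / q grows under q -> q^2 for small q,
   but it is bounded near 0. *)
Theorem defect_zero (q : C) : Cmod q < 1 -> defect q = 0.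
Proof.
  intros Hq. apply NNPP. intros Hne.
  destruct defect_derive_0 as [l Hl].
  assert (E0 : defect 0 = 0).
  { unfold defect, be. replace (- 0) with (RtoC 0) by ring. rewrite dal_0. field. }
  destruct (small_of_derive defect l Hl E0 1%R ltac:(lra)) as [d [Hd Hs]].
  destruct (squaring_invariant_near_0 (fun x => defect x <> 0)) with (q := q) (d := Rmin d (/ 8))
    as [x [H1 [H2 H3]]]; auto.
  { intros x Hx Ex F. apply Ex. rewrite <- defect_sqr_arg, F by exact Hx. ring. }
  { apply Rmin_glb_lt; lra. }
  assert (Nx : x <> 0) by (intros ->; auto).
  assert (Px : 0 < Cmod x) by now apply Cmod_gt_0.
  assert (PE : 0 < Cmod (defect x)) by now apply Cmod_gt_0.
  assert (X1 := Rlt_le_trans _ _ _ H1 (Rmin_l _ _)). assert (X2 := Rlt_le_trans _ _ _ H1 (Rmin_r _ _)).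
  set (m := (Cmod (defect x) / Cmod x)%R).
  assert (Pm : 0 < m) by now apply Rdiv_lt_0_compat.
  (* For |y| <= 1/8, squaring divides |defect| by 4 but |y| by at least 8, so the quotient at least
     doubles. *)
  assert (K : forall n, exists y, Cmod y <= Cmod x /\ 0 < Cmod y /\ 2 ^ n * m * Cmod y <= Cmod (defect y)).
  { induction n as [|n [y [Y1 [Y2 Y3]]]].
    - exists x. repeat split; [lra|exact Px|]. unfold m. right. simpl. field. lra.
    - exists (y ^ 2). rewrite Cmod_pow.
      pose proof (defect_sqr_arg y ltac:(lra)) as Ey. apply (f_equal Cmod) in Ey.
      rewrite Cmod_mult, Cmod_R, Rabs_pos_eq in Ey by lra.
      assert (P2 : 0 < 2 ^ n) by (apply pow_lt; lra).
      assert (P3 : 0 < 2 ^ n * m) by now apply Rmult_lt_0_compat.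
      simpl pow. rewrite Rmult_1_r. repeat split; [nra|nra|].
      assert (2 ^ n * m * Cmod y * (8 * Cmod y) <= 2 ^ n * m * Cmod y * 1).
      { apply Rmult_le_compat_l; [nra|lra]. }
      nra. }
  destruct (Pow_x_infinity 2 ltac:(rewrite Rabs_pos_eq; lra) ((Cmod l + 2) / m)%R) as [N HN].
  specialize (HN N (le_n _)). rewrite Rabs_pos_eq in HN by (apply pow_le; lra).
  destruct (K N) as [y [Y1 [Y2 Y3]]]. specialize (Hs y ltac:(lra)).
  pose proof (Cmod_triangle (defect y - l * y) (l * y)) as Tr.
  replace (defect y - l * y + l * y) with (defect y) in Tr by ring. rewrite Cmod_mult in Tr.
  assert (A : (Cmod l + 2) * Cmod y <= 2 ^ N * m * Cmod y).
  { apply Rmult_le_compat_r; [lra|]. apply Rge_le in HN.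
    apply Rmult_le_compat_r with (r := m) in HN; [|lra].
    replace ((Cmod l + 2) / m * m)%R with (Cmod l + 2)%R in HN by (field; lra). exact HN. }
  nra.
Qed.

Lemma dal1_eq (q : C) : Cmod q < 1 ->
  q * dal1 q = dal q * dal q + be q * be q * (al q * al q - be q * be q) / 4.
Proof.
  intros Hq. pose proof (defect_zero q Hq) as H. unfold defect in H.
  apply Ceq_minus. rewrite <- H. ring.
Qed.

(** * The ratio of the two means *)

(** Classically theta_4 / theta_3, the square root of the complementary modulus. By [be_sqr_arg], be
    (q^2) is a single-valued root of al be, so no branch has to be chosen. *)
Definition ratio (q : C) : C := be (q ^ 2) / al q.
Definition ratio1 (q : C) : C :=
  (- al1 (- q ^ 2) * (2 * q) * al q - be (q ^ 2) * al1 q) / (al q * al q).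

Lemma ratio_sqr (q : C) : Cmod q < 1 -> ratio q * ratio q = be q / al q.
Proof.
  intros Hq. assert (N := al_nz q Hq). unfold ratio.
  replace (be (q ^ 2) / al q * (be (q ^ 2) / al q)) with
    (be (q ^ 2) * be (q ^ 2) / (al q * al q)) by (field; auto).
  rewrite be_sqr_arg by exact Hq. field. auto.
Qed.

Lemma ratio_nz (q : C) : Cmod q < 1 -> ratio q <> 0.
Proof.
  intros Hq E. pose proof (ratio_sqr q Hq) as H. rewrite E, Cmult_0_l in H.
  apply (be_nz q Hq). replace (be q) with (be q / al q * al q) by (field; now apply al_nz).
  rewrite <- H. ring.
Qed.

Lemma ratio_opp (q : C) : Cmod q < 1 -> ratio (- q) * ratio q = 1.
Proof.
  intros Hq. assert (N := al_nz q Hq). assert (N' := be_nz q Hq). unfold ratio.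
  replace ((- q) ^ 2) with (q ^ 2) by ring. change (al (- q)) with (be q).
  replace (be (q ^ 2) / be q * (be (q ^ 2) / al q)) with
    (be (q ^ 2) * be (q ^ 2) / (al q * be q)) by (field; auto).
  rewrite be_sqr_arg by exact Hq. field. auto.
Qed.

(** One step of the mean read on quotients, that is Landen's transformation. *)
Lemma ratio_sqr_arg (q : C) : Cmod q < 1 ->
  ratio (q ^ 2) * ratio (q ^ 2) * (1 + ratio q * ratio q) = 2 * ratio q.
Proof.
  intros Hq. assert (N := al_nz q Hq). assert (N' := al_plus_be_nz q Hq).
  assert (H2 := Cmod_pow_lt_1 q 1 Hq).
  rewrite (ratio_sqr q Hq), (ratio_sqr _ H2), al_sqr_arg by exact Hq. unfold ratio. field. auto.
Qed.

Lemma ratio_derive (q : C) : Cmod q < 1 -> is_C_derive ratio q (ratio1 q).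
Proof.
  intros Hq. apply (C_derive_div (fun x => be (x ^ 2)) al q); [|now apply al_derive|now apply al_nz].
  apply (C_derive_comp be (fun x => x ^ 2)); [|apply sqr_derive].
  apply be_derive. exact (Cmod_pow_lt_1 q 1 Hq).
Qed.

(** The logarithmic derivative is 2 dbe (q^2) - dal q, which [dbe_sqr_arg] reduces to (dbe q - dal
    q) / 2; then [dal_minus_dbe] applies. *)
Theorem ratio1_eq (q : C) : Cmod q < 1 ->
  q * ratio1 q = - (ratio q * (al q * al q) * (1 - ratio q ^ 4)) / 4.
Proof.
  intros Hq. assert (N := al_nz q Hq). assert (H2 := Cmod_pow_lt_1 q 1 Hq).
  replace (ratio q ^ 4) with (ratio q * ratio q * (ratio q * ratio q)) by ring. rewrite ratio_sqr by exact Hq.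
  transitivity (ratio q * (2 * dbe (q ^ 2) - dal q)).
  - unfold ratio1, ratio.
    replace (q * ((- al1 (- q ^ 2) * (2 * q) * al q - be (q ^ 2) * al1 q) / (al q * al q))) with
      ((2 * (- q ^ 2 * al1 (- q ^ 2)) * al q - be (q ^ 2) * (q * al1 q)) / (al q * al q)) by (field; auto).
    rewrite (al1_dal q Hq), (al1_dbe _ H2). field. auto.
  - replace (2 * dbe (q ^ 2) - dal q) with (4 * dbe (q ^ 2) / 2 - dal q) by field.
    rewrite dbe_sqr_arg by exact Hq.
    replace ((dal q + dbe q) / 2 - dal q) with (- (dal q - dbe q) / 2) by field.
    rewrite dal_minus_dbe by exact Hq. field. auto.
Qed.

Lemma ratio_0 : ratio 0 = 1.
Proof.
  unfold ratio, be. replace (- 0 ^ 2) with (RtoC 0) by ring. rewrite al_0. field.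
Qed.

Lemma ratio1_0 : ratio1 0 = - (4).
Proof.
  unfold ratio1, be. replace (- 0 ^ 2) with (RtoC 0) by ring. rewrite al_0, al1_0. field.
Qed.

Lemma ratio1_holomorphic (q : C) : Cmod q < 1 -> exists l, is_C_derive ratio1 q l.
Proof.
  intros Hq. assert (H2 := Cmod_pow_lt_1 q 1 Hq). assert (N := al_nz q Hq).
  assert (Hm : Cmod (- q ^ 2) < 1) by now rewrite Cmod_opp.
  assert (Ha := al_derive q Hq). assert (Ha1 := al1_derive q Hq).
  assert (Hb1 := C_derive_comp (fun x => - x) (fun x => al1 (- x)) _ _ _ (opp_derive _)
    (C_derive_comp al1 (fun x => - x) _ _ _ (al1_derive _ Hm) (opp_derive (q ^ 2)))).
  assert (Hb1' := C_derive_comp (fun x => - al1 (- x)) (fun x => x ^ 2) q _ _ Hb1 (sqr_derive q)).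
  assert (Hb' := C_derive_comp be (fun x => x ^ 2) q _ _ (be_derive _ H2) (sqr_derive q)).
  eexists. exact (C_derive_div _ _ _ _ _
    (C_derive_minus _ _ _ _ _
      (C_derive_mult _ _ _ _ _
        (C_derive_mult _ _ _ _ _ Hb1' (C_derive_scal 2 _ _ _ (C_derive_id q))) Ha)
      (C_derive_mult _ _ _ _ _ Hb' Ha1))
    (C_derive_mult _ _ _ _ _ Ha Ha) (Cmult_neq_0 _ _ N N)).
Qed.

(** * The image of the ratio *)

Lemma Cmod_sqr (z : C) : (Cmod z * Cmod z = Re z * Re z + Im z * Im z)%R.
Proof. pose proof (Cmod2_alt z) as H. simpl in H. lra. Qed.

(** Half-angle formulas, with the sign of the imaginary part copied from z. The condition on [Re s]
    selects the root for which the Cayley estimate holds. *)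
Lemma C_sqrt_exists (z : C) : exists s : C, s * s = z /\ 0 <= Re s.
Proof.
  destruct z as [p r].
  pose proof (re_le_Cmod (p, r)) as H1. pose proof (Cmod_sqr (p, r)) as H2.
  set (m := Cmod (p, r)) in *. assert (Hm : 0 <= m) by apply Cmod_ge_0.
  simpl in H1, H2. pose proof (Rle_abs p). pose proof (Rle_abs (- p)). rewrite Rabs_Ropp in H0.
  set (x := sqrt ((m + p) / 2)). set (t := sqrt ((m - p) / 2)).
  assert (Ex : (x * x = (m + p) / 2)%R) by (apply sqrt_sqrt; lra).
  assert (Et : (t * t = (m - p) / 2)%R) by (apply sqrt_sqrt; lra).
  assert (Hx : 0 <= x) by apply sqrt_pos. assert (Ht : 0 <= t) by apply sqrt_pos.
  assert (Ext : (2 * (x * t) = Rabs r)%R).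
  { assert (0 <= x * t) by now apply Rmult_le_pos.
    apply Rsqr_inj; [lra|apply Rabs_pos|]. rewrite <- Rsqr_abs. unfold Rsqr.
    replace (2 * (x * t) * (2 * (x * t)))%R with (4 * (x * x) * (t * t))%R by ring.
    rewrite Ex, Et. nra. }
  destruct (Rle_dec 0 r) as [Hr|Hr].
  - exists (x, t). split; [|exact Hx]. rewrite Rabs_pos_eq in Ext by exact Hr.
    unfold Cmult; simpl. f_equal; lra.
  - exists (x, (- t)%R). split; [|exact Hx]. rewrite Rabs_left in Ext by lra.
    unfold Cmult; simpl. f_equal; lra.
Qed.

Lemma Cmod_1_plus_sqr (s : C) : 0 <= Re s -> Cmod (1 + s * s) <= Cmod (1 + s) * Cmod (1 + s).
Proof.
  intros Hs. rewrite Cmod_sqr.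
  eapply Rle_trans; [apply Cmod_triangle|]. rewrite Cmod_1, Cmod_mult, Cmod_sqr.
  rewrite re_plus, im_plus, re_RtoC, im_RtoC. nra.
Qed.

(* For the Cayley transform u = (1 - z) / (1 + z) this says |u_s| <= |u_z|^2, which makes
   the iteration converge to z = 1. *)
Lemma cayley_contracts (s z : C) :
  s * s * (1 + z * z) = 2 * z -> 1 + z * z <> 0 -> 0 <= Re s ->
  Cmod (1 - s) * (Cmod (1 + z) * Cmod (1 + z)) <= Cmod (1 - z) * Cmod (1 - z) * Cmod (1 + s).
Proof.
  intros E N Hs.
  assert (P : 0 < Cmod (1 + s)).
  { pose proof (Cmod_sqr (1 + s)) as H. rewrite re_plus, im_plus, re_RtoC, im_RtoC in H.
    pose proof (Cmod_ge_0 (1 + s)). nra. }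
  apply Rmult_le_reg_r with (Cmod (1 + s)); [exact P|].
  (* From s^2 = 2 z / (1 + z^2) follow 1 - s^2 = (1 - z)^2 / (1 + z^2) and 1 + s^2 = (1 + z)^2 / (1
     + z^2). *)
  apply Rle_trans with (Cmod (1 - z) * Cmod (1 - z) * Cmod (1 + s * s))%R.
  - right.
    replace (Cmod (1 - s) * (Cmod (1 + z) * Cmod (1 + z)) * Cmod (1 + s))%R with
      (Cmod ((1 - s) * (1 + s) * ((1 + z) * (1 + z)))) by (rewrite !Cmod_mult; ring).
    rewrite <- !Cmod_mult. f_equal.
    assert (Es : s * s = 2 * z / (1 + z * z)).
    { rewrite <- E. field. exact N. }
    replace ((1 - s) * (1 + s)) with (1 - s * s) by ring. rewrite Es. field. exact N.
  - replace (Cmod (1 - z) * Cmod (1 - z) * Cmod (1 + s) * Cmod (1 + s))%R with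
      (Cmod (1 - z) * Cmod (1 - z) * (Cmod (1 + s) * Cmod (1 + s)))%R by ring.
    apply Rmult_le_compat_l; [|now apply Cmod_1_plus_sqr].
    apply Rmult_le_pos; apply Cmod_ge_0.
Qed.

Definition in_image (z : C) : Prop := exists q : C, q <> 0 /\ Cmod q < 1 /\ ratio q = z.

(* The two preimages of s under z -> 2 z / (1 + z^2) = s^2 are the values of the ratio at
   the two square roots of q. *)
Lemma in_image_pullback (s z : C) :
  s * s * (1 + z * z) = 2 * z -> in_image s -> in_image z.
Proof.
  intros E [q [Nq [Hq Eq]]].
  destruct (C_sqrt_exists q) as [p [Ep _]].
  assert (Hp : Cmod p < 1).
  { rewrite <- Ep, Cmod_mult in Hq. pose proof (Cmod_ge_0 p). nra. }
  assert (Np : p <> 0) by (intros ->; apply Nq; rewrite <- Ep; ring).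
  pose proof (ratio_sqr_arg p Hp) as F. replace (p ^ 2) with q in F by (rewrite <- Ep; ring).
  rewrite Eq in F. pose proof (ratio_nz p Hp) as NY. pose proof (ratio_opp p Hp) as O.
  assert (G : (ratio p - z) * (1 - z * ratio p) = 0).
  { assert (K : 2 * ratio p * (1 + z * z) = 2 * z * (1 + ratio p * ratio p)).
    { rewrite <- F, <- E. ring. }
    replace ((ratio p - z) * (1 - z * ratio p)) with
      ((2 * ratio p * (1 + z * z) - 2 * z * (1 + ratio p * ratio p)) / 2) by field.
    rewrite K. field. }
  destruct (Cmult_integral _ _ G) as [G'|G'].
  - exists p. repeat split; auto. now apply Ceq_minus.
  - exists (- p). repeat split.
    + intros F'. apply Np. replace p with (- - p) by ring. rewrite F'. ring.
    + now rewrite Cmod_opp.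
    + assert (K : (ratio (- p) - z) * ratio p = 0) by (rewrite <- G', <- O; ring).
      destruct (Cmult_integral _ _ K) as [K'|K']; [now apply Ceq_minus|contradiction].
Qed.

Lemma in_image_near_1 : exists eta, 0 < eta /\
  forall z : C, z <> 1 -> Cmod (z - 1) < eta -> in_image z.
Proof.
  destruct (ratio1_holomorphic 0 Cmod_0_lt_1) as [l Hl].
  destruct (inverse_function ratio ratio1 0 1) as [eta [g [He Hg]]].
  - lra.
  - intros z Hz. apply ratio_derive. replace (z - 0) with z in Hz by ring. exact Hz.
  - rewrite ratio1_0. intros F. apply (f_equal Re) in F. simpl in F. lra.
  - apply (C_derive_cont ratio1 0 l Hl).
  - exists eta. split; [exact He|]. intros z Nz Hz. rewrite ratio_0 in Hg.
    destruct (Hg z Hz) as [G1 [G2 _]]. exists (g z). repeat split; [| |exact G2].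
    + intros F. apply Nz. rewrite <- G2, F. apply ratio_0.
    + replace (g z - 0) with (g z) in G1 by ring. exact G1.
Qed.

Lemma one_plus_sqr_nz (z : C) : z <> Ci -> z <> - Ci -> 1 + z * z <> 0.
Proof.
  intros N1 N2 E. assert (F : (z - Ci) * (z + Ci) = 0).
  { replace ((z - Ci) * (z + Ci)) with (z * z - Ci * Ci) by ring. rewrite Ci_sqr, <- E. ring. }
  destruct (Cmult_integral _ _ F) as [G|G].
  - apply N1. now apply Ceq_minus.
  - apply N2. apply Ceq_minus. rewrite <- G. ring.
Qed.

Lemma root_ne_1 (s z : C) : s * s * (1 + z * z) = 2 * z -> z <> 1 -> s <> 1.
Proof.
  intros E N ->. apply N.
  assert (F : (z - 1) * (z - 1) = 0).
  { replace ((z - 1) * (z - 1)) with (1 * 1 * (1 + z * z) - 2 * z) by ring. rewrite E. ring. }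
  destruct (Cmult_integral _ _ F) as [G|G]; now apply Ceq_minus.
Qed.

Lemma root_exists (z : C) : 1 + z * z <> 0 -> exists s, s * s * (1 + z * z) = 2 * z /\ 0 <= Re s.
Proof.
  intros N. destruct (C_sqrt_exists (2 * z / (1 + z * z))) as [s [Es Hs]].
  exists s. split; [|exact Hs]. rewrite Es. field. exact N.
Qed.

Lemma in_image_half_plane (z : C) : 0 < Re z -> z <> 1 -> in_image z.
Proof.
  destruct in_image_near_1 as [eta [He Hnear]].
  (* From |1 - x| <= r |1 + x| <= r (2 + |1 - x|) and r <= 1/2 follows |1 - x| <= 4 r, which is
     below eta once r <= eta / 8. *)
  set (r0 := Rmin (/ 2) (eta / 8)). assert (Hr0 : 0 < r0) by (apply Rmin_glb_lt; lra).
  assert (H2 : r0 <= / 2) by apply Rmin_l. assert (H8 : r0 <= eta / 8) by apply Rmin_r.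
  (* The induction is on the number of mean steps still to be made: each replaces r by r^2, so
     r^(2^n) keeps its value when n drops by one. *)
  assert (K : forall n r, 0 <= r < 1 -> r ^ (2 ^ n) <= r0 -> forall z : C, 0 < Re z -> z <> 1 ->
     Cmod (1 - z) <= r * Cmod (1 + z) -> in_image z).
  { induction n as [|n IH]; intros r Hr Hrn x Hx Nx Hxr.
    - simpl in Hrn. apply Hnear; [exact Nx|]. rewrite Cmod_minus_sym.
      pose proof (Cmod_triangle_minus 2 (1 - x)) as Tr.
      replace (2 - (1 - x)) with (1 + x) in Tr by ring. rewrite Cmod_R, Rabs_pos_eq in Tr by lra.
      pose proof (Cmod_ge_0 (1 - x)). pose proof (Cmod_ge_0 (1 + x)). nra.
    - assert (N : 1 + x * x <> 0).
      { apply one_plus_sqr_nz; intros ->; simpl in Hx; lra. }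
      destruct (root_exists x N) as [s [Es Hs]].
      pose proof (cayley_contracts s x Es N Hs) as Hc.
      assert (P1 : Cmod (1 - x) * Cmod (1 - x) < Cmod (1 + x) * Cmod (1 + x)).
      { rewrite !Cmod_sqr. unfold Cminus. rewrite !re_plus, !im_plus, re_opp, im_opp, re_RtoC, im_RtoC. nra. }
      (* On the imaginary axis |1 - s| = |1 + s|, which contradicts the strict contraction. *)
      assert (Ps : 0 < Re s).
      { destruct Hs as [Hs|Hs]; [exact Hs|exfalso].
        assert (Em : Cmod (1 - s) = Cmod (1 + s)).
        { apply Rsqr_inj; try apply Cmod_ge_0. unfold Rsqr. rewrite !Cmod_sqr.
          unfold Cminus. rewrite !re_plus, !im_plus, re_opp, im_opp, re_RtoC, im_RtoC, <- Hs. ring. }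
        rewrite Em in Hc.
        assert (0 < Cmod (1 + s)).
        { pose proof (Cmod_sqr (1 + s)) as H. rewrite re_plus, im_plus, re_RtoC, im_RtoC, <- Hs in H.
          pose proof (Cmod_ge_0 (1 + s)). nra. }
        nra. }
      apply in_image_pullback with s; [exact Es|].
      apply IH with (r := (r * r)%R); auto.
      + nra.
      + replace ((r * r) ^ (2 ^ n))%R with (r ^ (2 ^ S n))%R; [exact Hrn|].
        rewrite Nat.pow_succ_r', pow_mult. f_equal. simpl. ring.
      + now apply root_ne_1 with x.
      + assert (P2 : 0 < Cmod (1 + x) * Cmod (1 + x)).
        { pose proof (Cmod_ge_0 (1 - x)). nra. }
        apply Rmult_le_reg_r with (Cmod (1 + x) * Cmod (1 + x))%R; [exact P2|].
        eapply Rle_trans; [exact Hc|].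
        replace (r * r * Cmod (1 + s) * (Cmod (1 + x) * Cmod (1 + x)))%R with
          ((r * Cmod (1 + x)) * (r * Cmod (1 + x)) * Cmod (1 + s))%R by ring.
        apply Rmult_le_compat_r; [apply Cmod_ge_0|].
        apply Rmult_le_compat; auto; apply Cmod_ge_0. }
  intros Hz Nz.
  assert (P1 : Cmod (1 - z) * Cmod (1 - z) < Cmod (1 + z) * Cmod (1 + z)).
  { rewrite !Cmod_sqr. unfold Cminus. rewrite !re_plus, !im_plus, re_opp, im_opp, re_RtoC, im_RtoC. nra. }
  pose proof (Cmod_ge_0 (1 - z)) as Q1. pose proof (Cmod_ge_0 (1 + z)) as Q2.
  assert (Q3 : Cmod (1 - z) < Cmod (1 + z)) by nra.
  set (r := (Cmod (1 - z) / Cmod (1 + z))%R).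
  assert (Er : (Cmod (1 - z) = r * Cmod (1 + z))%R) by (unfold r; field; lra).
  assert (Hr : 0 <= r < 1).
  { split; [apply Rmult_le_pos; [lra|left; apply Rinv_0_lt_compat; lra]|].
    apply Rmult_lt_reg_r with (Cmod (1 + z)); lra. }
  assert (Hl : is_lim_seq (fun n => (r ^ n)%R) 0%R).
  { apply is_lim_seq_geom. rewrite Rabs_pos_eq; lra. }
  apply is_lim_seq_spec in Hl. destruct (Hl (mkposreal r0 Hr0)) as [n Hn].
  specialize (Hn (2 ^ n)%nat (Nat.lt_le_incl _ _ (Nat.pow_gt_lin_r 2 n ltac:(lia)))).
  simpl pos in Hn. rewrite Rminus_0_r in Hn. pose proof (Rle_abs (r ^ (2 ^ n))).
  apply (K n r); auto; lra.
Qed.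

(** If t were imaginary too, then t^2 (1 + s^2) would be real while 2 s is imaginary, forcing s =
    0. *)
Lemma imaginary_root (s t : C) : Re s = 0%R -> s <> 0 -> t * t * (1 + s * s) = 2 * s -> 0 <= Re t ->
  0 < Re t.
Proof.
  intros Hs Ns E [Ht|Ht]; [exact Ht|exfalso]. apply Ns.
  destruct s as [s0 s], t as [t0 t]. simpl in Hs, Ht. subst.
  apply (f_equal Im) in E. unfold Im, Cmult, Cplus, RtoC in E; simpl in E.
  unfold RtoC. f_equal. lra.
Qed.

(** The principal root s lies in the closed right half-plane; if it falls on the imaginary axis, one
    further root leaves it. The excluded points are where this breaks down: 1 + z^2 = 0 at z = Ci
    and z = - Ci, s = 0 at z = 0, 1 + s^2 = 0 at z = -1, and 1 is the value at q = 0. *)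
Theorem ratio_surjective (z : C) : regular_point z -> in_image z.
Proof.
  intros [N0 [N1 [N2 [N3 N4]]]].
  assert (N := one_plus_sqr_nz z N3 N4).
  destruct (root_exists z N) as [s [Es Hs]].
  apply in_image_pullback with s; [exact Es|].
  assert (Ns1 : s <> 1) by now apply root_ne_1 with z.
  destruct Hs as [Hs|Hs]; [now apply in_image_half_plane|].
  assert (Ns0 : s <> 0).
  { intros ->. apply N0. replace z with (2 * z / 2) by field. rewrite <- Es. field. }
  assert (Nss : 1 + s * s <> 0).
  { intros F. apply N2.
    assert (G : (1 + z) * (1 + z) = 0).
    { replace ((1 + z) * (1 + z)) with ((1 + s * s) * (1 + z * z) - s * s * (1 + z * z) + 2 * z) by ring.
      rewrite F, Es. ring. }
    destruct (Cmult_integral _ _ G) as [G'|G']; apply Ceq_minus; rewrite <- G'; ring. }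
  destruct (root_exists s Nss) as [t [Et Ht]].
  apply in_image_pullback with t; [exact Et|].
  apply in_image_half_plane; [now apply imaginary_root with s|].
  now apply root_ne_1 with s.
Qed.

(** * The complex exponential *)

Definition cexp (z : C) : C := ((exp (Re z) * cos (Im z))%R, (exp (Re z) * sin (Im z))%R).

Lemma cexp_plus (z w : C) : cexp (z + w) = cexp z * cexp w.
Proof.
  unfold cexp. rewrite re_plus, im_plus, exp_plus, cos_plus, sin_plus.
  unfold Cmult; simpl. f_equal; ring.
Qed.

Lemma cexp_0 : cexp 0 = 1.
Proof. unfold cexp, RtoC; simpl. rewrite exp_0, cos_0, sin_0. f_equal; ring. Qed.

Lemma Cmod_cexp (z : C) : Cmod (cexp z) = exp (Re z).
Proof.
  assert (H : (Cmod (cexp z) * Cmod (cexp z) = exp (Re z) * exp (Re z))%R).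
  { rewrite Cmod_sqr. unfold cexp; simpl. pose proof (sin2_cos2 (Im z)) as H. unfold Rsqr in H.
    transitivity (exp (fst z) * exp (fst z) * (sin (Im z) * sin (Im z) + cos (Im z) * cos (Im z)))%R;
      [unfold Re, Im; ring|]. rewrite H. unfold Re. ring. }
  apply Rsqr_inj; [apply Cmod_ge_0|left; apply exp_pos|exact H].
Qed.

Lemma cexp_nz (z : C) : cexp z <> 0.
Proof. apply Cmod_gt_0. rewrite Cmod_cexp. apply exp_pos. Qed.

Lemma cexp_opp (z : C) : cexp (- z) = / cexp z.
Proof.
  assert (H : cexp (- z) * cexp z = 1).
  { rewrite <- cexp_plus, <- cexp_0. f_equal. ring. }
  replace (cexp (- z)) with (cexp (- z) * cexp z / cexp z) by (field; apply cexp_nz).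
  rewrite H. field. apply cexp_nz.
Qed.

Lemma cexp_pow (z : C) (n : nat) : cexp (RtoC (INR n) * z) = cexp z ^ n.
Proof.
  induction n as [|n IH].
  - simpl. rewrite Cmult_0_l. apply cexp_0.
  - rewrite S_INR, RtoC_plus, Cmult_plus_distr_r, cexp_plus, IH. simpl.
    rewrite !Cmult_1_l. ring.
Qed.

Lemma real_derive_eps (f : R -> R) (l eps : R) :
  derivable_pt_lim f 0 l -> 0 < eps ->
  exists d, 0 < d /\ forall h, Rabs h < d -> Rabs (f h - f 0 - l * h) <= eps * Rabs h.
Proof.
  intros H Hp. destruct (H eps Hp) as [d Hd]. exists (pos d). split; [apply cond_pos|].
  intros h Hh. destruct (Req_dec h 0) as [->|Hn].
  - replace (f 0 - f 0 - l * 0)%R with 0%R by ring. rewrite Rabs_R0. lra.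
  - specialize (Hd h Hn Hh). rewrite Rplus_0_l in Hd.
    replace (f h - f 0 - l * h)%R with (((f h - f 0) / h - l) * h)%R by (field; exact Hn).
    rewrite Rabs_mult. apply Rmult_le_compat_r; [apply Rabs_pos|lra].
Qed.

Lemma cexp_derive_0 : is_C_derive cexp 0 1.
Proof.
  apply is_C_derive_eps. intros eps Hp.
  (* The real part costs 4 and the imaginary part 5 multiples of e |w|, with exp p bounded by 3. *)
  set (e := Rmin 1 (eps / 9)). assert (He : 0 < e) by (apply Rmin_glb_lt; lra).
  assert (He1 : e <= 1) by apply Rmin_l. assert (He9 : e <= eps / 9) by apply Rmin_r.
  destruct (real_derive_eps exp 1 e) as [d1 [D1 H1]]; auto.
  { pose proof (derivable_pt_lim_exp 0) as H. now rewrite exp_0 in H. }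
  destruct (real_derive_eps cos 0 e) as [d2 [D2 H2]]; auto.
  { pose proof (derivable_pt_lim_cos 0) as H. rewrite sin_0, Ropp_0 in H. exact H. }
  destruct (real_derive_eps sin 1 e) as [d3 [D3 H3]]; auto.
  { pose proof (derivable_pt_lim_sin 0) as H. now rewrite cos_0 in H. }
  exists (Rmin e (Rmin d1 (Rmin d2 d3))). split.
  { apply Rmin_glb_lt; [exact He|apply Rmin_glb_lt; [exact D1|apply Rmin_glb_lt; assumption]]. }
  intros w Hw. rewrite cexp_0. replace (w - 0) with w in * by ring.
  pose proof (re_le_Cmod w) as R1. pose proof (im_le_Cmod w) as I1.
  set (p := Re w) in *. set (r := Im w) in *. set (m := Cmod w) in *.
  assert (M1 := Rlt_le_trans _ _ _ Hw (Rmin_l _ _)).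
  assert (M2 := Rlt_le_trans _ _ _ Hw (Rmin_r _ _)).
  assert (M3 := Rlt_le_trans _ _ _ M2 (Rmin_l _ _)).
  assert (M4 := Rlt_le_trans _ _ _ M2 (Rmin_r _ _)).
  assert (M5 := Rlt_le_trans _ _ _ M4 (Rmin_l _ _)).
  assert (M6 := Rlt_le_trans _ _ _ M4 (Rmin_r _ _)).
  specialize (H1 p ltac:(lra)). specialize (H2 r ltac:(lra)). specialize (H3 r ltac:(lra)).
  rewrite exp_0 in H1. rewrite cos_0 in H2. rewrite sin_0 in H3.
  eapply Rle_trans; [apply Cmod_le_Re_Im|].
  replace (Re (cexp w - 1 - 1 * w)) with ((exp p - 1 - 1 * p) + exp p * (cos r - 1 - 0 * r))%R
    by (unfold cexp, Cminus, Cplus, Copp, Cmult, RtoC, p, r, Re; simpl; ring).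
  replace (Im (cexp w - 1 - 1 * w)) with (exp p * (sin r - 0 - 1 * r) + (exp p - 1 - 1 * p) * r + p * r)%R
    by (unfold cexp, Cminus, Cplus, Copp, Cmult, RtoC, p, r, Re, Im; simpl; ring).
  assert (Ep : exp p <= 3).
  { eapply Rle_trans; [|apply exp_le_3]. pose proof (Rle_abs p).
    destruct (Req_dec p 1) as [->|]; [lra|]. left. apply exp_increasing. lra. }
  pose proof (exp_pos p) as Ep0.
  pose proof (Rabs_pos p). pose proof (Rabs_pos r).
  pose proof (Rabs_pos (exp p - 1 - 1 * p)). pose proof (Rabs_pos (cos r - 1 - 0 * r)).
  pose proof (Rabs_pos (sin r - 0 - 1 * r)).
  assert (B1 : Rabs (exp p - 1 - 1 * p + exp p * (cos r - 1 - 0 * r)) <= e * m + 3 * (e * m)).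
  { eapply Rle_trans; [apply Rabs_triang|]. rewrite Rabs_mult, (Rabs_pos_eq (exp p)) by lra.
    assert (e * Rabs p <= e * m) by (apply Rmult_le_compat_l; lra).
    assert (e * Rabs r <= e * m) by (apply Rmult_le_compat_l; lra). nra. }
  assert (B2 : Rabs (exp p * (sin r - 0 - 1 * r) + (exp p - 1 - 1 * p) * r + p * r) <=
     3 * (e * m) + e * m + e * m).
  { eapply Rle_trans; [apply Rabs_triang|].
    eapply Rle_trans; [apply Rplus_le_compat_r, Rabs_triang|].
    rewrite !Rabs_mult, (Rabs_pos_eq (exp p)) by lra.
    assert (e * Rabs p <= e * m) by (apply Rmult_le_compat_l; lra).
    assert (e * Rabs r <= e * m) by (apply Rmult_le_compat_l; lra).
    assert (Rabs (exp p - 1 - 1 * p) * Rabs r <= e * m * 1).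
    { apply Rmult_le_compat; lra. }
    assert (Rabs p * Rabs r <= e * m) by (apply Rmult_le_compat; lra).
    assert (exp p * Rabs (sin r - 0 - 1 * r) <= 3 * (e * m)) by (apply Rmult_le_compat; lra).
    lra. }
  assert (e * m <= eps / 9 * m) by (apply Rmult_le_compat_r; [apply Cmod_ge_0|lra]).
  lra.
Qed.

Lemma cexp_derive (z : C) : is_C_derive cexp z (cexp z).
Proof.
  apply C_derive_ext with (f := fun w => cexp z * cexp (w - z)).
  - intros w. rewrite <- cexp_plus. f_equal. ring.
  - eapply C_derive_eq.
    + apply C_derive_scal. apply (C_derive_comp cexp (fun w => w - z) z 1 (1 - 0)).
      * replace (z - z) with (RtoC 0) by ring. apply cexp_derive_0.
      * apply C_derive_minus; [apply C_derive_id|apply C_derive_const].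
    + ring.
Qed.

Lemma cexp_surjective (z : C) : z <> 0 -> exists u, cexp u = z.
Proof.
  intros Hz. assert (P : 0 < Cmod z) by now apply Cmod_gt_0.
  set (m := Cmod z) in *. pose proof (Cmod_sqr z) as H. fold m in H.
  set (c := (Re z / m)%R). set (s := (Im z / m)%R).
  assert (Hcs : (c * c + s * s = 1)%R).
  { unfold c, s. replace (Re z / m * (Re z / m) + Im z / m * (Im z / m))%R
      with ((Re z * Re z + Im z * Im z) / (m * m))%R by (field; lra).
    rewrite <- H. field. lra. }
  assert (Ha : exists t, cos t = c /\ sin t = s).
  { assert (Hc : -1 <= c <= 1) by nra.
    assert (Es : sqrt (1 - Rsqr c) = Rabs s).
    { rewrite <- sqrt_Rsqr_abs. f_equal. unfold Rsqr. lra. }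
    destruct (Rle_dec 0 s) as [Hs|Hs].
    - exists (acos c). split; [now apply cos_acos|]. rewrite sin_acos, Es by exact Hc. now apply Rabs_pos_eq.
    - exists (- acos c)%R. rewrite cos_neg, sin_neg. split; [now apply cos_acos|].
      rewrite sin_acos, Es by exact Hc. rewrite Rabs_left by lra. ring. }
  destruct Ha as [t [Hc Hs]]. exists (ln m, t). unfold cexp; simpl.
  rewrite exp_ln by exact P. rewrite Hc, Hs. unfold c, s.
  rewrite (surjective_pairing z) at 1. unfold Re, Im. destruct z as [z1 z2]. simpl. f_equal; field; lra.
Qed.

Lemma cexp_PI : cexp (Ci * PI) = - (1).
Proof.
  unfold cexp. rewrite (Cmult_comm Ci), re_mult_Ci, im_RtoC, im_mult. simpl.
  rewrite Ropp_0, exp_0, Rmult_1_r, Rmult_0_l, Rplus_0_r, cos_PI, sin_PI.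
  unfold Copp, RtoC; simpl. f_equal; ring.
Qed.

Lemma cexp_PI2 : cexp (Ci * PI / 2) = Ci.
Proof.
  replace (Ci * PI / 2) with (RtoC (PI / 2) * Ci) by (rewrite RtoC_div by lra; field).
  unfold cexp. rewrite re_mult_Ci, im_RtoC, im_mult. simpl.
  rewrite Ropp_0, exp_0, Rmult_0_r, Rplus_0_r, Rmult_1_r, cos_PI2, sin_PI2.
  unfold Ci. f_equal; ring.
Qed.

(** * Partial fractions of 1 / sin^2 *)

Definition ec (u : C) : C := cexp (2 * Ci * PI * u).
(* 1 / sin (pi u) ^ 2 *)
Definition csc2 (u : C) : C := - (4) * koebe (ec u).

Lemma ec_plus (u v : C) : ec (u + v) = ec u * ec v.
Proof. unfold ec. rewrite <- cexp_plus. f_equal. ring. Qed.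

Lemma ec_opp (u : C) : ec (- u) = / ec u.
Proof. unfold ec. rewrite <- cexp_opp. f_equal. ring. Qed.

Lemma ec_nz (u : C) : ec u <> 0.
Proof. apply cexp_nz. Qed.

Lemma ec_half : ec (/ 2) = - (1).
Proof. unfold ec. rewrite <- cexp_PI. f_equal. field. Qed.

(** This is 1 / sin^2 + 1 / cos^2 = 4 / sin^2 of the double angle; the shifts by +1 and -1 agree by
    periodicity. *)
Lemma csc2_double (z : C) : ec z <> 1 ->
  csc2 (z / 2) + csc2 ((z + 1) / 2) = 4 * csc2 z /\
  csc2 (z / 2) + csc2 ((z - 1) / 2) = 4 * csc2 z.
Proof.
  intros Hz. set (v := ec (z / 2)).
  assert (E0 : ec z = v * v) by (unfold v; rewrite <- ec_plus; f_equal; field).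
  assert (E1 : ec ((z + 1) / 2) = - v).
  { replace ((z + 1) / 2) with (z / 2 + / 2) by field. rewrite ec_plus, ec_half. fold v. ring. }
  assert (E2 : ec ((z - 1) / 2) = - v).
  { replace ((z - 1) / 2) with (z / 2 + - / 2) by field. rewrite ec_plus, ec_opp, ec_half. fold v. field. }
  assert (N : 1 - v * v <> 0).
  { intros F. apply Hz. rewrite E0. symmetry. now apply Ceq_minus. }
  assert (N1 : 1 - v <> 0).
  { intros F. apply N. replace (1 - v * v) with ((1 - v) * (1 + v)) by ring. rewrite F. ring. }
  assert (N2 : 1 + v <> 0).
  { intros F. apply N. replace (1 - v * v) with ((1 - v) * (1 + v)) by ring. rewrite F. ring. }
  unfold csc2. rewrite E0, E1, E2. fold v. unfold koebe.
  replace (1 - v * v) with ((1 - v) * (1 + v)) by ring.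
  replace (1 - - v) with (1 + v) by ring. split; field; auto.
Qed.

Lemma pow2_nz (n : nat) : RtoC 2 ^ n <> 0.
Proof. apply Cpow_nz, C2_nz. Qed.

(** The result of doubling n + 1 times: the points (z + j) / 2^(n+1) for -2^n <= j < 2^n, with j = k
    paired with j = - k - 1. After division by 4^(n+1) each term tends to 1 / (pi^2 (z + j)^2),
    which produces the partial fractions. *)
Definition csc2_sum (n : nat) (z : C) : C :=
  csum (fun k => csc2 ((z + RtoC (INR k)) / 2 ^ S n) + csc2 ((z - RtoC (INR k) - 1) / 2 ^ S n)) (2 ^ n).

(** The even j come from z / 2 and the odd j from (z + 1) / 2. *)
Lemma csc2_sum_double (n : nat) (z : C) : csc2_sum (S n) z = csc2_sum n (z / 2) + csc2_sum n ((z + 1) / 2).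
Proof.
  unfold csc2_sum. rewrite <- csum_plus.
  assert (H : forall F G : nat -> C, (forall k, F (2 * k)%nat + F (S (2 * k)) = G k) ->
    forall m, csum F (2 * m) = csum G m).
  { intros F G HFG m. induction m as [|m IH]; [reflexivity|].
    replace (2 * S m)%nat with (S (S (2 * m))) by lia. cbn [csum]. rewrite IH, <- (HFG m). ring. }
  change (2 ^ S n)%nat with (2 * 2 ^ n)%nat. apply H. intros k.
  rewrite S_INR, mult_INR. replace (INR 2) with 2%R by (simpl; ring). rewrite !RtoC_plus, !RtoC_mult.
  pose proof (pow2_nz n) as N.
  replace (z / 2 + RtoC (INR k)) with ((z + 2 * RtoC (INR k)) / 2) by field.
  replace (z / 2 - RtoC (INR k) - 1) with ((z - (2 * RtoC (INR k) + 1) - 1) / 2) by field.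
  replace ((z + 1) / 2 + RtoC (INR k)) with ((z + (2 * RtoC (INR k) + 1)) / 2) by field.
  replace ((z + 1) / 2 - RtoC (INR k) - 1) with ((z - 2 * RtoC (INR k) - 1) / 2) by field.
  assert (D : forall x, x / 2 / 2 ^ S n = x / 2 ^ S (S n)).
  { intros x. simpl. field. exact N. }
  rewrite !D. ring.
Qed.

Lemma csc2_sum_eq (n : nat) : forall z, ec z <> 1 -> csc2_sum n z = 4 ^ S n * csc2 z.
Proof.
  induction n as [|n IH]; intros z Hz.
  - destruct (csc2_double z Hz) as [_ H]. unfold csc2_sum.
    replace (4 ^ 1 * csc2 z) with (4 * csc2 z) by ring. rewrite <- H. simpl.
    replace ((z + 0) / (2 * 1)) with (z / 2) by field.
    replace ((z - 0 - 1) / (2 * 1)) with ((z - 1) / 2) by field. ring.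
  - destruct (csc2_double z Hz) as [H _]. rewrite csc2_sum_double, !IH.
    + change (RtoC 4 ^ S (S n)) with (4 * 4 ^ S n).
      transitivity (4 ^ S n * (csc2 (z / 2) + csc2 ((z + 1) / 2))); [ring|]. rewrite H. ring.
    + intros F. apply Hz. replace z with ((z + 1) / 2 + (z + 1) / 2 + - (/ 2 + / 2)) by field.
      rewrite !ec_plus, ec_opp, ec_plus, ec_half, F. field.
    + intros F. apply Hz. replace z with (z / 2 + z / 2) by field. rewrite ec_plus, F. ring.
Qed.

Lemma exp_diff_bound (x : R) : x * x <= (exp x - exp (- x)) * (exp x - exp (- x)).
Proof.
  assert (H : forall t, 0 <= t -> t <= exp t - exp (- t)).
  { intros t Ht. rewrite exp_Ropp. pose proof (exp_ineq1_le t) as H1. pose proof (exp_pos t) as H2.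
    assert (/ exp t <= / (1 + t)) by (apply Rinv_le_contravar; lra).
    assert (/ (1 + t) <= 1).
    { rewrite <- Rinv_1. apply Rinv_le_contravar; lra. }
    lra. }
  destruct (Rle_dec 0 x) as [Hx|Hx].
  - specialize (H x Hx). nra.
  - specialize (H (- x)%R ltac:(lra)). rewrite Ropp_involutive in H. nra.
Qed.

Lemma sin_ge_mul_cos (t : R) : 0 <= t <= PI / 2 -> t * cos t <= sin t.
Proof.
  intros [H0 H1]. destruct H0 as [H0|<-]; [|rewrite sin_0; lra].
  destruct (MVT_gen sin 0 t cos) as [c [Hc E]].
  - intros x _. apply is_derive_Reals, derivable_pt_lim_sin.
  - intros x _. apply continuity_sin.
  - rewrite Rmin_left, Rmax_right in Hc by lra.
    rewrite sin_0, !Rminus_0_r in E. rewrite E.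
    rewrite Rmult_comm. apply Rmult_le_compat_r; [lra|].
    destruct (Req_dec c t) as [->|Hn]; [lra|]. pose proof PI_RGT_0.
    left. apply cos_decreasing_1; lra.
Qed.

(** The points of [csc2_sum] have real part at most about 1/2. The bound 3/4 leaves room for z and
    keeps away from the poles at 1 and -1; half of the angle pi * 3/4 is 3 pi / 8. *)
Definition c0 : R := cos (3 * PI / 8).

Lemma c0_pos : 0 < c0 <= 1.
Proof.
  pose proof PI_RGT_0. split; [apply cos_gt_0; lra|apply COS_bound].
Qed.

(** With r = pi t / 2, sin (2 r) = 2 sin r cos r >= 2 r cos(r)^2, and cos r >= [c0]. Halving the
    angle is needed because pi t may exceed pi / 2. *)
Lemma sin_PI_bound (t : R) : Rabs t <= 3 / 4 -> c0 ^ 4 * (t * t) <= sin (PI * t) * sin (PI * t).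
Proof.
  intros Ht. pose proof PI_RGT_0 as HP. pose proof c0_pos as Hc.
  assert (K : forall x, 0 <= x <= 3 / 4 -> c0 ^ 2 * x <= sin (PI * x)).
  { intros x Hx. set (r := (PI * x / 2)%R).
    assert (Hr : 0 <= r <= 3 * PI / 8) by (unfold r; split; nra).
    replace (PI * x)%R with (2 * r)%R by (unfold r; field). rewrite sin_2a.
    pose proof (sin_ge_mul_cos r ltac:(lra)) as H1.
    assert (H2 : c0 <= cos r).
    { unfold c0. destruct (Req_dec r (3 * PI / 8)) as [->|Hn]; [lra|]. left. apply cos_decreasing_1; lra. }
    assert (H3 : x <= 2 * r) by (unfold r; pose proof PI2_3_2; nra).
    apply Rle_trans with (2 * (r * cos r) * cos r)%R; [|apply Rmult_le_compat_r; lra].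
    replace (2 * (r * cos r) * cos r)%R with (2 * r * (cos r * cos r))%R by ring.
    simpl. rewrite Rmult_1_r, Rmult_comm. apply Rmult_le_compat; try nra. }
  assert (E : (sin (PI * t) * sin (PI * t) = sin (PI * Rabs t) * sin (PI * Rabs t))%R).
  { destruct (Rle_dec 0 t) as [H|H].
    - rewrite Rabs_pos_eq by lra. reflexivity.
    - rewrite Rabs_left by lra. replace (PI * - t)%R with (- (PI * t))%R by ring. rewrite sin_neg. ring. }
  rewrite E. pose proof (Rabs_pos t) as H0. specialize (K (Rabs t) ltac:(lra)).
  replace (t * t)%R with (Rabs t * Rabs t)%R by (rewrite <- Rabs_mult; apply Rabs_pos_eq; nra).
  replace (c0 ^ 4 * (Rabs t * Rabs t))%R with ((c0 ^ 2 * Rabs t) * (c0 ^ 2 * Rabs t))%R by ring.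
  apply Rmult_le_compat; auto; apply Rmult_le_pos; auto; apply pow_le; lra.
Qed.

(** |sin (pi u)|^2 is the sum of sin (pi Re u)^2 and sinh (pi Im u)^2; each summand is at least c0^4
    times the square of its part of u. *)
Lemma csc2_bound (u : C) :
  Rabs (Re u) <= 3 / 4 -> u <> 0 -> Cmod (csc2 u) <= / (c0 ^ 4 * (Cmod u * Cmod u)).
Proof.
  intros Hr Hu. pose proof PI_RGT_0 as HP. pose proof c0_pos as Hc.
  assert (Hc4 : 0 < c0 ^ 4 <= 1).
  { split; [apply pow_lt; lra|]. rewrite <- (pow1 4). apply pow_incr. lra. }
  assert (Pu : 0 < Cmod u) by now apply Cmod_gt_0.
  destruct u as [p r]. simpl in Hr. set (u := (p, r)) in *.
  set (s := exp (- (PI * r))%R). assert (Ps : 0 < s) by apply exp_pos.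
  assert (Ew : ec u = ((s * s * cos (2 * (PI * p)))%R, (s * s * sin (2 * (PI * p)))%R)).
  { unfold ec. replace (2 * Ci * PI * u) with ((- (2 * (PI * r)))%R, (2 * (PI * p))%R)
      by (unfold u, Ci, Cmult, RtoC; simpl; f_equal; ring).
    unfold cexp; simpl. replace (- (2 * (PI * r)))%R with (- (PI * r) + - (PI * r))%R by ring.
    rewrite exp_plus. reflexivity. }
  assert (Hw : Cmod (ec u) = (s * s)%R).
  { unfold ec. rewrite Cmod_cexp. unfold s. rewrite <- exp_plus. f_equal.
    unfold u, Ci, Cmult, RtoC; simpl. ring. }
  assert (E1 : (Cmod (1 - ec u) * Cmod (1 - ec u) =
      (s * s) * ((exp (PI * r) - exp (- (PI * r))) * (exp (PI * r) - exp (- (PI * r)))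
        + 4 * (sin (PI * p) * sin (PI * p))))%R).
  { rewrite Cmod_sqr, Ew. unfold Cminus, Cplus, Copp, RtoC, Re, Im; simpl.
    fold s. assert (Es : (exp (PI * r) * s = 1)%R).
    { unfold s. rewrite <- exp_plus, <- exp_0. f_equal. ring. }
    set (t := exp (PI * r)) in *.
    replace (s * s * ((t - s) * (t - s) + 4 * (sin (PI * p) * sin (PI * p))))%R with
      ((t * s - s * s) * (t * s - s * s) + 4 * (s * s) * (sin (PI * p) * sin (PI * p)))%R by ring.
    rewrite Es. pose proof (sin2_cos2 (2 * (PI * p))) as H. unfold Rsqr in H.
    assert (H2 := cos_2a_sin (PI * p)).
    set (cc := cos (2 * (PI * p))) in *. set (ss := sin (2 * (PI * p))) in *.
    set (sn := sin (PI * p)) in *.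
    replace ((1 + - (s * s * cc)) * (1 + - (s * s * cc)) + (0 + - (s * s * ss)) * (0 + - (s * s * ss)))%R
      with (1 - 2 * (s * s) * cc + (s * s) * (s * s) * (ss * ss + cc * cc))%R by ring.
    rewrite H, H2. ring. }
  assert (E2 : 4 * (c0 ^ 4 * (Cmod u * Cmod u)) * (s * s) <= Cmod (1 - ec u) * Cmod (1 - ec u)).
  { rewrite E1, Rmult_comm. apply Rmult_le_compat_l; [nra|].
    rewrite (Cmod_sqr u). simpl.
    pose proof (exp_diff_bound (PI * r)) as B1. pose proof (sin_PI_bound p Hr) as B2.
    assert (2 * 2 * (r * r) <= PI * r * (PI * r)).
    { pose proof PI2_3_2. assert (2 * 2 <= PI * PI) by nra.
      replace (PI * r * (PI * r))%R with (PI * PI * (r * r))%R by ring.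
      apply Rmult_le_compat_r; nra. }
    assert (c0 ^ 4 * (r * r) <= 1 * (r * r)) by (apply Rmult_le_compat_r; nra).
    simpl in *. nra. }
  assert (Q : 0 < c0 ^ 4 * (Cmod u * Cmod u)) by (apply Rmult_lt_0_compat; nra).
  assert (Q2 : 0 < 4 * (c0 ^ 4 * (Cmod u * Cmod u)) * (s * s)) by (apply Rmult_lt_0_compat; nra).
  assert (N : 1 - ec u <> 0) by (apply Cmod_gt_0; pose proof (Cmod_ge_0 (1 - ec u)); nra).
  unfold csc2, koebe. rewrite Cmod_mult, Cmod_opp, Cmod_R, Rabs_pos_eq by lra.
  rewrite Cmod_div by now apply Cmult_neq_0. rewrite Cmod_mult, Hw.
  apply Rmult_le_reg_r with (Cmod (1 - ec u) * Cmod (1 - ec u))%R; [lra|].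
  replace (4 * (s * s / (Cmod (1 - ec u) * Cmod (1 - ec u))) * (Cmod (1 - ec u) * Cmod (1 - ec u)))%R
    with (4 * (s * s))%R by (field; apply Rgt_not_eq; now apply Cmod_gt_0).
  apply Rmult_le_reg_l with (c0 ^ 4 * (Cmod u * Cmod u))%R; [exact Q|].
  set (X := (c0 ^ 4 * (Cmod u * Cmod u))%R) in *.
  rewrite <- (Rmult_assoc X (/ X)), Rinv_r, Rmult_1_l by lra. lra.
Qed.

Lemma clim_derive_comp (f : C -> C) (u : nat -> C) (l m : C) :
  is_C_derive f l m -> clim u l -> clim (fun n => f (u n)) (f l).
Proof.
  intros Hf Hu eps Hp. destruct (C_derive_cont f l m Hf eps Hp) as [d [Hd H]].
  destruct (Hu d Hd) as [N HN]. exists N. intros n Hn. apply H. auto.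
Qed.

Lemma csc2_scaled_clim (x : C) : x <> 0 ->
  clim (fun n => / 4 ^ S n * csc2 (x / 2 ^ S n)) (/ (RtoC PI * RtoC PI) * / (x * x)).
Proof.
  intros Hx. set (X := 2 * Ci * PI * x).
  assert (NPI : RtoC PI <> 0).
  { intros F. apply RtoC_inj in F. pose proof PI_RGT_0. lra. }
  assert (NX : X <> 0) by (unfold X; repeat apply Cmult_neq_0; auto using C2_nz, Ci_nz).
  assert (HX : 0 < Cmod X) by now apply Cmod_gt_0.
  assert (Hsmall : forall d, 0 < d -> exists N, forall n, (N <= n)%nat -> Cmod (X / 2 ^ S n) < d).
  { intros d Hd. destruct (Pow_x_infinity 2 ltac:(rewrite Rabs_pos_eq; lra) (Cmod X / d + 1)%R) as [N HN].
    exists N. intros n Hn. specialize (HN (S n) ltac:(lia)). rewrite Rabs_pos_eq in HN by (apply pow_le; lra).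
    rewrite Cmod_div, Cmod_pow, Cmod_R, Rabs_pos_eq by (try apply pow2_nz; lra).
    assert (P : 0 < 2 ^ S n) by (apply pow_lt; lra).
    apply Rmult_lt_reg_r with (2 ^ S n)%R; [exact P|].
    unfold Rdiv. rewrite Rmult_assoc, Rinv_l, Rmult_1_r by lra.
    apply Rmult_lt_reg_l with (/ d)%R; [now apply Rinv_0_lt_compat|].
    rewrite <- Rmult_assoc, Rinv_l, Rmult_1_l by lra. unfold Rdiv in HN. lra. }
  assert (L0 : clim (fun n => X / 2 ^ S n) 0).
  { intros eps Hp. destruct (Hsmall eps Hp) as [N HN]. exists N. intros n Hn.
    replace (X / 2 ^ S n - 0) with (X / 2 ^ S n) by ring. auto. }
  assert (L1 : clim (fun n => cexp (X / 2 ^ S n)) 1).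
  { rewrite <- cexp_0. exact (clim_derive_comp cexp _ 0 _ (cexp_derive 0) L0). }
  assert (L2 : clim (fun n => 2 ^ S n * (1 - cexp (X / 2 ^ S n))) (- X)).
  { intros eps Hp.
    destruct (proj1 (is_C_derive_eps _ _ _) cexp_derive_0 (eps / 2 / Cmod X)%R) as [d [Hd H]].
    { apply Rdiv_lt_0_compat; lra. }
    destruct (Hsmall d Hd) as [N HN]. exists N. intros n Hn. specialize (HN n Hn).
    set (t := X / 2 ^ S n) in *.
    specialize (H t). replace (t - 0) with t in H by ring. specialize (H HN).
    rewrite cexp_0 in H.
    assert (Et : X = 2 ^ S n * t) by (unfold t; field; apply pow2_nz).
    replace (2 ^ S n * (1 - cexp t) - - X) with (- (2 ^ S n * (cexp t - 1 - 1 * t))) by (rewrite Et; ring).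
    rewrite Cmod_opp, Cmod_mult.
    assert (P : 0 < Cmod (2 ^ S n)) by (apply Cmod_gt_0, pow2_nz).
    apply Rle_lt_trans with (Cmod (2 ^ S n) * (eps / 2 / Cmod X * Cmod t))%R.
    { apply Rmult_le_compat_l; lra. }
    replace (Cmod (2 ^ S n) * (eps / 2 / Cmod X * Cmod t))%R with (eps / 2)%R; [lra|].
    assert (Em : Cmod X = (Cmod (2 ^ S n) * Cmod t)%R) by (rewrite Et at 1; apply Cmod_mult).
    rewrite Em. field. split; [|lra]. intros F. rewrite F in Em. lra. }
  assert (NX2 : - X * - X <> 0).
  { apply Cmult_neq_0; intros F; apply NX; replace X with (- - X) by ring; rewrite F; ring. }
  pose proof (clim_mult _ _ _ _ (clim_scal (- (4)) _ _ L1)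
    (clim_derive_comp Cinv _ _ _ (C_derive_inv _ NX2) (clim_mult _ _ _ _ L2 L2))) as H.
  replace (/ (RtoC PI * RtoC PI) * / (x * x)) with (- (4) * 1 * / (- X * - X)).
  - eapply clim_ext; [|exact H]. intros n. cbv beta. unfold csc2, ec, koebe.
    replace (2 * Ci * PI * (x / 2 ^ S n)) with (X / 2 ^ S n) by (unfold X; field; apply pow2_nz).
    set (w := cexp (X / 2 ^ S n)).
    replace (RtoC 4 ^ S n) with (2 ^ S n * 2 ^ S n).
    2:{ rewrite <- Cpow_mult_l. replace (RtoC 2 * 2) with (RtoC 4) by ring. reflexivity. }
    (* At w = 1 both sides are 0, because [Cinv] sends 0 to 0. *)
    destruct (Ceq_dec (1 - w) 0) as [F|F].
    + rewrite F. assert (I0 : / (RtoC 0) = 0).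
      { unfold Cinv, RtoC; simpl. f_equal; unfold Rdiv; ring. }
      unfold Cdiv. rewrite !Cmult_0_r, I0. ring.
    + field. split; [exact F|apply pow2_nz].
  - replace (- X * - X) with (4 * (Ci * Ci) * (RtoC PI * RtoC PI) * (x * x)) by (unfold X; ring).
    rewrite Ci_sqr. field. split; [exact Hx|exact NPI].
Qed.

Definition zsum (f : Z -> C) (N : nat) : C :=
  csum (fun i => f (Z.of_nat i - Z.of_nat N)%Z) (S (2 * N)).

Lemma zsum_0 (f : Z -> C) : zsum f 0 = f 0%Z.
Proof. unfold zsum. simpl. ring. Qed.

Lemma zsum_S (f : Z -> C) (N : nat) :
  zsum f (S N) = zsum f N + f (Z.of_nat (S N)) + f (- Z.of_nat (S N))%Z.
Proof.
  unfold zsum. replace (S (2 * S N)) with (S (S (S (2 * N)))) by lia.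
  rewrite csum_S_l. cbn [csum].
  rewrite (csum_ext _ (fun i => f (Z.of_nat i - Z.of_nat N)%Z)) by (intros; f_equal; lia).
  replace (Z.of_nat 0 - Z.of_nat (S N))%Z with (- Z.of_nat (S N))%Z by lia.
  replace (Z.of_nat (S (2 * N)) - Z.of_nat (S N))%Z with (Z.of_nat (2 * N) - Z.of_nat N)%Z by lia.
  replace (Z.of_nat (S (S (2 * N))) - Z.of_nat (S N))%Z with (Z.of_nat (S N)) by lia.
  ring.
Qed.

Lemma zsum_csum (f : Z -> C) (N : nat) :
  zsum f N = f 0%Z + csum (fun k => f (Z.of_nat (S k)) + f (- Z.of_nat (S k))%Z) N.
Proof.
  induction N as [|N IH]; [rewrite zsum_0; simpl; ring|].
  rewrite zsum_S, IH. cbn [csum]. ring.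
Qed.

Lemma rsummable_inv_sqr : rsummable (fun k => / (INR (S k) * INR (S k)))%R.
Proof.
  apply rsummable_le with (2 := rsummable_pow32). intros k.
  assert (P : 1 <= INR (S k)) by (rewrite S_INR; pose proof (pos_INR k); lra).
  assert (S1 : 0 < sqrt (INR (S k))) by (apply sqrt_lt_R0; lra).
  assert (S2 : sqrt (INR (S k)) <= INR (S k)).
  { pose proof (sqrt_sqrt (INR (S k)) ltac:(lra)). nra. }
  split; [left; apply Rinv_0_lt_compat; nra|].
  apply Rinv_le_contravar; [nra|]. apply Rmult_le_compat_l; lra.
Qed.

(** Distance from the integers with linear growth: it both excludes the poles and yields a majorant
    of order 1 / k^2. *)
Definition separated (z : C) (d : R) : Prop :=
  forall k : Z, d * (1 + Rabs (IZR k)) <= Cmod (z - RtoC (IZR k)).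

(** [csc2_sum_eq] divided by 4^(n+1) is a constant sequence, and Tannery's theorem evaluates its
    limit term by term. *)
Theorem csc2_partial_fractions (z : C) (d : R) :
  0 < d -> separated z d -> ec z <> 1 ->
  clim (zsum (fun m => 1 / (z - RtoC (IZR m)) ^ 2)) (PI * PI * csc2 z).
Proof.
  intros Hd Hsep Hz.
  assert (NPI : RtoC PI <> 0).
  { intros F. apply RtoC_inj in F. pose proof PI_RGT_0. lra. }
  assert (Lk : forall k : nat, d * INR (S k) <= Cmod (z + RtoC (INR k)) /\
      d * INR (S k) <= Cmod (z - RtoC (INR k) - 1)).
  { intros k. pose proof (pos_INR k) as Pk. rewrite S_INR. split.
    - pose proof (Hsep (- Z.of_nat k)%Z) as H. rewrite opp_IZR, <- INR_IZR_INZ, Rabs_Ropp, Rabs_pos_eq in H by lra.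
      rewrite RtoC_opp in H. replace (z - - RtoC (INR k)) with (z + RtoC (INR k)) in H by ring. lra.
    - pose proof (Hsep (Z.of_nat (S k))) as H. rewrite <- INR_IZR_INZ, S_INR, Rabs_pos_eq in H by lra.
      rewrite RtoC_plus in H. replace (z - (RtoC (INR k) + 1)) with (z - RtoC (INR k) - 1) in H by ring. nra. }
  assert (PS : forall k, 0 < d * INR (S k)).
  { intros k. apply Rmult_lt_0_compat; [exact Hd|]. apply lt_0_INR. lia. }
  assert (N1 : forall k, z + RtoC (INR k) <> 0).
  { intros k. apply Cmod_gt_0. destruct (Lk k). specialize (PS k). lra. }
  assert (N2 : forall k, z - RtoC (INR k) - 1 <> 0).
  { intros k. apply Cmod_gt_0. destruct (Lk k). specialize (PS k). lra. }
  pose proof c0_pos as Hc. assert (Hc4 : 0 < c0 ^ 4) by (apply pow_lt; lra).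
  set (f := fun k => / (RtoC PI * RtoC PI) * / ((z + RtoC (INR k)) * (z + RtoC (INR k)))
     + / (RtoC PI * RtoC PI) * / ((z - RtoC (INR k) - 1) * (z - RtoC (INR k) - 1))).
  set (Fn := fun n k => / 4 ^ S n * csc2 ((z + RtoC (INR k)) / 2 ^ S n)
     + / 4 ^ S n * csc2 ((z - RtoC (INR k) - 1) / 2 ^ S n)).
  set (M := fun k => (2 / (c0 ^ 4 * (d * d)) * / (INR (S k) * INR (S k)))%R).
  assert (HM : rsummable M).
  { apply rsummable_scal; [|apply rsummable_inv_sqr]. left. apply Rdiv_lt_0_compat; [lra|].
    apply Rmult_lt_0_compat; nra. }
  (* The bound at x / 2^(n+1) carries 4^(n+1) / |x|^2, and the prefactor cancels the power of 4: the
     majorant does not depend on n. *)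
  assert (B : forall x n k, d * INR (S k) <= Cmod x -> Rabs (Re x) <= 3 / 2 * 2 ^ n ->
     Cmod (/ 4 ^ S n * csc2 (x / 2 ^ S n)) <= / (c0 ^ 4 * (d * d)) * / (INR (S k) * INR (S k))).
  { intros x n k H1 H2. specialize (PS k). assert (Nx : x <> 0) by (apply Cmod_gt_0; lra).
    assert (P2 : 0 < 2 ^ S n) by (apply pow_lt; lra).
    assert (E4 : Cmod (4 ^ S n) = (2 ^ S n * 2 ^ S n)%R).
    { rewrite Cmod_pow, Cmod_R, Rabs_pos_eq by lra. rewrite <- Rpow_mult_distr.
      replace (2 * 2)%R with 4%R by ring. reflexivity. }
    assert (N4 : RtoC 4 ^ S n <> 0).
    { apply Cmod_gt_0. rewrite E4. nra. }
    assert (E2 : Cmod (x / 2 ^ S n) = (Cmod x / 2 ^ S n)%R).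
    { rewrite Cmod_div, Cmod_pow, Cmod_R, Rabs_pos_eq by (try apply pow2_nz; lra). reflexivity. }
    rewrite Cmod_mult, Cmod_inv, E4 by exact N4.
    apply Rle_trans with (/ (2 ^ S n * 2 ^ S n) * / (c0 ^ 4 * (Cmod (x / 2 ^ S n) * Cmod (x / 2 ^ S n))))%R.
    - apply Rmult_le_compat_l; [left; apply Rinv_0_lt_compat; nra|]. apply csc2_bound.
      + replace (x / 2 ^ S n) with (x * RtoC (/ 2 ^ S n)).
        * rewrite re_scal_r, Rabs_mult, Rabs_inv, (Rabs_pos_eq (2 ^ S n)) by lra.
          apply Rmult_le_reg_r with (2 ^ S n)%R; [exact P2|].
          rewrite Rmult_assoc, Rinv_l by lra. simpl. lra.
        * rewrite RtoC_inv, RtoC_pow by lra. reflexivity.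
      + intros F. apply Nx. replace x with (x / 2 ^ S n * 2 ^ S n) by (field; apply pow2_nz). rewrite F. ring.
    - rewrite E2. rewrite <- !Rinv_mult. apply Rinv_le_contravar.
      + apply Rmult_lt_0_compat; [apply Rmult_lt_0_compat; nra|].
        assert (0 < INR (S k)) by (apply lt_0_INR; lia). nra.
      + replace (2 ^ S n * 2 ^ S n * (c0 ^ 4 * (Cmod x / 2 ^ S n * (Cmod x / 2 ^ S n))))%R with
          (c0 ^ 4 * (Cmod x * Cmod x))%R by (field; lra).
        rewrite Rmult_assoc. apply Rmult_le_compat_l; [lra|].
        replace (d * d * (INR (S k) * INR (S k)))%R with ((d * INR (S k)) * (d * INR (S k)))%R by ring.
        apply Rmult_le_compat; lra. }
  assert (T : clim (fun n => csum (Fn n) (2 ^ n)) (Ser f)).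
  { apply tannery with (M := M); [exact HM| | |].
    - destruct (Pow_x_infinity 2 ltac:(rewrite Rabs_pos_eq; lra) (2 * Rabs (Re z) + 2)%R) as [N0 HN0].
      exists N0. intros n k Hn Hk. specialize (HN0 n Hn). rewrite Rabs_pos_eq in HN0 by (apply pow_le; lra).
      assert (Hk' : INR k + 1 <= 2 ^ n).
      { rewrite <- S_INR. replace (2 ^ n)%R with (INR (2 ^ n)) by (rewrite pow_INR; replace (INR 2) with 2%R by (simpl; ring); reflexivity).
        apply le_INR. lia. }
      pose proof (pos_INR k). destruct (Lk k) as [L1 L2].
      unfold Fn. eapply Rle_trans; [apply Cmod_triangle|]. unfold M.
      replace (2 / (c0 ^ 4 * (d * d)) * / (INR (S k) * INR (S k)))%R with
        (/ (c0 ^ 4 * (d * d)) * / (INR (S k) * INR (S k)) + / (c0 ^ 4 * (d * d)) * / (INR (S k) * INR (S k)))%R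
        by (unfold Rdiv; ring).
      apply Rplus_le_compat; apply B; auto.
      + rewrite re_plus, re_RtoC. eapply Rle_trans; [apply Rabs_triang|].
        rewrite (Rabs_pos_eq (INR k)) by lra. lra.
      + unfold Cminus. rewrite !re_plus, !re_opp, !re_RtoC.
        replace (Re z + - INR k + - (1))%R with (Re z + - (INR k + 1))%R by ring.
        eapply Rle_trans; [apply Rabs_triang|]. rewrite Rabs_Ropp, (Rabs_pos_eq (INR k + 1)) by lra. lra.
    - intros k. apply clim_plus; now apply csc2_scaled_clim.
    - intros m. exists m. intros n Hn. pose proof (Nat.pow_gt_lin_r 2 n ltac:(lia)). lia. }
  assert (Ef : Ser f = csc2 z).
  { eapply clim_unique; [exact T|]. eapply clim_ext; [|apply clim_const].
    intros n. pose proof (csc2_sum_eq n z Hz) as E. unfold csc2_sum in E.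
    assert (N4 : RtoC 4 ^ S n <> 0) by (apply Cpow_nz; intros F; apply RtoC_inj in F; lra).
    replace (csc2 z) with (/ 4 ^ S n * (4 ^ S n * csc2 z)) by (field; exact N4).
    rewrite <- E, <- csum_scal. apply csum_ext. intros k _. unfold Fn. ring. }
  assert (Lf : clim (csum f) (csc2 z)).
  { rewrite <- Ef. apply Ser_correct with (M := M); [|exact HM]. intros k.
    assert (G : forall x, d * INR (S k) <= Cmod x -> x <> 0 ->
      Cmod (/ (RtoC PI * RtoC PI) * / (x * x)) <= / (c0 ^ 4 * (d * d)) * / (INR (S k) * INR (S k))).
    { intros x Hx Nx. apply clim_le with (u := fun n => / 4 ^ S n * csc2 (x / 2 ^ S n));
        [|now apply csc2_scaled_clim].
      destruct (Pow_x_infinity 2 ltac:(rewrite Rabs_pos_eq; lra) (Rabs (Re x))) as [N0 HN0].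
      exists N0. intros n Hn. specialize (HN0 n Hn). rewrite Rabs_pos_eq in HN0 by (apply pow_le; lra).
      apply B; [exact Hx|]. pose proof (pow_le 2 n ltac:(lra)). lra. }
    destruct (Lk k) as [L1 L2]. unfold f, M. eapply Rle_trans; [apply Cmod_triangle|].
    pose proof (G _ L1 (N1 k)). pose proof (G _ L2 (N2 k)). unfold Rdiv. lra. }
  (* The pairs k, - k - 1 with k < N cover the shifts -N..N-1; the symmetric sum has the extra term
     at z + N. *)
  assert (Lr : clim (fun n => 1 / (z + RtoC (INR n)) ^ 2) 0).
  { apply clim_0_Cmod with (e := fun n => (/ (d * d) * / INR (S n))%R).
    - exists 0%nat. intros n _. destruct (Lk n) as [L1 _]. specialize (PS n).
      rewrite Cmod_div by (apply Cpow_nz, N1). rewrite Cmod_1, Cmod_pow. cbn [pow]. rewrite Rmult_1_r.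
      assert (P1 : 1 <= INR (S n)) by (rewrite S_INR; pose proof (pos_INR n); lra).
      unfold Rdiv. rewrite Rmult_1_l, <- Rinv_mult. apply Rinv_le_contravar; [nra|].
      apply Rle_trans with ((d * INR (S n)) * (d * INR (S n)))%R; [|apply Rmult_le_compat; lra].
      replace (d * INR (S n) * (d * INR (S n)))%R with (d * d * (INR (S n) * INR (S n)))%R by ring.
      apply Rmult_le_compat_l; [nra|]. nra.
    - replace (Finite 0) with (Rbar_mult (/ (d * d))%R 0%R) by (simpl; f_equal; ring).
      apply is_lim_seq_scal_l.
      apply (is_lim_seq_incr_1 (fun n => / INR n)%R).
      replace (Finite 0) with (Rbar_inv p_infty) by reflexivity.
      apply is_lim_seq_inv; [apply is_lim_seq_INR|discriminate]. }
  pose proof (clim_plus _ _ _ _ (clim_scal (RtoC PI * RtoC PI) _ _ Lf) Lr) as H.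
  replace (RtoC PI * RtoC PI * csc2 z) with (RtoC PI * RtoC PI * csc2 z + 0) by ring.
  eapply clim_ext; [|exact H]. intros N. cbv beta.
  induction N as [|N IH].
  - rewrite zsum_0. simpl. unfold Cminus. replace (z + - 0) with (z + 0) by ring. ring.
  - rewrite zsum_S, <- IH. cbn [csum].
    rewrite opp_IZR, <- INR_IZR_INZ, RtoC_opp.
    replace (z - - RtoC (INR (S N))) with (z + RtoC (INR (S N))) by ring.
    replace (z - RtoC (INR (S N))) with (z - RtoC (INR N) - 1) by (rewrite S_INR, RtoC_plus; ring).
    unfold f. field. repeat split; auto.
Qed.

(** * The lattice sum of wp *)

Lemma PI_nz : RtoC PI <> 0.
Proof. intros F. apply RtoC_inj in F. pose proof PI_RGT_0. lra. Qed.

Lemma ec_eq_1 (u : C) : ec u = 1 -> exists k : Z, u = RtoC (IZR k).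
Proof.
  intros H. destruct u as [p r]. pose proof PI_RGT_0 as HP.
  assert (E : 2 * Ci * PI * (p, r) = ((- (2 * PI * r))%R, (2 * (PI * p))%R)).
  { unfold Ci, Cmult, RtoC; simpl. f_equal; ring. }
  unfold ec in H. rewrite E in H.
  assert (Hm := f_equal Cmod H). rewrite Cmod_cexp, Cmod_1, <- exp_0 in Hm. simpl in Hm.
  apply exp_inv in Hm. assert (Hr : r = 0%R) by nra. subst r.
  apply (f_equal Re) in H. unfold cexp in H. simpl in H.
  replace (- (2 * PI * 0))%R with 0%R in H by ring. rewrite exp_0, Rmult_1_l, cos_2a_sin in H.
  assert (Hs : sin (PI * p) = 0%R) by nra.
  destruct (sin_eq_0_0 _ Hs) as [k Hk]. exists k. unfold RtoC. f_equal. nra.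
Qed.

Lemma separated_ec (z : C) (d : R) : 0 < d -> separated z d -> ec z <> 1.
Proof.
  intros Hd Hs E. destruct (ec_eq_1 z E) as [k Hk]. specialize (Hs k).
  rewrite Hk, Cmod_self in Hs. pose proof (Rabs_pos (IZR k)). nra.
Qed.

Lemma zsum_ext (f g : Z -> C) (N : nat) : (forall m, f m = g m) -> zsum f N = zsum g N.
Proof. intros H. apply csum_ext. intros; apply H. Qed.

Lemma zsum_minus (f g : Z -> C) (N : nat) : zsum (fun m => f m - g m) N = zsum f N - zsum g N.
Proof. apply csum_minus. Qed.

Lemma zsum_scal (c : C) (f : Z -> C) (N : nat) : zsum (fun m => c * f m) N = c * zsum f N.
Proof. apply csum_scal. Qed.

Lemma csc2_half : csc2 (/ 2) = 1.
Proof. unfold csc2. rewrite ec_half. unfold koebe. field. Qed.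

Lemma separated_half : separated (/ 2) (/ 4).
Proof.
  intros k. assert (E : / 2 - RtoC (IZR k) = RtoC (/ 2 - IZR k)).
  { rewrite RtoC_minus, RtoC_inv by lra. reflexivity. }
  rewrite E, Cmod_R.
  assert (H : (k <= 0)%Z \/ (1 <= k)%Z) by lia. destruct H as [H|H]; apply IZR_le in H.
  - rewrite Rabs_left1, Rabs_pos_eq by lra. lra.
  - rewrite (Rabs_pos_eq (IZR k)), Rabs_left1 by lra. lra.
Qed.

(* Compares the expansion of 1 / sin^2 at 1/2, a sum over odd integers, with the full sum. *)
Lemma basel : clim (csum (fun k => 2 / (RtoC (INR (S k)) * RtoC (INR (S k))))) (PI * PI / 3).
Proof.
  set (f := fun k => 2 / (RtoC (INR (S k)) * RtoC (INR (S k)))).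
  assert (NS : forall k, RtoC (INR (S k)) <> 0).
  { intros k F. apply RtoC_inj in F. pose proof (lt_0_INR (S k) ltac:(lia)). lra. }
  assert (Hf : clim (csum f) (Ser f)).
  { apply Ser_correct with (M := fun k => (2 * / (INR (S k) * INR (S k)))%R).
    - intros k. unfold f. rewrite Cmod_div, Cmod_mult, !Cmod_R by (apply Cmult_neq_0; apply NS).
      rewrite !Rabs_pos_eq by (apply pos_INR || lra). apply Rle_refl.
    - apply rsummable_scal; [lra|apply rsummable_inv_sqr]. }
  pose proof (csc2_partial_fractions (/ 2) (/ 4) ltac:(lra) separated_half
    (separated_ec (/ 2) (/ 4) ltac:(lra) separated_half)) as H.
  rewrite csc2_half in H.
  (* For m from -N to N the odd numbers 2 m - 1 run from -2 N - 1 to 2 N - 1; the unpaired one at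
     the lower end is removed. *)
  assert (Hr : clim (fun N => 4 / (2 * RtoC (INR N) + 1) ^ 2) 0).
  { apply clim_0_Cmod with (e := fun N => (4 * / INR (S N))%R).
    - exists 0%nat. intros N _. pose proof (pos_INR N) as PN.
      replace (2 * RtoC (INR N) + 1) with (RtoC (2 * INR N + 1)) by (rewrite RtoC_plus, RtoC_mult; reflexivity).
      assert (NZ : RtoC (2 * INR N + 1) <> 0) by (intros F; apply RtoC_inj in F; lra).
      rewrite Cmod_div by (apply Cpow_nz, NZ). rewrite Cmod_pow, !Cmod_R, !Rabs_pos_eq by lra.
      apply Rmult_le_compat_l; [lra|]. rewrite S_INR. apply Rinv_le_contravar; [lra|]. simpl. nra.
    - replace (Finite 0) with (Rbar_mult 4%R 0%R) by (simpl; f_equal; ring).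
      apply is_lim_seq_scal_l. apply (is_lim_seq_incr_1 (fun n => / INR n)%R).
      replace (Finite 0) with (Rbar_inv p_infty) by reflexivity.
      apply is_lim_seq_inv; [apply is_lim_seq_INR|discriminate]. }
  pose proof (clim_minus _ _ _ _ H Hr) as H1.
  pose proof (clim_minus _ _ _ _ (clim_scal 4 _ _ (clim_double _ _ Hf)) Hf) as H2.
  (* An even denominator 2 j contributes 4 * 2 / (2 j)^2 = 2 / j^2, so the difference retains four
     times the terms with odd denominator. *)
  assert (E : PI * PI * 1 - 0 = 4 * Ser f - Ser f).
  { eapply clim_unique; [exact H1|]. eapply clim_ext; [|exact H2].
    intros N. cbv beta. induction N as [|N IH].
    - rewrite zsum_0. simpl. unfold Cdiv. field.
    - rewrite zsum_S. replace (2 * S N)%nat with (S (S (2 * N))) by lia. cbn [csum].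
      replace (4 * (csum f (2 * N) + f (2 * N)%nat + f (S (2 * N))) - (csum f N + f N)) with
        (4 * csum f (2 * N) - csum f N + (4 * f (2 * N)%nat + 4 * f (S (2 * N)) - f N)) by ring.
      rewrite IH. unfold f. rewrite opp_IZR, <- INR_IZR_INZ, RtoC_opp.
      pose proof (pos_INR N) as PN.
      replace (INR (S (S (2 * N)))) with (2 * INR (S N))%R
        by (rewrite !S_INR, mult_INR; simpl; ring).
      replace (INR (S (2 * N))) with (2 * INR N + 1)%R by (rewrite S_INR, mult_INR; simpl; ring).
      rewrite S_INR, !RtoC_plus, !RtoC_mult, !RtoC_plus.
      assert (Q : forall x : R, x <> 0%R -> RtoC x <> 0) by (intros x Hx F; apply RtoC_inj in F; auto).
      assert (N1 : 2 * RtoC (INR N) + 1 <> 0) by (rewrite <- RtoC_mult, <- RtoC_plus; apply Q; lra).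
      assert (N2 : RtoC (INR N) + 1 <> 0) by (rewrite <- RtoC_plus; apply Q; lra).
      assert (N3 : 2 * (RtoC (INR N) + 1) + 1 <> 0).
      { rewrite <- RtoC_plus, <- RtoC_mult, <- RtoC_plus; apply Q; lra. }
      assert (N4 : 1 - 2 * (RtoC (INR N) + 1) <> 0).
      { rewrite <- RtoC_plus, <- RtoC_mult, <- RtoC_minus; apply Q; lra. }
      assert (N5 : 1 - 2 * - (RtoC (INR N) + 1) <> 0).
      { rewrite <- RtoC_plus, <- RtoC_opp, <- RtoC_mult, <- RtoC_minus; apply Q; lra. }
      replace (/ 2 - (RtoC (INR N) + 1)) with ((1 - 2 * (RtoC (INR N) + 1)) / 2) by field.
      replace (/ 2 - - (RtoC (INR N) + 1)) with ((2 * (RtoC (INR N) + 1) + 1) / 2) by field.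
      replace (1 - 2 * (RtoC (INR N) + 1)) with (- (2 * RtoC (INR N) + 1)) by ring.
      field. repeat split; auto. }
  replace (PI * PI / 3) with ((PI * PI * 1 - 0) / 3) by field. rewrite E.
  replace ((4 * Ser f - Ser f) / 3) with (Ser f) by field. exact Hf.
Qed.

(** Left unsimplified so that it is convertible with the lattice point in [wp_term] at half-periods
    2 and 2 t. *)
Definition lat (t : C) (m n : Z) : C := 2 * 2 * RtoC (IZR m) + 2 * (2 * t) * RtoC (IZR n).

Definition distant (k : R) (x : C) (m n : Z) : Prop :=
  k * (1 + Rabs (IZR m)) <= Cmod x /\ k * (1 + Rabs (IZR n)) <= Cmod x.

Definition off_lattice (t z : C) (k : R) : Prop := forall m n, distant k (z - lat t m n) m n.

Lemma lattice_norm (t : C) : 0 < Im t -> exists k, 0 < k /\ forall p r : R,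
  k * Rabs p <= Cmod (RtoC p + RtoC r * t) /\ k * Rabs r <= Cmod (RtoC p + RtoC r * t).
Proof.
  intros Ht. set (v := Im t) in *. pose proof (Cmod_ge_0 t) as Hm.
  (* The imaginary part bounds |r| by |x| / v, and then |p| <= |x| + |r| |t|. *)
  set (D := (1 + Cmod t / v + / v)%R).
  assert (Hv : 0 < / v) by now apply Rinv_0_lt_compat.
  assert (Hq : 0 <= Cmod t / v) by (apply Rmult_le_pos; lra).
  assert (HD : 0 < D) by (unfold D; lra).
  exists (/ D)%R. split; [now apply Rinv_0_lt_compat|]. intros p r.
  set (x := RtoC p + RtoC r * t). pose proof (Cmod_ge_0 x) as Hx.
  assert (H1 : Rabs r <= Cmod x / v).
  { apply Rmult_le_reg_r with v; [exact Ht|]. unfold Rdiv. rewrite Rmult_assoc, Rinv_l, Rmult_1_r by lra.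
    pose proof (im_le_Cmod x) as H. unfold x in H. rewrite im_plus, im_RtoC, im_scal_l, Rplus_0_l in H.
    rewrite Rabs_mult in H. fold v in H. rewrite (Rabs_pos_eq v) in H by lra. exact H. }
  assert (H2 : Rabs p <= Cmod x + Rabs r * Cmod t).
  { pose proof (Cmod_triangle_minus x (RtoC r * t)) as H. unfold x in H at 1.
    replace (RtoC p + RtoC r * t - RtoC r * t) with (RtoC p) in H by ring.
    rewrite Cmod_mult, !Cmod_R in H. exact H. }
  assert (H3 : Rabs r * Cmod t <= Cmod x / v * Cmod t) by (apply Rmult_le_compat_r; lra).
  assert (K : forall s, s <= D * Cmod x -> / D * s <= Cmod x).
  { intros s Hs. apply Rmult_le_reg_l with D; [exact HD|]. rewrite <- Rmult_assoc, Rinv_r, Rmult_1_l by lra. exact Hs. }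
  unfold Rdiv in *. split; apply K; unfold D; nra.
Qed.

(** In the basis 1, t all these points have integer coordinates of the form 4 m, 1 - 4 m or 2 - 4 m.
    A nonzero one of them is at least 1 + |m| in size; where a coordinate vanishes, the other serves
    both indices. *)
Lemma lattice_distant (t : C) : 0 < Im t -> exists k, 0 < k /\
  (forall m n, (m, n) <> (0, 0)%Z -> distant k (lat t m n) m n) /\
  off_lattice t 1 k /\ off_lattice t 2 k /\ off_lattice t t k.
Proof.
  intros Ht. destruct (lattice_norm t Ht) as [k [Hk H]]. exists k. split; [exact Hk|].
  assert (A : forall i j : Z, (1 + Z.abs i <= Z.abs j)%Z -> 1 + Rabs (IZR i) <= Rabs (IZR j)).
  { intros i j Hij. rewrite <- !abs_IZR, <- (plus_IZR 1). now apply IZR_le. }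
  assert (G : forall (p r m n : Z) (x : C), x = RtoC (IZR p) + RtoC (IZR r) * t ->
    (1 + Z.abs m <= Z.abs p \/ 1 + Z.abs m <= Z.abs r)%Z ->
    (1 + Z.abs n <= Z.abs p \/ 1 + Z.abs n <= Z.abs r)%Z -> distant k x m n).
  { intros p r m n x -> Hm Hn. destruct (H (IZR p) (IZR r)) as [H1 H2].
    split.
    - destruct Hm as [Hm|Hm]; apply A in Hm;
        (eapply Rle_trans; [apply Rmult_le_compat_l; [lra|exact Hm]|assumption]).
    - destruct Hn as [Hn|Hn]; apply A in Hn;
        (eapply Rle_trans; [apply Rmult_le_compat_l; [lra|exact Hn]|assumption]). }
  split; [|split; [|split]].
  - intros m n Hmn. apply (G (4 * m)%Z (4 * n)%Z).
    + unfold lat. rewrite !mult_IZR, !RtoC_mult. ring.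
    + assert (m <> 0 \/ n <> 0)%Z by (destruct (Z.eq_dec m 0), (Z.eq_dec n 0); subst; auto). lia.
    + assert (m <> 0 \/ n <> 0)%Z by (destruct (Z.eq_dec m 0), (Z.eq_dec n 0); subst; auto). lia.
  - intros m n. apply (G (1 - 4 * m)%Z (- (4 * n))%Z); [|lia|lia].
    unfold lat. rewrite minus_IZR, opp_IZR, !mult_IZR, RtoC_minus, RtoC_opp, !RtoC_mult. ring.
  - intros m n. apply (G (2 - 4 * m)%Z (- (4 * n))%Z); [|lia|lia].
    unfold lat. rewrite minus_IZR, opp_IZR, !mult_IZR, RtoC_minus, RtoC_opp, !RtoC_mult. ring.
  - intros m n. apply (G (- (4 * m))%Z (1 - 4 * n)%Z); [|lia|lia].
    unfold lat. rewrite minus_IZR, opp_IZR, !mult_IZR, RtoC_minus, RtoC_opp, !RtoC_mult. ring.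
Qed.

Lemma distant_nz (k : R) (x : C) (m n : Z) : 0 < k -> distant k x m n -> x <> 0.
Proof.
  intros Hk [H _]. apply Cmod_gt_0. pose proof (Rabs_pos (IZR m)).
  eapply Rlt_le_trans; [|exact H]. apply Rmult_lt_0_compat; lra.
Qed.

(** The exponent 3/2 splits the cubic decay of [wp_term] evenly between the two indices, which makes
    the double sum converge with a product majorant. *)
Definition weight (m : Z) : R := / ((1 + Rabs (IZR m)) * sqrt (1 + Rabs (IZR m))).

Lemma distant_mult (k : R) (x : C) (m n : Z) : 0 < k -> distant k x m n ->
  k * (sqrt (1 + Rabs (IZR m)) * sqrt (1 + Rabs (IZR n))) <= Cmod x.
Proof.
  intros Hk [H1 H2]. pose proof (Rabs_pos (IZR m)). pose proof (Rabs_pos (IZR n)).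
  set (p := sqrt (1 + Rabs (IZR m))). set (r := sqrt (1 + Rabs (IZR n))).
  assert (Ep : (p * p = 1 + Rabs (IZR m))%R) by (apply sqrt_sqrt; lra).
  assert (Er : (r * r = 1 + Rabs (IZR n))%R) by (apply sqrt_sqrt; lra).
  rewrite <- Ep in H1. rewrite <- Er in H2.
  pose proof (Rle_0_sqr (p - r)) as S0. unfold Rsqr in S0.
  assert (k * (2 * (p * r)) <= k * (p * p + r * r)) by (apply Rmult_le_compat_l; lra). lra.
Qed.

Lemma wp_term_bound (t z : C) (k : R) (m n : Z) : 0 < k ->
  (forall m n, (m, n) <> (0, 0)%Z -> distant k (lat t m n) m n) -> off_lattice t z k ->
  Cmod (wp_term 2 (2 * t) z m n) <= 2 * Cmod z / (k * k * k) * (weight m * weight n).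
Proof.
  intros Hk Hl Hz. unfold wp_term. cbv zeta.
  change (2 * 2 * RtoC (IZR m) + 2 * (2 * t) * RtoC (IZR n)) with (lat t m n).
  pose proof (Rabs_pos (IZR m)) as Pm. pose proof (Rabs_pos (IZR n)) as Pn.
  unfold weight.
  set (p := sqrt (1 + Rabs (IZR m))). set (r := sqrt (1 + Rabs (IZR n))).
  assert (Ep : (p * p = 1 + Rabs (IZR m))%R) by (apply sqrt_sqrt; lra).
  assert (Er : (r * r = 1 + Rabs (IZR n))%R) by (apply sqrt_sqrt; lra).
  assert (Hp : 0 < p) by (apply sqrt_lt_R0; lra). assert (Hr : 0 < r) by (apply sqrt_lt_R0; lra).
  rewrite <- Ep, <- Er.
  assert (Hkkk : 0 < k * k * k) by (repeat apply Rmult_lt_0_compat; lra).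
  assert (Hw : 0 < p * p * p * (r * r * r)) by (repeat apply Rmult_lt_0_compat; lra).
  replace (2 * Cmod z / (k * k * k) * (/ (p * p * p) * / (r * r * r)))%R with
    (2 * Cmod z * / (k * k * k * (p * p * p * (r * r * r))))%R by (field; lra).
  assert (P0 : 0 < / (k * k * k * (p * p * p * (r * r * r)))).
  { apply Rinv_0_lt_compat. now apply Rmult_lt_0_compat. }
  pose proof (Cmod_ge_0 z) as Z0.
  destruct (Z.eqb m 0 && Z.eqb n 0)%bool eqn:E.
  { rewrite Cmod_0. apply Rmult_le_pos; lra. }
  assert (Hmn : (m, n) <> (0, 0)%Z).
  { intros F. injection F as -> ->. discriminate. }
  set (l := lat t m n). assert (Dl := Hl m n Hmn). fold l in Dl. assert (Dz := Hz m n). fold l in Dz.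
  pose proof (distant_mult _ _ _ _ Hk Dl) as Ml. pose proof (distant_mult _ _ _ _ Hk Dz) as Mz.
  fold p r in Ml, Mz. destruct Dl as [L1 L2], Dz as [Z1 Z2]. rewrite <- Ep in L1, Z1. rewrite <- Er in L2, Z2.
  assert (B1 : 0 < k * (p * p)) by (repeat apply Rmult_lt_0_compat; lra).
  assert (B2 : 0 < k * (r * r)) by (repeat apply Rmult_lt_0_compat; lra).
  assert (B3 : 0 < k * (p * r)) by (repeat apply Rmult_lt_0_compat; lra).
  assert (Nl : l <> 0) by (apply Cmod_gt_0; lra).
  assert (Nz : z - l <> 0) by (apply Cmod_gt_0; lra).
  assert (Pl : 0 < Cmod l) by now apply Cmod_gt_0.
  assert (Pz : 0 < Cmod (z - l)) by now apply Cmod_gt_0.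
  (* A factor z and three distances per term: one is bounded through m, one through n, and one
     through their geometric mean. *)
  replace (1 / (z - l) ^ 2 - 1 / l ^ 2) with
    (z * (/ (l * (z - l) * (z - l)) - / (l * l * (z - l)))) by (field; auto).
  rewrite Cmod_mult.
  replace (2 * Cmod z * / (k * k * k * (p * p * p * (r * r * r))))%R with
    (Cmod z * (/ (k * (p * p) * (k * (r * r)) * (k * (p * r))) + / (k * (p * p) * (k * (r * r)) * (k * (p * r)))))%R
    by (field; lra).
  apply Rmult_le_compat_l; [exact Z0|].
  eapply Rle_trans; [apply Cmod_triangle_minus|].
  rewrite !Cmod_inv, !Cmod_mult by (repeat apply Cmult_neq_0; auto).
  assert (Q : 0 < k * (p * p) * (k * (r * r)) * (k * (p * r))) by (repeat apply Rmult_lt_0_compat; lra).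
  assert (M3 : forall x1 x2 x3, k * (p * p) <= x1 -> k * (r * r) <= x2 -> k * (p * r) <= x3 ->
     k * (p * p) * (k * (r * r)) * (k * (p * r)) <= x1 * x2 * x3).
  { intros x1 x2 x3 X1 X2 X3. apply Rmult_le_compat; [|lra| |exact X3].
    - apply Rmult_le_pos; lra.
    - apply Rmult_le_compat; lra. }
  apply Rplus_le_compat; apply Rinv_le_contravar; auto.
Qed.

Lemma weight_sum : exists B, 0 <= B /\ forall (f : Z -> C) (c : R) (N : nat), 0 <= c ->
  (forall m, Cmod (f m) <= c * weight m) -> Cmod (zsum f N) <= c * B.
Proof.
  destruct rsummable_pow32 as [W0 [B HB]]. set (w := fun k => (/ (INR (S k) * sqrt (INR (S k))))%R) in *.
  assert (B0 : 0 <= B) by exact (HB 0%nat).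
  exists (2 * B)%R. split; [lra|]. intros f c N Hc Hf.
  assert (E : forall k : nat, weight (Z.of_nat k) = w k /\ weight (- Z.of_nat k) = w k).
  { intros k. unfold weight, w. rewrite opp_IZR, Rabs_Ropp, <- INR_IZR_INZ, Rabs_pos_eq by apply pos_INR.
    rewrite S_INR, Rplus_comm. auto. }
  rewrite zsum_csum. eapply Rle_trans; [apply Cmod_triangle|].
  assert (H1 : Cmod (csum (fun k => f (Z.of_nat (S k)) + f (- Z.of_nat (S k))%Z) N)
     <= rsum (fun k => (2 * c) * w (S k))%R N).
  { apply csum_Cmod. intros k _. eapply Rle_trans; [apply Cmod_triangle|].
    destruct (E (S k)) as [E1 E2].
    pose proof (Hf (Z.of_nat (S k))) as F1. pose proof (Hf (- Z.of_nat (S k))%Z) as F2.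
    rewrite E1 in F1. rewrite E2 in F2. lra. }
  rewrite rsum_scal in H1.
  pose proof (Hf 0%Z) as F0. change 0%Z with (Z.of_nat 0) in F0 at 2. rewrite (proj1 (E 0%nat)) in F0.
  assert (S1 : (w 0%nat + rsum (fun k => w (S k)) N = rsum w (S N))%R).
  { clear. induction N as [|N IH]; [simpl; lra|].
    change (rsum w (S (S N))) with (rsum w (S N) + w (S N))%R. rewrite <- IH. simpl. lra. }
  specialize (HB (S N)). rewrite <- S1 in HB. pose proof (W0 0%nat) as w0. fold (w 0%nat) in w0.
  assert (c * (w 0%nat + rsum (fun k => w (S k)) N) <= c * B) by (apply Rmult_le_compat_l; lra).
  assert (0 <= c * w 0%nat) by now apply Rmult_le_pos.
  lra.
Qed.

Lemma sum_n_csum (f : nat -> C) (n : nat) : sum_n f n = csum f (S n).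
Proof.
  induction n as [|n IH].
  - rewrite sum_O. simpl. ring.
  - rewrite sum_Sn, IH. reflexivity.
Qed.

Lemma csc2_even (u : C) : csc2 (- u) = csc2 u.
Proof.
  unfold csc2. rewrite ec_opp. assert (N := ec_nz u). set (w := ec u) in *. f_equal.
  unfold koebe. destruct (Ceq_dec (1 - w) 0) as [E|E].
  - replace w with (1 - (1 - w)) by ring. rewrite E.
    replace (1 - 0) with (RtoC 1) by ring. replace (/ 1) with (RtoC 1) by field. reflexivity.
  - assert (E' : w - 1 <> 0) by (intros F; apply E; replace (1 - w) with (- (w - 1)) by ring; rewrite F; ring).
    field. auto.
Qed.

Section Rows.

Variables (t z : C) (k : R).
Hypothesis Hk : 0 < k.
Hypothesis Hl : forall m n, (m, n) <> (0, 0)%Z -> distant k (lat t m n) m n.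
Hypothesis Hz : off_lattice t z k.

Definition row (n : Z) (N : nat) : C := zsum (fun m => wp_term 2 (2 * t) z m n) N.

Lemma scaled_separated (x : C) (n : Z) :
  (forall m, k * (1 + Rabs (IZR m)) <= Cmod (x - lat t m n)) ->
  separated (x / 4 - RtoC (IZR n) * t) (k / 4).
Proof.
  intros H m. specialize (H m).
  replace (x - lat t m n) with (4 * (x / 4 - RtoC (IZR n) * t - RtoC (IZR m))) in H by (unfold lat; field).
  rewrite Cmod_mult, Cmod_R, (Rabs_pos_eq 4) in H by lra. lra.
Qed.

(** Division by the period 4 puts the row over the integers; the convergence terms 1 / l^2 form a
    second such row, at - n t. *)
Lemma row_clim_n (n : Z) : n <> 0%Z ->
  clim (row n) (PI * PI / 16 * (csc2 (z / 4 - RtoC (IZR n) * t) - csc2 (RtoC (IZR n) * t))).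
Proof.
  intros Hn.
  assert (S1 : separated (z / 4 - RtoC (IZR n) * t) (k / 4)) by (apply scaled_separated; intros m; apply Hz).
  assert (S2 : separated (0 / 4 - RtoC (IZR n) * t) (k / 4)).
  { apply scaled_separated. intros m. replace (0 - lat t m n) with (- lat t m n) by ring.
    rewrite Cmod_opp. apply Hl. intros F. injection F as _ F. contradiction. }
  assert (K4 : 0 < k / 4) by lra.
  pose proof (csc2_partial_fractions _ _ K4 S1 (separated_ec _ _ K4 S1)) as H1.
  pose proof (csc2_partial_fractions _ _ K4 S2 (separated_ec _ _ K4 S2)) as H2.
  replace (0 / 4 - RtoC (IZR n) * t) with (- (RtoC (IZR n) * t)) in * by field.
  rewrite csc2_even in H2.
  pose proof (clim_scal (/ 16) _ _ (clim_minus _ _ _ _ H1 H2)) as H.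
  replace (PI * PI / 16 * (csc2 (z / 4 - RtoC (IZR n) * t) - csc2 (RtoC (IZR n) * t))) with
    (/ 16 * (PI * PI * csc2 (z / 4 - RtoC (IZR n) * t) - PI * PI * csc2 (RtoC (IZR n) * t))) by field.
  eapply clim_ext; [|exact H]. intros N. cbv beta. rewrite <- zsum_minus, <- zsum_scal.
  apply zsum_ext. intros m. unfold wp_term. cbv zeta.
  rewrite (proj2 (Z.eqb_neq n 0) Hn), Bool.andb_false_r.
  change (2 * 2 * RtoC (IZR m) + 2 * (2 * t) * RtoC (IZR n)) with (lat t m n).
  assert (N1 : z - lat t m n <> 0).
  { exact (distant_nz _ _ _ _ Hk (Hz m n)). }
  assert (N2 : lat t m n <> 0).
  { apply (distant_nz k _ m n Hk), Hl. intros F. injection F as _ F. contradiction. }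
  replace (z / 4 - RtoC (IZR n) * t - RtoC (IZR m)) with ((z - lat t m n) / 4) by (unfold lat; field).
  replace (- (RtoC (IZR n) * t) - RtoC (IZR m)) with (- lat t m n / 4) by (unfold lat; field).
  field. auto.
Qed.

(** This row lacks the origin: its pole part is stated separately in [wp], and the convergence terms
    over m <> 0 add up by [basel], whence the constant 1/3. *)
Lemma row_clim_0 : clim (row 0) (PI * PI / 16 * (csc2 (z / 4) - / 3) - 1 / z ^ 2).
Proof.
  assert (K4 : 0 < k / 4) by lra.
  assert (S1 : separated (z / 4 - RtoC (IZR 0) * t) (k / 4)) by (apply scaled_separated; intros m; apply Hz).
  replace (z / 4 - RtoC (IZR 0) * t) with (z / 4) in S1 by (simpl; field).
  pose proof (csc2_partial_fractions _ _ K4 S1 (separated_ec _ _ K4 S1)) as H1.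
  assert (Nm : forall m, z - RtoC (4 * IZR m) <> 0).
  { intros m. replace (RtoC (4 * IZR m)) with (lat t m 0) by (unfold lat; rewrite RtoC_mult; ring).
    exact (distant_nz _ _ _ _ Hk (Hz m 0%Z)). }
  assert (N0 : z <> 0).
  { replace z with (z - RtoC (4 * IZR 0)); [apply Nm|]. rewrite RtoC_mult. ring. }
  pose proof (clim_minus _ _ _ _
    (clim_minus _ _ _ _ (clim_scal (/ 16) _ _ H1) (clim_const (1 / z ^ 2))) (clim_scal (/ 16) _ _ basel)) as H.
  replace (PI * PI / 16 * (csc2 (z / 4) - / 3) - 1 / z ^ 2) with
    (/ 16 * (PI * PI * csc2 (z / 4)) - 1 / z ^ 2 - / 16 * (PI * PI / 3)) by (field; auto).
  eapply clim_ext; [|exact H]. intros N. cbv beta. unfold row. rewrite !zsum_csum.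
  replace (wp_term 2 (2 * t) z 0 0) with (RtoC 0) by reflexivity.
  replace (1 / (z / 4 - RtoC (IZR 0)) ^ 2) with (16 / z ^ 2).
  2:{ replace (z / 4 - RtoC (IZR 0)) with (z / 4) by (simpl; ring). field. auto. }
  rewrite Cplus_0_l.
  rewrite (csum_ext (fun k0 => wp_term 2 (2 * t) z (Z.of_nat (S k0)) 0 + wp_term 2 (2 * t) z (- Z.of_nat (S k0)) 0)
    (fun j => / 16 * (1 / (z / 4 - RtoC (IZR (Z.of_nat (S j)))) ^ 2 + 1 / (z / 4 - RtoC (IZR (- Z.of_nat (S j)))) ^ 2)
       - / 16 * (2 / (RtoC (INR (S j)) * RtoC (INR (S j)))))).
  - rewrite csum_minus, !csum_scal. field. auto.
  - intros j _. unfold wp_term. cbv zeta.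
    rewrite (proj2 (Z.eqb_neq (Z.of_nat (S j)) 0)), (proj2 (Z.eqb_neq (- Z.of_nat (S j)) 0)) by lia.
    simpl andb. cbv iota.
    pose proof (Nm (Z.of_nat (S j))) as M1. pose proof (Nm (- Z.of_nat (S j))%Z) as M2.
    rewrite RtoC_mult in M1, M2.
    rewrite opp_IZR, RtoC_opp in *. rewrite <- INR_IZR_INZ in *. set (x := RtoC (INR (S j))) in *.
    assert (Nx : x <> 0).
    { intros F. apply RtoC_inj in F. pose proof (lt_0_INR (S j) ltac:(lia)). lra. }
    replace (2 * 2 * x + 2 * (2 * t) * RtoC (IZR 0)) with (4 * x) by (simpl; ring).
    replace (2 * 2 * - x + 2 * (2 * t) * RtoC (IZR 0)) with (4 * - x) by (simpl; ring).
    replace (z / 4 - x) with ((z - 4 * x) / 4) by field.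
    replace (z / 4 - - x) with ((z - 4 * - x) / 4) by field.
    set (z1 := z - 4 * x) in *. set (z2 := z - 4 * - x) in *. field. auto.
Qed.

(** Each row is bounded by a multiple of [weight n] uniformly in its cut, so the limit along the
    squares may be taken row by row. *)
Theorem wp_csc2 (s : C) :
  clim (csum (fun j => csc2 (z / 4 - RtoC (INR (S j)) * t) + csc2 (z / 4 + RtoC (INR (S j)) * t)
     - 2 * csc2 (RtoC (INR (S j)) * t))) s ->
  wp z 2 (2 * t) = PI * PI / 16 * (csc2 (z / 4) - / 3 + s).
Proof.
  intros Hs. destruct weight_sum as [B [HB0 HB]].
  destruct rsummable_pow32 as [W0 WB].
  set (K := (2 * Cmod z / (k * k * k))%R).
  assert (K0 : 0 <= K).
  { unfold K. apply Rmult_le_pos; [pose proof (Cmod_ge_0 z); lra|].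
    left. apply Rinv_0_lt_compat. repeat apply Rmult_lt_0_compat; lra. }
  assert (Hrow : forall n N, Cmod (row n N) <= K * B * weight n).
  { intros n N. replace (K * B * weight n)%R with (K * weight n * B)%R by ring. apply HB.
    - apply Rmult_le_pos; [exact K0|]. unfold weight. left. apply Rinv_0_lt_compat.
      pose proof (Rabs_pos (IZR n)). apply Rmult_lt_0_compat; [lra|apply sqrt_lt_R0; lra].
    - intros m. pose proof (wp_term_bound t z k m n Hk Hl Hz) as H. fold K in H. lra. }
  set (w := fun k => (/ (INR (S k) * sqrt (INR (S k))))%R) in *.
  set (F := fun (N j : nat) => row (Z.of_nat (S j)) N + row (- Z.of_nat (S j)) N).
  set (f := fun j => PI * PI / 16 * (csc2 (z / 4 - RtoC (INR (S j)) * t) + csc2 (z / 4 + RtoC (INR (S j)) * t)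
     - 2 * csc2 (RtoC (INR (S j)) * t))).
  assert (Ef : Ser f = PI * PI / 16 * s).
  { apply Ser_unique. exact (Ser_scal _ _ _ Hs). }
  assert (T : clim (fun N => csum (F N) N) (Ser f)).
  { apply tannery with (M := fun j => (2 * (K * B) * w j)%R) (K := fun N => N).
    - apply rsummable_scal; [|split; assumption]. apply Rmult_le_pos; [lra|now apply Rmult_le_pos].
    - exists 0%nat. intros N j _ _. unfold F. eapply Rle_trans; [apply Cmod_triangle|].
      assert (Hw : forall n, Rabs (IZR n) = INR (S j) -> weight n <= w j).
      { intros n Hn. unfold weight, w. rewrite Hn. pose proof (lt_0_INR (S j) ltac:(lia)) as P.
        apply Rinv_le_contravar.
        - apply Rmult_lt_0_compat; [exact P|now apply sqrt_lt_R0].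
        - apply Rmult_le_compat; [lra|apply sqrt_pos|lra|apply sqrt_le_1_alt; lra]. }
      assert (KB : 0 <= K * B) by now apply Rmult_le_pos.
      pose proof (Hrow (Z.of_nat (S j)) N) as R1. pose proof (Hrow (- Z.of_nat (S j))%Z N) as R2.
      assert (A1 : K * B * weight (Z.of_nat (S j)) <= K * B * w j).
      { apply Rmult_le_compat_l; [exact KB|]. apply Hw. rewrite <- INR_IZR_INZ. apply Rabs_pos_eq, pos_INR. }
      assert (A2 : K * B * weight (- Z.of_nat (S j)) <= K * B * w j).
      { apply Rmult_le_compat_l; [exact KB|]. apply Hw. rewrite opp_IZR, Rabs_Ropp, <- INR_IZR_INZ.
        apply Rabs_pos_eq, pos_INR. }
      lra.
    - intros j. unfold F, f.
      pose proof (clim_plus _ _ _ _ (row_clim_n (Z.of_nat (S j)) ltac:(lia)) (row_clim_n (- Z.of_nat (S j)) ltac:(lia))) as H.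
      rewrite opp_IZR, <- INR_IZR_INZ, RtoC_opp in H.
      set (x := RtoC (INR (S j))) in *.
      replace (- x * t) with (- (x * t)) in H by ring. rewrite csc2_even in H.
      replace (z / 4 - - (x * t)) with (z / 4 + x * t) in H by ring.
      match type of H with clim _ ?r => match goal with |- clim _ ?r' => replace r' with r by field end end.
      exact H.
    - intros m. exists m. auto. }
  unfold wp. rewrite (clim_C_lim_seq _ (PI * PI / 16 * (csc2 (z / 4) - / 3) - 1 / z ^ 2 + Ser f)).
  - rewrite Ef. ring.
  - eapply clim_ext; [|exact (clim_plus _ _ _ _ row_clim_0 T)].
    intros N. cbv beta. unfold F.
    rewrite <- (zsum_csum (fun n => row n N)).
    (* In [wp] the index m along a row is the outer one; over a square the order can be
       exchanged. *)
    rewrite sum_n_csum. unfold zsum at 1, row, zsum. rewrite csum_swap.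
    apply csum_ext. intros i _. symmetry. apply sum_n_csum.
Qed.

End Rows.

(** * Values of wp in terms of al *)

(** This is [ec (t / 4)], the variable of the rows at z = t; shifting by one row multiplies by its
    fourth power. *)
Definition nome (t : C) : C := cexp (Ci * PI / 2 * t).

Lemma nome_lt_1 (t : C) : 0 < Im t -> Cmod (nome t) < 1.
Proof.
  intros Ht. unfold nome. rewrite Cmod_cexp, <- exp_0. apply exp_increasing.
  replace (Ci * PI / 2 * t) with (RtoC (PI / 2) * t * Ci) by (rewrite RtoC_div by lra; field).
  rewrite re_mult_Ci, im_scal_l. pose proof PI_RGT_0. nra.
Qed.

Lemma ec_nome (t : C) (n : nat) : ec (RtoC (INR n) * t) = nome t ^ (4 * n).
Proof.
  unfold ec, nome. rewrite <- cexp_pow, mult_INR. f_equal. rewrite RtoC_mult.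
  replace (INR 4) with 4%R by (simpl; ring). field.
Qed.

Lemma ec_nome_quarter (t : C) : ec (t / 4) = nome t.
Proof. unfold ec, nome. f_equal. field. Qed.

Lemma ec_quarter : ec (1 / 4) = Ci.
Proof. transitivity (cexp (Ci * PI / 2)); [unfold ec; f_equal; field|apply cexp_PI2]. Qed.

Lemma koebe_opp (w : C) : Cmod w < 1 -> koebe (- w) = 4 * koebe (w * w) - koebe w.
Proof. intros H. rewrite <- koebe_parity by exact H. ring. Qed.

Lemma csc2_minus (u v : C) : csc2 (u - v) = - (4) * koebe (ec v * / ec u).
Proof.
  rewrite <- csc2_even. unfold csc2. replace (- (u - v)) with (v + - u) by ring.
  now rewrite ec_plus, ec_opp.
Qed.

Lemma csc2_plus (u v : C) : csc2 (u + v) = - (4) * koebe (ec u * ec v).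
Proof. unfold csc2. now rewrite ec_plus. Qed.

Section Values.

Variable t : C.
Hypothesis Ht : 0 < Im t.

Let q := nome t.
Let Hq : Cmod q < 1 := nome_lt_1 t Ht.

Lemma Lam_pow_clim (n : nat) : clim (csum (fun j => koebe (q ^ (S n * S j)))) (Lam (q ^ S n)).
Proof.
  eapply clim_ext; [|exact (Lam_clim _ (Cmod_pow_lt_1 q n Hq))].
  intros N. apply csum_ext. intros j _. now rewrite Cpow_mult_r.
Qed.

(** Here [ec (1 / 4)] is [Ci]: the values of [koebe] at Ci w and - Ci w combine to one at - w^2,
    which a second use of parity reduces to w^2 and w^4. *)
Lemma wp_quarter :
  wp 1 2 (2 * t) = PI * PI / 16 * (5 / 3 + 8 * Lam (q ^ 4) + 16 * Lam (q ^ 8) - 64 * Lam (q ^ 16)).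
Proof.
  destruct (lattice_distant t Ht) as [k [Hk [Hl [H1 _]]]].
  rewrite (wp_csc2 t 1 k Hk Hl H1 (8 * Lam (q ^ 4) + 16 * Lam (q ^ 8) - 64 * Lam (q ^ 16))).
  - unfold csc2. rewrite ec_quarter. unfold koebe.
    replace ((1 - Ci) * (1 - Ci)) with (1 + Ci * Ci - 2 * Ci) by ring. rewrite Ci_sqr.
    replace (1 + - (1) - 2 * Ci) with (- (2 * Ci)) by ring. field. apply Ci_nz.
  - pose proof (clim_minus _ _ _ _ (clim_plus _ _ _ _ (clim_scal 8 _ _ (Lam_pow_clim 3)) (clim_scal 16 _ _ (Lam_pow_clim 7)))
      (clim_scal 64 _ _ (Lam_pow_clim 15))) as H.
    eapply clim_ext; [|exact H]. intros N. cbv beta. rewrite <- !csum_scal, <- csum_plus, <- csum_minus.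
    apply csum_ext. intros j _. rewrite csc2_minus, csc2_plus, ec_quarter. unfold csc2. rewrite ec_nome. fold q.
    set (w := q ^ (4 * S j)).
    assert (Hw : Cmod w < 1) by (unfold w; apply Cmod_pow_lt_1; exact Hq).
    replace (q ^ (8 * S j)) with (w * w) by (unfold w; rewrite <- Cpow_add_r; f_equal; lia).
    replace (q ^ (16 * S j)) with (w * w * (w * w)) by (unfold w; rewrite <- !Cpow_add_r; f_equal; lia).
    rewrite Ci_inv. replace (w * - Ci) with (- (Ci * w)) by ring.
    rewrite koebe_opp by (rewrite Cmod_mult, Cmod_Ci; lra).
    replace (Ci * w * (Ci * w)) with (Ci * Ci * (w * w)) by ring. rewrite Ci_sqr.
    replace (- (1) * (w * w)) with (- (w * w)) by ring.
    rewrite koebe_opp by now apply Cmod_sqr_lt. ring.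
Qed.

Lemma wp_half : wp 2 2 (2 * t) = PI * PI / 16 * (2 / 3 + 16 * Lam (q ^ 4) - 32 * Lam (q ^ 8)).
Proof.
  destruct (lattice_distant t Ht) as [k [Hk [Hl [_ [H2 _]]]]].
  rewrite (wp_csc2 t 2 k Hk Hl H2 (16 * Lam (q ^ 4) - 32 * Lam (q ^ 8))).
  - replace (2 / 4) with (/ 2) by field. rewrite csc2_half. field.
  - pose proof (clim_minus _ _ _ _ (clim_scal 16 _ _ (Lam_pow_clim 3)) (clim_scal 32 _ _ (Lam_pow_clim 7))) as H.
    eapply clim_ext; [|exact H]. intros N. cbv beta. rewrite <- !csum_scal, <- csum_minus.
    apply csum_ext. intros j _. replace (2 / 4) with (/ 2) by field.
    rewrite csc2_minus, csc2_plus, ec_half. unfold csc2. rewrite ec_nome. fold q.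
    set (w := q ^ (4 * S j)).
    assert (Hw : Cmod w < 1) by (unfold w; apply Cmod_pow_lt_1; exact Hq).
    replace (q ^ (8 * S j)) with (w * w) by (unfold w; rewrite <- Cpow_add_r; f_equal; lia).
    replace (w * / - (1)) with (- w) by field. replace (- (1) * w) with (- w) by ring.
    rewrite koebe_opp by exact Hw. ring.
Qed.

(** The rows contribute the powers 4 j - 1 and 4 j + 1 of q, and the row n = 0 contributes q itself:
    together all odd powers, whose sum is Lam q - Lam (q^2). *)
Lemma wp_tau :
  wp t 2 (2 * t) = PI * PI / 16 * (- (1 / 3) - 4 * (Lam q - Lam (q ^ 2)) + 8 * Lam (q ^ 4)).
Proof.
  destruct (lattice_distant t Ht) as [k [Hk [Hl [_ [_ H3]]]]].
  rewrite (wp_csc2 t t k Hk Hl H3 (- (4) * (Lam q - Lam (q ^ 2)) + 8 * Lam (q ^ 4) + 4 * koebe q)).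
  - unfold csc2. rewrite ec_nome_quarter. fold q. field.
  - pose proof (Lam_pow_clim 0) as H1. rewrite Cpow_1_r in H1.
    (* N pairs of rows and the central one reach the odd power 4 N + 1; the even powers up to 4 N
       are the first 2 N terms of Lam (q^2). *)
    assert (H1' : clim (fun N => csum (fun j => koebe (q ^ (1 * S j))) (S (4 * N))) (Lam q)).
    { apply (clim_subseq (csum (fun j => koebe (q ^ (1 * S j)))) _ (fun N => S (4 * N))); [|exact H1].
      intros m. exists m. intros; lia. }
    pose proof (clim_plus _ _ _ _ (clim_plus _ _ _ _ (clim_scal (- (4)) _ _ (clim_minus _ _ _ _ H1' (clim_double _ _ (Lam_pow_clim 1))))
       (clim_scal 8 _ _ (Lam_pow_clim 3))) (clim_const (4 * koebe q))) as H.
    eapply clim_ext; [|exact H]. intros N. cbv beta. induction N as [|N IH].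
    + change (S (4 * 0)) with 1%nat. change (2 * 0)%nat with 0%nat. cbn [csum].
      change (1 * 1)%nat with 1%nat. rewrite Cpow_1_r. ring.
    + replace (S (4 * S N)) with (S (S (S (S (S (4 * N)))))) by lia.
      replace (2 * S N)%nat with (S (S (2 * N))) by lia. cbn [csum] in *. rewrite <- IH.
      rewrite csc2_minus, csc2_plus. rewrite ec_nome_quarter. unfold csc2. rewrite ec_nome. fold q.
      assert (E1 : q ^ (4 * S N) * / q = q ^ (1 * S (S (S (4 * N))))).
      { replace (4 * S N)%nat with (S (1 * S (S (S (4 * N))))) by lia. rewrite Cpow_S. field. apply cexp_nz. }
      assert (E2 : q * q ^ (4 * S N) = q ^ (1 * S (S (S (S (S (4 * N))))))).
      { rewrite <- Cpow_S. f_equal. lia. }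
      rewrite E1, E2.
      replace (2 * S (2 * N))%nat with (1 * S (S (4 * N)))%nat by lia.
      replace (2 * S (S (2 * N)))%nat with (1 * S (S (S (S (4 * N)))))%nat by lia.
      replace (4 * S N)%nat with (1 * S (S (S (S (4 * N)))))%nat by lia.
      ring.
Qed.

(** Up to pi^2 / 16 the numerator is be (q^4)^2 = al (q^2) be (q^2). The denominator is -(al q^2 +
    be (q^2)^2) / 2, which the mean turns into - al q * al (q^2). *)
Theorem x_of_nome : x_of t = - ratio q.
Proof.
  assert (H2 := Cmod_pow_lt_1 q 1 Hq).
  pose proof (al_nz q Hq) as N1. pose proof (al_nz _ H2) as N2.
  assert (NP : PI * PI / 16 <> 0).
  { intros F. apply (Cmult_neq_0 _ _ PI_nz PI_nz). replace (RtoC PI * PI) with (PI * PI / 16 * 16) by field.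
    rewrite F. ring. }
  unfold x_of.
  assert (E1 : wp 1 2 (2 * t) - wp 2 2 (2 * t) = PI * PI / 16 * (al (q ^ 2) * be (q ^ 2))).
  { rewrite wp_quarter, wp_half, <- (be_sqr_arg _ H2), <- Cpow_mult_r. change (2 * 2)%nat with 4%nat.
    rewrite be_square by exact (Cmod_pow_lt_1 q 3 Hq).
    rewrite <- !Cpow_mult_r. change (4 * 2)%nat with 8%nat. change (4 * 4)%nat with 16%nat. field. }
  assert (E2 : wp t 2 (2 * t) - wp 2 2 (2 * t) = PI * PI / 16 * (- (al q * al (q ^ 2)))).
  { assert (E3 : al q * al (q ^ 2) = (al q * al q + be (q ^ 2) * be (q ^ 2)) / 2).
    { rewrite be_sqr_arg, al_sqr_arg by exact Hq. field. }
    rewrite E3, wp_tau, wp_half, al_square, be_square by assumption.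
    rewrite <- !Cpow_mult_r. change (2 * 2)%nat with 4%nat. change (2 * 4)%nat with 8%nat. field. }
  rewrite E1, E2. unfold ratio.
  assert (N3 : - (al q * al (q ^ 2)) <> 0).
  { intros F. apply (Cmult_neq_0 _ _ N1 N2). replace (al q * al (q ^ 2)) with (- - (al q * al (q ^ 2))) by ring.
    rewrite F. ring. }
  field. repeat split; auto using PI_nz.
Qed.

(** In terms of squares [wp_tau] is pi^2 / 192 times be^2 - 5 al^2, and be^2 / al^2 is the fourth
    power of the ratio. *)
Theorem wp_nome : wp t 2 (2 * t) = PI * PI / 192 * (al q * al q) * (x_of t ^ 4 - 5).
Proof.
  pose proof (al_nz q Hq) as N1.
  rewrite x_of_nome. replace ((- ratio q) ^ 4) with (ratio q * ratio q * (ratio q * ratio q)) by ring.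
  rewrite ratio_sqr by exact Hq.
  transitivity (PI * PI / 192 * (be q * be q - 5 * (al q * al q))); [|field; exact N1].
  rewrite wp_tau, al_square, be_square by exact Hq. field.
Qed.

End Values.

(** * The differential equation in x *)

Lemma nome_derive (t : C) : is_C_derive nome t (Ci * PI / 2 * nome t).
Proof.
  eapply C_derive_eq.
  - apply (C_derive_comp cexp (fun x => Ci * PI / 2 * x) t (nome t) (Ci * PI / 2 * 1)).
    + apply cexp_derive.
    + apply C_derive_scal, C_derive_id.
  - ring.
Qed.

Lemma nome_surjective (q : C) : q <> 0 -> Cmod q < 1 -> exists t, 0 < Im t /\ nome t = q.
Proof.
  intros Nq Hq. destruct (cexp_surjective q Nq) as [u Hu].
  assert (NP := PI_nz). pose proof PI_RGT_0 as HP.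
  exists (u / (Ci * PI / 2)). split.
  - rewrite <- Hu, Cmod_cexp, <- exp_0 in Hq. apply exp_lt_inv in Hq.
    replace (u / (Ci * PI / 2)) with (RtoC (- 2 / PI) * (u * Ci)).
    + rewrite im_scal_l. replace (Im (u * Ci)) with (Re u) by (unfold Im, Re, Ci; simpl; ring).
      replace (- 2 / PI * Re u)%R with (2 / PI * - Re u)%R by (field; lra).
      apply Rmult_lt_0_compat; [apply Rdiv_lt_0_compat; lra|lra].
    + replace (u / (Ci * PI / 2)) with (2 / PI * u * / Ci) by (field; auto using Ci_nz).
      rewrite Ci_inv, RtoC_div by lra. field. exact NP.
  - unfold nome. rewrite <- Hu. f_equal. field. split; auto using Ci_nz.
Qed.

Lemma regular_x5 (x : C) : regular_point x -> x ^ 5 - x <> 0.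
Proof.
  intros [N0 [N1 [N2 [N3 N4]]]].
  assert (E : x ^ 5 - x = x * ((x - 1) * (x + 1)) * ((x - Ci) * (x + Ci))).
  { replace ((x - Ci) * (x + Ci)) with (x * x - Ci * Ci) by ring. rewrite Ci_sqr. ring. }
  assert (A : forall p r : C, p <> - r -> p + r <> 0).
  { intros p r H F. apply H. replace p with (p + r - r) by ring. rewrite F. ring. }
  rewrite E. repeat apply Cmult_neq_0; auto using Cminus_eq_contra.
Qed.

Lemma regular_opp (x : C) : regular_point x -> regular_point (- x).
Proof.
  intros [N0 [N1 [N2 [N3 N4]]]].
  assert (A : forall r : C, x <> - r -> - x <> r).
  { intros r H F. apply H. rewrite <- F. ring. }
  assert (A' : forall r : C, x <> r -> - x <> - r).
  { intros r H F. apply H. replace x with (- - x) by ring. rewrite F. ring. }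
  repeat split; auto. intros F. apply N0. replace x with (- - x) by ring. rewrite F. ring.
Qed.

Theorem inverse_branch_exists (x0 : C) : regular_point x0 ->
  exists (U : C -> Prop) (tau : C -> C), open U /\ U x0 /\ inverse_branch U tau.
Proof.
  intros Hx. destruct (ratio_surjective _ (regular_opp _ Hx)) as [q [Nq [Hq Ey]]].
  destruct (nome_surjective q Nq Hq) as [t [Ht Et]].
  assert (NP := PI_nz).
  set (f := fun s => - ratio (nome s)).
  set (f1 := fun s => - (1) * (ratio1 (nome s) * (Ci * PI / 2 * nome s))).
  (* A disc of radius [Im t] about t stays in the upper half-plane. *)
  assert (Hup : forall s, Cmod (s - t) < Im t -> 0 < Im s).
  { intros s Hs. pose proof (im_le_Cmod (s - t)) as H. unfold Cminus in H. rewrite im_plus, im_opp in H.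
    pose proof (Rle_abs (- (Im s + - Im t))) as H'. rewrite Rabs_Ropp in H'. unfold Cminus in Hs. lra. }
  assert (Df : forall s, 0 < Im s -> is_C_derive f s (f1 s)).
  { intros s Hs. apply (C_derive_comp (fun w => - w) (fun s => ratio (nome s))); [apply opp_derive|].
    apply (C_derive_comp ratio nome); [apply ratio_derive; now apply nome_lt_1|apply nome_derive]. }
  assert (Dy1 : exists l, is_C_derive f1 t l).
  { destruct (ratio1_holomorphic (nome t) (nome_lt_1 t Ht)) as [l Hl]. eexists.
    exact (C_derive_scal _ _ _ _ (C_derive_mult _ _ _ _ _
      (C_derive_comp ratio1 nome _ _ _ Hl (nome_derive t))
      (C_derive_scal (Ci * PI / 2) _ _ _ (nome_derive t)))). }
  (* By [ratio1_eq] the derivative is a nonzero multiple of al^2 (x0^5 - x0), so regularity of x0 is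
     exactly what local invertibility uses. *)
  assert (N1 : f1 t <> 0).
  { unfold f1. rewrite Et.
    replace (- (1) * (ratio1 q * (Ci * PI / 2 * q))) with (- (Ci * PI / 2) * (q * ratio1 q)) by ring.
    rewrite ratio1_eq, Ey by exact Hq. pose proof (regular_x5 x0 Hx) as N5. pose proof (al_nz q Hq) as Na.
    replace (- (Ci * PI / 2) * (- (- x0 * (al q * al q) * (1 - (- x0) ^ 4)) / 4)) with
      (Ci * (PI * (al q * (al q * ((x0 ^ 5 - x0) * / 8))))) by field.
    repeat apply Cmult_neq_0; auto using Ci_nz. intros F.
    assert (G : 8 * / 8 = RtoC 1) by field. rewrite F in G. apply C1_nz. rewrite <- G. ring. }
  destruct Dy1 as [l Dy1].
  destruct (inverse_function f f1 t (Im t) Ht (fun s Hs => Df s (Hup s Hs)) N1 (C_derive_cont f1 t l Dy1))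
    as [eta [g [He Hg]]].
  assert (Ef : f t = x0) by (unfold f; rewrite Et, Ey; ring). rewrite Ef in Hg.
  exists (fun x => Cmod (x - x0) < eta), g. split; [apply open_disc_at|]. split.
  - rewrite Cmod_self. exact He.
  - split.
    + intros x Hxe. destruct (Hg x Hxe) as [_ [_ D]]. eexists. exact D.
    + intros x Hxe. destruct (Hg x Hxe) as [G1 [G2 _]]. split; [now apply Hup|].
      rewrite x_of_nome by now apply Hup. exact G2.
Qed.

(** Composes f with a local inverse of z^2 at a root s of f x0. Its values stay within |s| of s and
    therefore avoid 0. *)
Lemma holomorphic_sqrt (U : C -> Prop) (f : C -> C) (x0 : C) :
  open U -> U x0 -> holomorphic_on U f -> f x0 <> 0 ->
  exists (V : C -> Prop) (r : C -> C), open V /\ V x0 /\ (forall x, V x -> U x) /\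
    holomorphic_on V r /\ forall x, V x -> r x <> 0 /\ r x * r x = f x.
Proof.
  intros HU Hx Hf N. destruct (C_sqrt_exists (f x0)) as [s [Es _]].
  assert (Ns : s <> 0) by (intros ->; apply N; rewrite <- Es; ring).
  destruct (inverse_function (fun z => z ^ 2) (fun z => 2 * z) s (Cmod s)) as [eta [g [He Hg]]].
  - now apply Cmod_gt_0.
  - intros z _. apply sqr_derive.
  - apply Cmult_neq_0; [apply C2_nz|exact Ns].
  - apply (C_derive_cont (fun z => 2 * z) s (2 * 1)). apply C_derive_scal, C_derive_id.
  - replace (s ^ 2) with (f x0) in Hg by (rewrite <- Es; ring).
    exists (fun x => U x /\ Cmod (f x - f x0) < eta), (fun x => g (f x)).
    split; [|split; [|split; [|split]]].
    + apply open_intro. intros x [Ux Dx].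
      destruct (open_disc U x HU Ux) as [d1 [D1 H1]]. destruct (Hf x Ux) as [l Hl].
      destruct (C_derive_cont f x l Hl (eta - Cmod (f x - f x0))%R) as [d2 [D2 H2]]; [lra|].
      exists (Rmin d1 d2). split; [now apply Rmin_glb_lt|]. intros w Hw. split.
      * apply H1. eapply Rlt_le_trans; [exact Hw|apply Rmin_l].
      * specialize (H2 w (Rlt_le_trans _ _ _ Hw (Rmin_r _ _))).
        pose proof (Cmod_triangle (f w - f x) (f x - f x0)) as T.
        replace (f w - f x + (f x - f x0)) with (f w - f x0) in T by ring. lra.
    + split; [exact Hx|]. rewrite Cmod_self. exact He.
    + now intros x [Ux _].
    + intros x [Ux Dx]. destruct (Hf x Ux) as [l Hl]. destruct (Hg _ Dx) as [_ [_ D]].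
      eexists. exact (C_derive_comp g f x _ _ D Hl).
    + intros x [Ux Dx]. destruct (Hg _ Dx) as [G1 [G2 _]]. split.
      * intros F. rewrite F in G1. replace (0 - s) with (- s) in G1 by ring. rewrite Cmod_opp in G1. lra.
      * rewrite <- G2 at 3. ring.
Qed.

Section Branch.

Variables (U : C -> Prop) (tau : C -> C).
Hypothesis HU : open U.
Hypothesis Hreg : forall x, U x -> regular_point x.
Hypothesis Htau : inverse_branch U tau.

Definition al_tau (x : C) : C := al (nome (tau x)).
Definition dal_tau (x : C) : C := dal (nome (tau x)).
(** The product of tau' = 8 / (i pi al^2 (x^5 - x)) and [Ssq]. *)
Definition kappa : C := PI / (24 * Ci).
(* [Ssq] is the square of the prefactor, and [tau' = kappa / Ssq]. *)
Definition Ssq (x : C) : C := PI * PI / 192 * (al_tau x * al_tau x * (x ^ 5 - x)).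
Definition Ssq1 (x : C) : C := PI * PI / 192 * (8 * dal_tau x + al_tau x * al_tau x * (5 * x ^ 4 - 1)).
Definition dal_tau1 (x : C) : C :=
  (dal_tau x * dal_tau x + x ^ 4 * (al_tau x * al_tau x) * (al_tau x * al_tau x) * (1 - x ^ 4) / 4) * (4 / (al_tau x * al_tau x * (x ^ 5 - x))).
Definition Ssq2 (x : C) : C :=
  PI * PI / 192 * (8 * dal_tau1 x + 8 * dal_tau x / (x ^ 5 - x) * (5 * x ^ 4 - 1) + al_tau x * al_tau x * (20 * x ^ 3)).
Definition pot (x : C) : C := - (1 / 4) * ((x ^ 8 + 14 * x ^ 4 + 1) / (x ^ 5 - x) ^ 2).

Lemma tau_upper (x : C) : U x -> 0 < Im (tau x).
Proof. intros Hx. apply Htau. exact Hx. Qed.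

Lemma nome_tau_lt_1 (x : C) : U x -> Cmod (nome (tau x)) < 1.
Proof. intros Hx. apply nome_lt_1. now apply tau_upper. Qed.

Lemma ratio_nome_tau (x : C) : U x -> ratio (nome (tau x)) = - x.
Proof.
  intros Hx. pose proof (x_of_nome (tau x) (tau_upper x Hx)) as H.
  rewrite (proj2 (proj2 Htau x Hx)) in H.
  transitivity (- - ratio (nome (tau x))); [ring|now rewrite <- H].
Qed.

Lemma al_tau_nz (x : C) : U x -> al_tau x <> 0.
Proof. intros Hx. apply al_nz. now apply nome_tau_lt_1. Qed.

Lemma x5_nz (x : C) : U x -> x ^ 5 - x <> 0.
Proof. intros Hx. apply regular_x5. auto. Qed.

Lemma PI2_nz : PI * PI / 192 <> 0.
Proof.
  intros F. apply (Cmult_neq_0 _ _ PI_nz PI_nz). replace (RtoC PI * PI) with (PI * PI / 192 * 192) by field.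
  rewrite F. ring.
Qed.

Lemma Ssq_nz (x : C) : U x -> Ssq x <> 0.
Proof.
  intros Hx. pose proof (al_tau_nz x Hx). pose proof (x5_nz x Hx).
  unfold Ssq. apply Cmult_neq_0; [exact PI2_nz|]. now repeat apply Cmult_neq_0.
Qed.

Lemma kappa_nz : kappa <> 0.
Proof.
  unfold kappa. intros F. apply PI_nz. replace (RtoC PI) with (PI / (24 * Ci) * (24 * Ci)) by (field; apply Ci_nz).
  rewrite F. ring.
Qed.

(** An arbitrary branch is only known to be holomorphic, so its derivative is found by
    differentiating ratio (nome (tau x)) = - x. *)
Lemma tau_derive_aux (x : C) : U x -> exists l,
  is_C_derive tau x l /\ l * (Ci * PI / 2) = 4 / (al_tau x * al_tau x * (x ^ 5 - x)).
Proof.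
  intros Hx. destruct (proj1 Htau x Hx) as [l Hl]. exists l. split; [exact Hl|].
  pose proof (nome_tau_lt_1 x Hx) as Hq. pose proof (al_tau_nz x Hx) as NA. pose proof (x5_nz x Hx) as N5.
  set (q := nome (tau x)) in *.
  assert (E : ratio1 q * (Ci * PI / 2 * q * l) = - (1)).
  { apply C_derive_unique with (f := fun w => ratio (nome (tau w))) (z := x).
    - exact (C_derive_comp ratio (fun w => nome (tau w)) x _ _ (ratio_derive q Hq)
        (C_derive_comp nome tau x _ _ (nome_derive (tau x)) Hl)).
    - apply C_derive_ext_open with (U := U) (f := fun w => - w); auto.
      + intros w Hw. symmetry. now apply ratio_nome_tau.
      + apply opp_derive. }
  replace (ratio1 q * (Ci * PI / 2 * q * l)) with (q * ratio1 q * (l * (Ci * PI / 2))) in E by ring.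
  rewrite ratio1_eq in E by exact Hq. unfold q in E at 1 4. rewrite ratio_nome_tau in E by exact Hx.
  change (al q) with (al_tau x) in E.
  replace (- (- x * (al_tau x * al_tau x) * (1 - (- x) ^ 4)) / 4) with (- (al_tau x * al_tau x * (x ^ 5 - x)) / 4) in E by field.
  replace (l * (Ci * PI / 2)) with
    (- (al_tau x * al_tau x * (x ^ 5 - x)) / 4 * (l * (Ci * PI / 2)) * (- (4) / (al_tau x * al_tau x * (x ^ 5 - x)))) by (field; auto).
  rewrite E. field. auto.
Qed.

Lemma tau_derive (x : C) : U x -> is_C_derive tau x (kappa / Ssq x).
Proof.
  intros Hx. destruct (tau_derive_aux x Hx) as [l [Hl E]].
  pose proof (al_tau_nz x Hx) as NA. pose proof (x5_nz x Hx) as N5. pose proof PI_nz as NP. pose proof Ci_nz as NC.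
  apply C_derive_eq with (1 := Hl).
  replace l with (l * (Ci * PI / 2) / (Ci * PI / 2)) by (field; auto). rewrite E.
  unfold kappa, Ssq. field. auto.
Qed.

Lemma nome_tau_derive (x : C) : U x ->
  is_C_derive (fun w => nome (tau w)) x (nome (tau x) * (4 / (al_tau x * al_tau x * (x ^ 5 - x)))).
Proof.
  intros Hx. destruct (tau_derive_aux x Hx) as [l [Hl E]].
  eapply C_derive_eq; [exact (C_derive_comp nome tau x _ _ (nome_derive (tau x)) Hl)|].
  rewrite <- E. ring.
Qed.

Lemma al_tau_derive (x : C) : U x -> is_C_derive al_tau x (4 * dal_tau x / (al_tau x * (x ^ 5 - x))).
Proof.
  intros Hx. pose proof (nome_tau_lt_1 x Hx) as Hq.
  pose proof (al_tau_nz x Hx) as NA. pose proof (x5_nz x Hx) as N5.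
  eapply C_derive_eq.
  - exact (C_derive_comp al (fun w => nome (tau w)) x _ _ (al_derive _ Hq) (nome_tau_derive x Hx)).
  - rewrite Cmult_assoc, (Cmult_comm (al1 _)), al1_dal by exact Hq.
    change (dal (nome (tau x))) with (dal_tau x). change (al (nome (tau x))) with (al_tau x). field. auto.
Qed.

Lemma dal_tau_derive (x : C) : U x -> is_C_derive dal_tau x (dal_tau1 x).
Proof.
  intros Hx. pose proof (nome_tau_lt_1 x Hx) as Hq. pose proof (al_tau_nz x Hx) as NA.
  (* The square of the ratio is be / al, and the ratio is - x along the branch. This removes be from
     the Riccati equation. *)
  assert (Eb : be (nome (tau x)) = x * x * al_tau x).
  { pose proof (ratio_sqr _ Hq) as E. rewrite ratio_nome_tau in E by exact Hx.
    change (al (nome (tau x))) with (al_tau x) in E.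
    replace (x * x * al_tau x) with (- x * - x * al_tau x) by ring. rewrite E. field. exact NA. }
  eapply C_derive_eq.
  - exact (C_derive_comp dal (fun w => nome (tau w)) x _ _ (dal_derive _ Hq) (nome_tau_derive x Hx)).
  - rewrite Cmult_assoc, (Cmult_comm (dal1 _)), dal1_eq, Eb by exact Hq.
    change (dal (nome (tau x))) with (dal_tau x). change (al (nome (tau x))) with (al_tau x). unfold dal_tau1.
    f_equal. field.
Qed.

Lemma pow_derive (n : nat) (x c : C) : RtoC (INR n) * x ^ pred n = c -> is_C_derive (fun w => w ^ n) x c.
Proof. intros <-. apply C_derive_pow. Qed.

Lemma Ssq_derive (x : C) : U x -> is_C_derive Ssq x (Ssq1 x).
Proof.
  intros Hx. pose proof (al_tau_nz x Hx) as NA. pose proof (x5_nz x Hx) as N5.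
  pose proof (al_tau_derive x Hx) as DA.
  assert (D5 : is_C_derive (fun w => w ^ 5) x (5 * x ^ 4)).
  { apply pow_derive. replace (INR 5) with 5%R by (simpl; ring). reflexivity. }
  eapply C_derive_eq.
  - exact (C_derive_scal _ _ _ _ (C_derive_mult _ _ _ _ _ (C_derive_mult _ _ _ _ _ DA DA)
      (C_derive_minus _ _ _ _ _ D5 (C_derive_id x)))).
  - unfold Ssq1. field. auto.
Qed.

Lemma Ssq1_derive (x : C) : U x -> is_C_derive Ssq1 x (Ssq2 x).
Proof.
  intros Hx. pose proof (al_tau_nz x Hx) as NA. pose proof (x5_nz x Hx) as N5.
  pose proof (al_tau_derive x Hx) as DA. pose proof (dal_tau_derive x Hx) as Da.
  assert (D4 : is_C_derive (fun w => w ^ 4) x (4 * x ^ 3)).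
  { apply pow_derive. replace (INR 4) with 4%R by (simpl; ring). reflexivity. }
  eapply C_derive_eq.
  - exact (C_derive_scal _ _ _ _ (C_derive_plus _ _ _ _ _ (C_derive_scal 8 _ _ _ Da)
      (C_derive_mult _ _ _ _ _ (C_derive_mult _ _ _ _ _ DA DA)
        (C_derive_minus _ _ _ _ _ (C_derive_scal 5 _ _ _ D4) (C_derive_const 1 x))))).
  - unfold Ssq2. field. auto.
Qed.

(* For R = S^2 the equation S'' = Q S reads 2 R R'' - R'^2 = 4 Q R^2. *)
Lemma Ssq_equation (x : C) : U x -> 2 * Ssq x * Ssq2 x - Ssq1 x * Ssq1 x = 4 * pot x * (Ssq x * Ssq x).
Proof.
  intros Hx. pose proof (al_tau_nz x Hx) as NA. pose proof (x5_nz x Hx) as N5.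
  unfold Ssq, Ssq1, Ssq2, pot, dal_tau1. field. auto.
Qed.

Lemma wp_tau_x (x : C) : U x ->
  wp (tau x) 2 (2 * tau x) = PI * PI / 192 * (al_tau x * al_tau x) * (x ^ 4 - 5).
Proof.
  intros Hx. rewrite wp_nome by now apply tau_upper. rewrite (proj2 (proj2 Htau x Hx)). reflexivity.
Qed.

(** S is a root of [Ssq], which has no zero, so it exists also around points with x^4 = 5. Away from
    these, r1 is a root of the first quotient, and S / r1 squares to [wp] by [wp_tau_x]. *)
Theorem prefactor_exists (x0 : C) : U x0 ->
  exists (V : C -> Prop) (S : C -> C), open V /\ V x0 /\ (forall x, V x -> U x) /\ prefactor_branch V tau S.
Proof.
  intros Hx0.
  destruct (holomorphic_sqrt U Ssq x0 HU Hx0) as [V [S [OV [Vx0 [VU [HS KS]]]]]].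
  { intros x Hx. eexists. exact (Ssq_derive x Hx). }
  { now apply Ssq_nz. }
  exists V, S. split; [exact OV|]. split; [exact Vx0|]. split; [exact VU|]. split; [exact HS|].
  intros x1 V1 N1.
  set (V2 := fun x => V x /\ x ^ 4 - 5 <> 0).
  assert (D4 : forall x, is_C_derive (fun w => w ^ 4) x (4 * x ^ 3)).
  { intros x. apply pow_derive. replace (INR 4) with 4%R by (simpl; ring). reflexivity. }
  assert (D5 : forall x, is_C_derive (fun w => w ^ 5) x (5 * x ^ 4)).
  { intros x. apply pow_derive. replace (INR 5) with 5%R by (simpl; ring). reflexivity. }
  assert (DD : forall x, is_C_derive (fun w => w ^ 4 - 5) x (4 * x ^ 3 - 0)).
  { intros x. exact (C_derive_minus _ _ _ _ _ (D4 x) (C_derive_const 5 x)). }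
  assert (OV2 : open V2).
  { apply open_intro. intros x [Vx Nx]. destruct (open_disc V x OV Vx) as [d1 [P1 H1]].
    destruct (C_derive_cont _ _ _ (DD x) (Cmod (x ^ 4 - 5))) as [d2 [P2 H2]]; [now apply Cmod_gt_0|].
    exists (Rmin d1 d2). split; [now apply Rmin_glb_lt|]. intros w Hw. split.
    - apply H1. eapply Rlt_le_trans; [exact Hw|apply Rmin_l].
    - intros F. specialize (H2 w (Rlt_le_trans _ _ _ Hw (Rmin_r _ _))). cbv beta in H2. rewrite F in H2.
      replace (0 - (x ^ 4 - 5)) with (- (x ^ 4 - 5)) in H2 by ring. rewrite Cmod_opp in H2. lra. }
  assert (N1' : x1 ^ 4 - 5 <> 0) by now apply Cminus_eq_contra.
  assert (Nx5 : x1 ^ 5 - x1 <> 0) by (apply x5_nz; auto).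
  destruct (holomorphic_sqrt V2 (fun x => (x ^ 5 - x) / (x ^ 4 - 5)) x1 OV2) as [W [r1 [OW [Wx1 [WV [Hr1 Kr1]]]]]].
  { split; assumption. }
  { intros x [_ Nx]. eexists.
    exact (C_derive_div _ _ _ _ _ (C_derive_minus _ _ _ _ _ (D5 x) (C_derive_id x)) (DD x) Nx). }
  { intros F. apply Nx5. replace (x1 ^ 5 - x1) with ((x1 ^ 5 - x1) / (x1 ^ 4 - 5) * (x1 ^ 4 - 5)) by (field; auto).
    rewrite F. ring. }
  exists W, r1, (fun x => S x / r1 x). split; [exact OW|]. split; [exact Wx1|]. split; [|split; [|split]].
  - intros x Wx. destruct (WV x Wx) as [Vx Nx]. split; [exact Vx|]. intros F. apply Nx. rewrite F. ring.
  - split; [exact Hr1|]. intros x Wx. rewrite <- (proj2 (Kr1 x Wx)). ring.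
  - split.
    + intros x Wx. destruct (WV x Wx) as [Vx Nx]. destruct (HS x Vx) as [l1 D1]. destruct (Hr1 x Wx) as [l2 D2].
      eexists. exact (C_derive_div _ _ _ _ _ D1 D2 (proj1 (Kr1 x Wx))).
    + intros x Wx. destruct (WV x Wx) as [Vx Nx]. destruct (Kr1 x Wx) as [Nr Er].
      rewrite wp_tau_x by auto. pose proof (x5_nz x (VU x Vx)) as N5.
      replace ((S x / r1 x) ^ 2) with (S x * S x / (r1 x * r1 x)) by (field; exact Nr).
      rewrite Er, (proj2 (KS x Vx)). unfold Ssq. field. auto.
  - intros x Wx. destruct (Kr1 x Wx) as [Nr _]. field. exact Nr.
Qed.

Section Prefactor.

Variable S : C -> C.
Hypothesis HS : prefactor_branch U tau S.

Lemma S_sqr_generic (x : C) : U x -> x ^ 4 <> 5 -> S x * S x = Ssq x.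
Proof.
  intros Hx Nx. destruct (proj2 HS x Hx Nx) as [V [r1 [r2 [_ [Vx [_ [[_ H1] [[_ H2] H3]]]]]]]].
  rewrite (H3 x Vx). replace (r1 x * r2 x * (r1 x * r2 x)) with (r1 x ^ 2 * r2 x ^ 2) by ring.
  rewrite (H1 x Vx), (H2 x Vx), wp_tau_x by exact Hx. unfold Ssq. field. now apply Cminus_eq_contra.
Qed.

(* At the points with x^4 = 5 the identity follows by continuity. *)
Lemma S_sqr (x : C) : U x -> S x * S x = Ssq x.
Proof.
  intros Hx. destruct (Ceq_dec (x ^ 4) 5) as [E|N]; [|now apply S_sqr_generic].
  assert (Nx : x <> 0).
  { intros ->. assert (F : RtoC 0 = 5) by (rewrite <- E; ring). apply RtoC_inj in F. lra. }
  destruct (proj1 HS x Hx) as [l Hl].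
  pose proof (C_derive_minus _ _ _ _ _ (C_derive_mult _ _ _ _ _ Hl Hl) (Ssq_derive x Hx)) as D.
  assert (D4 : is_C_derive (fun w => w ^ 4) x (4 * x ^ 3)).
  { apply pow_derive. replace (INR 4) with 4%R by (simpl; ring). reflexivity. }
  apply Ceq_minus. apply NNPP. intros NE.
  assert (PE : 0 < Cmod (S x * S x - Ssq x)) by now apply Cmod_gt_0.
  destruct (C_derive_cont _ _ _ D _ PE) as [d1 [P1 H1]].
  destruct (open_disc U x HU Hx) as [d2 [P2 H2]].
  assert (P3 : 0 < Cmod (4 * x ^ 3)).
  { apply Cmod_gt_0, Cmult_neq_0; [|now apply Cpow_nz]. intros F. apply RtoC_inj in F. lra. }
  destruct (proj1 (is_C_derive_eps _ _ _) D4 (Cmod (4 * x ^ 3) / 2)%R ltac:(lra)) as [d3 [P3' H3]].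
  set (e := (Rmin d1 (Rmin d2 d3) / 2)%R).
  assert (Pm : 0 < Rmin d1 (Rmin d2 d3)) by (apply Rmin_glb_lt; [exact P1|now apply Rmin_glb_lt]).
  pose proof (Rmin_l d1 (Rmin d2 d3)) as M1. pose proof (Rmin_r d1 (Rmin d2 d3)) as M2.
  pose proof (Rmin_l d2 d3) as M3. pose proof (Rmin_r d2 d3) as M4.
  set (w := x + RtoC e). assert (Ew : Cmod (w - x) = e).
  { unfold w. replace (x + RtoC e - x) with (RtoC e) by ring. rewrite Cmod_R. apply Rabs_pos_eq. unfold e. lra. }
  specialize (H1 w ltac:(rewrite Ew; unfold e; lra)).
  specialize (H2 w ltac:(rewrite Ew; unfold e; lra)).
  specialize (H3 w ltac:(rewrite Ew; unfold e; lra)).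
  (* The derivative 4 x^3 is nonzero, so a small real displacement leaves the set x^4 = 5. *)
  assert (Nw : w ^ 4 <> 5).
  { intros F. rewrite F, E in H3. replace (5 - 5 - 4 * x ^ 3 * (w - x)) with (- (4 * x ^ 3 * (w - x))) in H3 by ring.
    rewrite Cmod_opp, (Cmod_mult (4 * x ^ 3) (w - x)), Ew in H3. assert (0 < e) by (unfold e; lra). nra. }
  cbv beta in H1. rewrite (S_sqr_generic w H2 Nw) in H1.
  replace (Ssq w - Ssq w - (S x * S x - Ssq x)) with (- (S x * S x - Ssq x)) in H1 by ring.
  rewrite Cmod_opp in H1. lra.
Qed.

Lemma S_nz (x : C) : U x -> S x <> 0.
Proof.
  intros Hx F. apply (Ssq_nz x Hx). rewrite <- S_sqr, F by exact Hx. ring.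
Qed.

Definition S1 (x : C) : C := Ssq1 x / (2 * S x).

Lemma S_derive (x : C) : U x -> is_C_derive S x (S1 x).
Proof.
  intros Hx. destruct (proj1 HS x Hx) as [l Hl]. pose proof (S_nz x Hx) as NS.
  assert (E : l * S x + S x * l = Ssq1 x).
  { apply C_derive_unique with (f := fun w => S w * S w) (z := x).
    - exact (C_derive_mult _ _ _ _ _ Hl Hl).
    - apply C_derive_ext_open with (U := U) (f := Ssq); auto.
      + intros w Hw. symmetry. now apply S_sqr.
      + now apply Ssq_derive. }
  apply C_derive_eq with (1 := Hl). unfold S1. rewrite <- E. field. exact NS.
Qed.

Lemma S1_derive (x : C) : U x -> is_C_derive S1 x (pot x * S x).
Proof.
  intros Hx. pose proof (S_nz x Hx) as NS. pose proof (S_sqr x Hx) as ES.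
  assert (N2 : 2 * S x <> 0) by (apply Cmult_neq_0; [apply C2_nz|exact NS]).
  eapply C_derive_eq.
  - exact (C_derive_div _ _ _ _ _ (Ssq1_derive x Hx) (C_derive_scal 2 _ _ _ (S_derive x Hx)) N2).
  - pose proof (Ssq_equation x Hx) as E. rewrite <- ES in E. unfold S1.
    replace ((Ssq2 x * (2 * S x) - Ssq1 x * (2 * (Ssq1 x / (2 * S x)))) / (2 * S x * (2 * S x))) with
      ((2 * (S x * S x) * Ssq2 x - Ssq1 x * Ssq1 x) / (4 * (S x * S x * S x))) by (field; exact NS).
    rewrite E. field. exact NS.
Qed.

Theorem solution_iff (HC : connected_set U) (Psi : C -> C) :
  ode_solution U Psi <-> exists A B : C, forall x : C, U x -> Psi x = S x * (A * tau x + B).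
Proof.
  split.
  - intros [P1 [P2 HP]].
    (* The constant w is the Wronskian of S and Psi. *)
    destruct (derive_0_const_connected U (fun x => P1 x * S x - Psi x * S1 x) HU HC) as [w Hw].
    { intros x Hx. destruct (HP x Hx) as [D1 [D2 E]].
      eapply C_derive_eq.
      - exact (C_derive_minus _ _ _ _ _ (C_derive_mult _ _ _ _ _ D2 (S_derive x Hx))
          (C_derive_mult _ _ _ _ _ D1 (S1_derive x Hx))).
      - rewrite E. unfold pot. ring. }
    (* The derivative of Psi / S is w / S^2, and tau' = kappa / S^2. *)
    destruct (derive_0_const_connected U (fun x => Psi x / S x - w / kappa * tau x) HU HC) as [B HB].
    { intros x Hx. destruct (HP x Hx) as [D1 _]. pose proof (S_nz x Hx) as NS. pose proof (Ssq_nz x Hx) as NR.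
      eapply C_derive_eq.
      - exact (C_derive_minus _ _ _ _ _ (C_derive_div _ _ _ _ _ D1 (S_derive x Hx) NS)
          (C_derive_scal (w / kappa) _ _ _ (tau_derive x Hx))).
      - rewrite (Hw x Hx), (S_sqr x Hx). field. split; [exact NR|exact kappa_nz]. }
    exists (w / kappa), B. intros x Hx. rewrite <- (HB x Hx). field. split; [exact kappa_nz|now apply S_nz].
  - intros [A [B HP]].
    (* The summand A kappa / S is S A tau'. Its derivative cancels S1 A tau', which leaves only the
       term with S''. *)
    exists (fun x => S1 x * (A * tau x + B) + A * kappa / S x),
      (fun x => pot x * S x * (A * tau x + B)).
    intros x Hx. pose proof (S_nz x Hx) as NS. pose proof (Ssq_nz x Hx) as NR. pose proof (S_sqr x Hx) as ES.
    assert (DT := C_derive_plus _ _ _ _ _ (C_derive_scal A _ _ _ (tau_derive x Hx)) (C_derive_const B x)).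
    assert (ET : A * (kappa / Ssq x) + 0 = A * kappa / (S x * S x)) by (rewrite ES; field; exact NR).
    rewrite ET in DT.
    split; [|split].
    + apply C_derive_ext_open with (U := U) (f := fun w => S w * (A * tau w + B)); auto.
      { intros w Hw. symmetry. auto. }
      eapply C_derive_eq; [exact (C_derive_mult _ _ _ _ _ (S_derive x Hx) DT)|]. cbv beta. field. exact NS.
    + eapply C_derive_eq.
      * exact (C_derive_plus _ _ _ _ _ (C_derive_mult _ _ _ _ _ (S1_derive x Hx) DT)
          (C_derive_div _ _ _ _ _ (C_derive_const (A * kappa) x) (S_derive x Hx) NS)).
      * cbv beta. field. exact NS.
    + rewrite (HP x Hx). unfold pot. ring.
Qed.

End Prefactor.

End Branch.

(** The two existence clauses keep the equivalence from being vacuous: every regular point carries a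
    branch of tau, and every branch locally carries a prefactor. Connectedness makes A and B
    constants on the whole domain. *)
Theorem proposition2 :
  (forall x0 : C, regular_point x0 ->
     exists (U : C -> Prop) (tau : C -> C),
       open U /\ U x0 /\ inverse_branch U tau) /\
  (forall (U : C -> Prop) (tau : C -> C),
     open U -> (forall x, U x -> regular_point x) -> inverse_branch U tau ->
     (forall x0 : C, U x0 ->
        exists (V : C -> Prop) (S : C -> C),
          open V /\ V x0 /\ (forall x, V x -> U x) /\
          prefactor_branch V tau S) /\
     (connected_set U ->
      forall S : C -> C, prefactor_branch U tau S ->
      forall Psi : C -> C,
        ode_solution U Psi <->
        exists A B : C, forall x : C, U x -> Psi x = S x * (A * tau x + B))).
Proof.
  split; [exact inverse_branch_exists|].
  intros U tau HU Hreg Htau. split.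
  - now apply prefactor_exists.
  - intros HC S HS Psi. now apply solution_iff.
Qed.
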